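(* Consider the PIMH-EM process $(\theta_i,\mathfrak{X}_i)_{i\ge0}$ defined in the context for the Poisson count model with random intensity, with state space $\mathsf{X}=\mathbb{R}^{n\times N}\times\{1,\ldots,N\}^{(n-1)\times N}$ and parameter space $\Theta=(0,\infty)$. Let the projection sets be $\mathcal{R}_i:=\{\theta\in\Theta:\underline\theta_i\le\theta\le\bar\theta_i\}$ and the projections $\theta_i^{\mathrm{proj}}:=(\underline\theta_i\vee\theta_i^* )\wedge\bar\theta_i$, with constant sequences $\underline\theta_i\downarrow0$ and $\bar\theta_i\uparrow\infty$ satisfying $$\liminf_{i\to\infty}\underline\theta_i\log(i)=\infty\qquad\text{and}\qquad\limsup_{i\to\infty}\frac{\bar\theta_i}{i^\epsilon}=0\quad\text{for all }\epsilon>0.$$ Let the step sizes be $\Gamma_i:=c_\gamma i^{-\eta_\gamma}\mathbb{I}\{U_i\le c_p i^{-\eta_p}\}$, where $c_\gamma,c_p\in(0,\infty)$, the constants $\eta_\gamma,\eta_p\in(0,1)$ satisfy $\eta_\gamma+\eta_p<1$, $2\eta_\gamma+\eta_p>1$ and $\eta_\gamma+2\eta_p>1$, and $(U_i)_{i\ge1}$ are uniform $(0,1)$ distributed random variables, $U_i$ being independent of the history $\mathcal{F}_{i-1}$ and $\mathfrak{X}_i$. Then there exist $0<c_1<c_2<\infty$ such that for any $(\theta,x)\in\mathcal{R}_0\times\mathsf{X}$, $$\mathbb{P}_{\theta,x}\Bigl(\bigcup_{m=1}^\infty\bigcap_{i=m}^\infty\{c_1\le\theta_i\le c_2\}\Bigr)=1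 .$$
   Context: Model. Fix $n\ge2$, $N\ge1$, $\rho\in(-1,1)$, $\sigma^2>0$ and observations $y_{1:n}=(y_1,\ldots,y_n)$, nonnegative integers with $\bar y:=\sum_{i=1}^ny_i>0$. The latent process is $X_1\sim N(0,(1-\rho^2)^{-1}\sigma^2)$, $X_k=\rho X_{k-1}+\sigma\epsilon_k$ for $2\le k\le n$, with $\epsilon_k$ independent standard Gaussian. The observations are conditionally independent with $Y_k\mid X_k\sim\mathrm{Poisson}(e^{\alpha+X_k})$. The unknown parameter is $\zeta:=\alpha\in\mathbb{R}$; $p_\zeta(y_k\mid x_k)$ is the Poisson probability of $y_k$ with mean $e^{\alpha+x_k}$. The sufficient statistic is $t(x_{1:n}):=\sum_{i=1}^ne^{x_i}$, taking values in $\Theta=(0,\infty)$, and the maximiser of the complete-data likelihood given sufficient statistic $\theta$ is $\hat\zeta(\theta)=\hat\alpha(\theta):=\log(\bar y/\theta)$. Particle filter $\mathrm{PF}(y_{1:n},\zeta)$ with $N$ particles and prior proposal $q_\zeta(x_k\mid x_{1:k-1},y_{1:k})=N(x_k;\rho x_{k-1},\sigma^2)$: the particles $\tilde x_1^j$, $j=1,\ldots,N$, are i.i.d. $N(0,\sigma^2/(1-\rho^2))$ (equivalently, propagated from an artificial exactly stationary initial state at time $0$). For $k=2,\ldots,n$: draw ancestor indices $a_{k-1}^j\in\{1,\ldots,N\}$, $j=1,\ldots,N$, by (multinomial) resampling with probabilities proportional to $p_\zeta(y_{k-1}\mid\tilde x_{k-1}^i)$, $i=1,\ldots,N$, then draw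 independently $\tilde x_k^j\sim N(\rho\,\tilde x_{k-1}^{a_{k-1}^j},\sigma^2)$. The output is $(\tilde{\mathbf{x}},\mathbf{a})$ with $\tilde{\mathbf{x}}=(\tilde x_k^j)\in\mathbb{R}^{n\times N}$ and $\mathbf{a}\in\{1,\ldots,N\}^{(n-1)\times N}$. For $j\in\{1,\dots,N\}$, $\bar x_{1:n}(\tilde{\mathbf{x}},\mathbf{a},j)=(\tilde x_1^{b_1},\ldots,\tilde x_n^{b_n})$ is the trajectory with $b_n=j$, $b_k=a_k^{b_{k+1}}$, and $\bar w(\tilde{\mathbf{x}},\mathbf{a},j)=p_\zeta(y_n\mid\tilde x_n^j)/\sum_ip_\zeta(y_n\mid\tilde x_n^i)$ is its normalised weight as computed by the particle filter that generated it. (The weights are part of the filter output; the likelihood estimate is $\hat Z_\zeta(\tilde{\mathbf{x}}):=\prod_{k=1}^n\frac1N\sum_{i=1}^Np_\zeta(y_k\mid\tilde x_k^i)$.) In what follows one only uses that $\bar w\in[0,1]$ with $\sum_j\bar w(\tilde{\mathbf{x}},\mathbf{a},j)=1$ and the recursion below with parameter $\zeta=\hat\zeta(\theta)$ inside $H(\theta,\cdot)$. PIMH kernel. $P_\theta$ on $\mathsf{X}$: from state $(\tilde{\mathbf{x}},\mathbf{a})$ propose $(\tilde{\mathbf{x}}_*,\mathbf{a}_* )\sim\mathrm{PF}(y_{1:n},\hat\zeta(\theta))$ and accept it with probability $\min\{1,\hat Z_{\hat\zeta(\theta)}(\tilde{\mathbf{x}}_* )/\hat Z_{\hat\zeta(\theta)}(\tilde{\mathbf{x}})\}$,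 otherwise stay at $(\tilde{\mathbf{x}},\mathbf{a})$. Process. Let $H(\theta,(\tilde{\mathbf{x}},\mathbf{a})):=\sum_{k=1}^N\bar w(\tilde{\mathbf{x}},\mathbf{a},k)\,t(\bar x_{1:n}(\tilde{\mathbf{x}},\mathbf{a},k))-\theta$. Starting from $(\theta_0,\mathfrak{X}_0)=(\theta,x)\in\mathcal{R}_0\times\mathsf{X}$, for $i\ge1$: $\mathfrak{X}_i\mid\mathcal{F}_{i-1}\sim P_{\theta_{i-1}}(\mathfrak{X}_{i-1},\cdot)$; $\theta_i^*=\theta_{i-1}+\Gamma_iH(\theta_{i-1},\mathfrak{X}_i)$; $\theta_i=\theta_i^*$ if $\theta_i^*\in\mathcal{R}_i$ and $\theta_i=\theta_i^{\mathrm{proj}}$ otherwise. Here $\mathcal{F}_i$ is generated by $\theta_0,\mathfrak{X}_0,\theta_1,\mathfrak{X}_1,\Gamma_1,\ldots,\theta_i,\mathfrak{X}_i,\Gamma_i$ and $\mathbb{P}_{\theta,x}$ is the law of the process started at $(\theta,x)$. $a\vee b=\max\{a,b\}$, $a\wedge b=\min\{a,b\}$. *)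

(* Defs.v *)
(* MathComp-Analysis, over an arbitrary R : realType. *)
From HB Require Import structures.
From mathcomp Require Import all_boot all_order all_algebra.
From mathcomp Require Import all_classical all_reals all_analysis.

Set Implicit Arguments.
Unset Strict Implicit.
Unset Printing Implicit Defensive.

Import Order.TTheory GRing.Theory Num.Theory.
Import numFieldNormedType.Exports.

Local Open Scope classical_set_scope.
Local Open Scope ring_scope.

(* Discrete sigma-algebra on the index type of the particles. *)
HB.instance Definition _ (N : nat) := isPointed.Build 'I_N.+1 ord0.
HB.instance Definition _ (N : nat) :=
  @isMeasurable.Build default_measure_display 'I_N.+1 discrete_measurable
    discrete_measurable0 discrete_measurableC discrete_measurableU.

(* Times are numbered from 0, so that the n observation times of the model are
   the elements of 'I_m.+1 with n = m + 1.  The number of particles is N.+1: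
   'I_0 is empty and cannot carry a measurableType structure. *)
Notation particles R N := (N.+1.-tuple R).
Notation ancestors N := (N.+1.-tuple 'I_N.+1).
Notation pf_state R m N :=
  ((m.+1.-tuple (particles R N)) * (m.-tuple (ancestors N)))%type.

(* A law is given by the integrals of the nonnegative functions against it;
   composing such functionals is sequential sampling. *)
Definition integrator (R : realType) (T : Type) := (T -> \bar R) -> \bar R.

(* Law of (t_0, ..., t_{n-1}) for independent t_i drawn according to E i. *)
Fixpoint independent_draws (R : realType) (T : Type) (n : nat) :
    ('I_n -> integrator R T) -> integrator R (n.-tuple T) :=
  match n with
  | 0 => fun _ F => F [tuple]
  | n'.+1 => fun E F =>
      E ord0 (fun t =>
        independent_draws (fun i => E (lift ord0 i))
          (fun ts => F [tuple of t :: ts]))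
  end.

Section model.
Context {R : realType}.
Variables (m N : nat) (y : m.+1.-tuple nat) (rho sigma : R).
Implicit Types (alpha theta : R) (x : particles R N) (z : pf_state R m N).

Definition ybar : nat := (\sum_(k < m.+1) tnth y k)%N.

Definition obs_prob alpha (yk : nat) (u : R) : R :=
  poisson_pmf (expR (alpha + u)) yk.

Definition suff_stat (u : m.+1.-tuple R) : R := \sum_(k < m.+1) expR (tnth u k).

Definition alpha_hat theta : R := ln (ybar%:R / theta).

Definition norm_weight alpha (yk : nat) x (i : 'I_N.+1) : R :=
  obs_prob alpha yk (tnth x i) / \sum_(l < N.+1) obs_prob alpha yk (tnth x l).

(* The second argument of normal_prob is the standard deviation. *)
Definition pf_init : integrator R (particles R N) :=
  independent_draws (fun _ f =>
    (\int[normal_prob 0 (Num.sqrt (sigma ^+ 2 / (1 - rho ^+ 2)))]_u f u)%E).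

Definition pf_resample alpha (yk : nat) x : integrator R (ancestors N) :=
  independent_draws (fun _ f =>
    (\sum_(i < N.+1) (norm_weight alpha yk x i)%:E * f i)%E).

Definition pf_propagate x (a : ancestors N) : integrator R (particles R N) :=
  independent_draws (fun j f =>
    (\int[normal_prob (rho * tnth x (tnth a j)) sigma]_u f u)%E).

(* The r remaining steps of the filter from the particles x at time k. *)
Fixpoint pf_steps alpha (r k : nat) x :
    integrator R (r.-tuple (particles R N) * r.-tuple (ancestors N)) :=
  match r with
  | 0 => fun F => F ([tuple], [tuple])
  | r'.+1 => fun F =>
      pf_resample alpha (nth 0%N y k) x (fun a =>
        pf_propagate x a (fun x' =>
          pf_steps alpha k.+1 x' (fun xas : r'.-tuple _ * r'.-tuple _ =>
            F ([tuple of x' :: xas.1], [tuple of a :: xas.2]))))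
  end.

Definition particle_filter alpha : integrator R (pf_state R m N) := fun F =>
  pf_init (fun x0 =>
    pf_steps alpha 0 x0 (fun xas : m.-tuple _ * m.-tuple _ =>
      F ([tuple of x0 :: xas.1], xas.2))).

(* b_m = j and b_k = a_k^{b_{k+1}} for k < m. *)
Definition lineage (a : m.-tuple (ancestors N)) (j : 'I_N.+1) (k : nat) :
    'I_N.+1 :=
  foldr (fun ak b => tnth ak b) j (drop k a).

Definition trajectory z (j : 'I_N.+1) : m.+1.-tuple R :=
  [tuple tnth (tnth z.1 k) (lineage z.2 j k) | k < m.+1].

Definition Zhat alpha z : R :=
  \prod_(k < m.+1)
    ((N.+1%:R)^-1 *
     \sum_(i < N.+1) obs_prob alpha (tnth y k) (tnth (tnth z.1 k) i)).

Definition accept_prob theta z z' : R :=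
  Num.min 1 (Zhat (alpha_hat theta) z' / Zhat (alpha_hat theta) z).

(* P_theta(z, B): the proposal z' replaces z when it is accepted. *)
Definition pimh_kernel theta z (B : set (pf_state R m N)) : \bar R :=
  particle_filter (alpha_hat theta) (fun z' =>
    (accept_prob theta z z' * \1_B z' +
     (1 - accept_prob theta z z') * \1_B z)%:E).

(* The final weights are those of the parameter alpha_hat theta. *)
Definition H theta z : R :=
  (\sum_(j < N.+1)
     norm_weight (alpha_hat theta) (tnth y ord_max) (tnth z.1 ord_max) j *
     suff_stat (trajectory z j)) - theta.

End model.

Definition proj_set (R : realType) (lo hi : R^nat) (i : nat) : set R :=
  [set theta | 0 < theta /\ lo i <= theta <= hi i].

Definition step_size (R : realType) (cg cp etag etap : R) (T : Type)
    (U : nat -> T -> R) (i : nat) (w : T) : R :=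
  cg * i%:R `^ (- etag) * \1_[set w | U i w <= cp * i%:R `^ (- etap)] w.

Section process.
Context {R : realType} {d : measure_display} {Omega : measurableType d}.
Variables (m N : nat).
Implicit Types (theta Gamma : nat -> Omega -> R)
  (X : nat -> Omega -> pf_state R m N).

(* Generators of F_i; there is no Gamma_0. *)
Definition history_gen theta X Gamma (i : nat) : set (set Omega) :=
  \bigcup_(k in [set k | (k <= i)%N])
     (preimage_set_system setT (theta k) measurable `|`
      preimage_set_system setT (X k) measurable)
  `|` \bigcup_(k in [set k | (1 <= k <= i)%N])
     preimage_set_system setT (Gamma k) measurable.

Definition history theta X Gamma (i : nat) : set (set Omega) :=
  <<s history_gen theta X Gamma i >>.

Definition history_next theta X Gamma (i : nat) : set (set Omega) :=
  <<s history_gen theta X Gamma i `|`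
      preimage_set_system setT (X i.+1) measurable >>.

(* The process started at (theta0, x0), as a family of random variables on
   some probability space. *)
Record pimh_em_process (P : probability Omega R)
    (y : m.+1.-tuple nat) (rho sigma : R) (lo hi : R^nat)
    (cg cp etag etap : R) (theta0 : R) (x0 : pf_state R m N)
    (U theta : nat -> {mfun Omega >-> R})
    (X : nat -> {mfun Omega >-> pf_state R m N}) : Prop := PimhEmProcess {
  process_init : forall w, theta 0%N w = theta0 /\ X 0%N w = x0 ;
  process_kernel : forall i A B,
    history theta X (step_size cg cp etag etap U) i A -> measurable B ->
    P (A `&` X i.+1 @^-1` B) =
      (\int[P]_(w in A) pimh_kernel y rho sigma (theta i w) (X i w) B)%E ;
  process_uniform : forall i B, measurable B ->
    distribution P (U i.+1) B = uniform_prob (@ltr01 R) B ;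
  process_indep : forall i A B,
    history_next theta X (step_size cg cp etag etap U) i A -> measurable B ->
    P (A `&` U i.+1 @^-1` B) = (P A * P (U i.+1 @^-1` B))%E ;
  process_update : forall i w,
    let theta_star := theta i w +
      step_size cg cp etag etap U i.+1 w * H y (theta i w) (X i.+1 w) in
    theta i.+1 w =
      if theta_star \in proj_set lo hi i.+1 then theta_star
      else Num.min (Num.max (lo i.+1) theta_star) (hi i.+1)
}.

End process.

(* Main.v *)
From HB Require Import structures.
Require Import Defs.
From mathcomp Require Import all_boot all_order all_algebra.
From mathcomp Require Import ring lra.
From mathcomp Require Import all_classical all_reals all_analysis.
From mathcomp Require Import measurable_realfun.
Import Order.TTheory GRing.Theory Num.Theory.
Import numFieldNormedType.Exports.
Local Open Scope classical_set_scope.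
Local Open Scope ring_scope.
Set Implicit Arguments.
Unset Strict Implicit.
Unset Printing Implicit Defensive.

(** The squared distance [dist2] of the iterates to a fixed interval [a, b] is
    shown to tend to 0 almost surely; the constants are then a / 2 and b + a / 2.
    Write S(z) for the weighted statistic of a filter output z, so that
    H theta z = S(z) - theta, and |z| for the l1 norm of its particles.

    Above b the term - theta pulls down and S pushes up. Although a fresh filter
    run has exponential moments that are bounded uniformly in the parameter
    ([filter_moment]), S is unbounded, and a rejection keeps the old state. But
    for theta >= 1 a proposal is accepted from z with probability at least
    c exp(- ybar |z|) ([accept_ge]), so that the function
    G = g exp((1 + ybar) |z|), for a suitable g, decreases on average by at least
    maxstat = (m + 1) exp |z| >= S, up to a constant: P(G + maxstat) <= G + b
    ([drift_large]).

    Below a the statistic exceeds 4 theta, and pushes up, unless some trajectory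
    of the state lies under - s = ln (4 theta); call the state low in that case.
    A fresh run is low with probability at most (N + 1)^(m + 1) exp(- Q s^2)
    ([filter_low_le], an exponential tilt along each trajectory), Q being the
    cost of keeping a stationary AR(1) path at a constant level. From any state,
    the chain reaches a state that is not low with a probability at least three
    times as large ([escape_ge], [escape_rate]): if particle 0 follows a path at
    level - (s - D) then the likelihood estimate is bounded below, so that the
    proposal is accepted, and the cost exp(- Q (s - D)^2) of that path wins
    against exp(- Q s^2) when D is large. So a low state is left at a rate r and
    the others become low at a rate at most r / 3, and K = 2 theta / r satisfies
    P((K + 4 theta) 1_low) <= K 1_low + 2 theta ([drift_small]). The price is
    the size of K, at most exp(q / theta).

    Let gamma_i be the mean step size and V_i = dist2(theta_i) + gamma_i C(theta_i, X_i)
    with the correction C = 2 (theta - b)^+ G + 2 (a - theta)^+ K 1_low. Both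
    inequalities say that, given the past, V decreases on average by at least
    gamma_i lo_i / a times dist2(theta_i), up to an error b_i
    ([correction_drift], [lyapunov_step], [integrated_drift]). The error is of
    second order in the step sizes, times powers of hi_i, exp(q / lo_i) and
    exponential moments of X_i; these three are smaller than any power of i, by
    the rates assumed on the projection bounds and by [state_moment_rate]. So
    the b_i are summable because 2 etag + etap > 1 and etag + 2 etap > 1,
    whereas the gamma_i lo_i are not because etag + etap < 1 ([step_rates]).
    Hence the mean of dist2 is small at arbitrarily late times, and a maximal
    inequality keeps dist2 small from then on ([almost_supermartingale_cvg0]).

    The laws of the model are functionals on nonnegative functions. [kernelized]
    relates them to probability kernels, from which additivity and measurability
    follow, while monotonicity is proved for arbitrary functions. *)

(** * Functionals given by probability kernels *)

Lemma le_of_eq {disp} {T : porderType disp} (x y : T) : x = y -> (x <= y)%O.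
Proof. by move=> ->. Qed.

Section kernelized.
Local Open Scope ereal_scope.
Context {R : realType}.

(** Only nonnegative measurable functions are tested: elsewhere an iterated
    integral need not be an integral. *)
Definition kernelized {d d'} {S : measurableType d} {T : measurableType d'}
    (E : S -> integrator R T) : Prop :=
  exists k : R.-pker S ~> T, forall s (f : T -> \bar R), measurable_fun setT f ->
    (forall t, 0 <= f t) -> E s f = \int[k s]_t f t.

Lemma kernelizedI {d d'} {S : measurableType d} {T : measurableType d'}
    (E : S -> integrator R T) (mu : S -> {measure set T -> \bar R}) :
  (forall U, measurable U -> measurable_fun setT (fun s => mu s U)) ->
  (forall s, mu s setT = 1) ->
  (forall s (f : T -> \bar R), measurable_fun setT f -> (forall t, 0 <= f t) ->
     E s f = \int[mu s]_t f t) ->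
  kernelized E.
Proof.
move=> mmu mu1 hE.
pose M := @isKernel.Build _ _ S T R mu mmu.
pose K : R.-ker S ~> T := HB.pack mu M.
pose PM := @Kernel_isProbability.Build _ _ S T R K mu1.
pose PK : R.-pker S ~> T := HB.pack mu M PM.
by exists PK.
Qed.

Lemma kernelized_dirac {d d'} {S : measurableType d} {T : measurableType d'}
    (g : S -> T) : measurable_fun setT g -> kernelized (fun s f => f (g s)).
Proof.
move=> mg; exists (kdirac mg) => s f mf f0 /=.
by rewrite /kdirac integral_dirac ?diracT ?mul1e.
Qed.

Lemma kernelized_bind {d d' d2} {S : measurableType d} {T : measurableType d'}
    {U : measurableType d2} (E1 : S -> integrator R T)
    (E2 : S * T -> integrator R U) :
  kernelized E1 -> kernelized E2 ->
  kernelized (fun s f => E1 s (fun t => E2 (s, t) f)).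
Proof.
move=> [k1 h1] [k2 h2].
refine (@kernelizedI _ _ _ _ _ (mkcomp k1 k2) _ _ _).
- by move=> V mV; exact: measurable_kernel.
- move=> s; rewrite /= /kcomp.
  under eq_integral do rewrite prob_kernel.
  by rewrite integral_cst// prob_kernel mule1.
- move=> s f mf f0; rewrite /mkcomp integral_kcomp//.
  rewrite h1.
  + by apply: eq_integral => t _; rewrite h2.
  + under eq_fun do rewrite h2//.
    apply: (@measurable_fun_integral_kernel _ _ _ _ _ (fun t => k2 (s, t))) => //.
    move=> V mV; exact: (measurableT_comp (measurable_kernel k2 V mV) (pair1_measurable s)).
  + by move=> t; rewrite h2//; apply: integral_ge0.
Qed.

Lemma kernelized_comp {d d' d2} {S : measurableType d} {T : measurableType d'}
    {U : measurableType d2} (E : T -> integrator R U) (g : S -> T) :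
  measurable_fun setT g -> kernelized E -> kernelized (fun s => E (g s)).
Proof.
move=> mg [k hk]; apply: (@kernelizedI _ _ _ _ _ (fun s => k (g s))).
- by move=> V mV; apply: (measurableT_comp (measurable_kernel k V mV)).
- by move=> s; rewrite prob_kernel.
- by move=> s f mf f0; rewrite hk.
Qed.

Lemma kernelized_map {d d' d2} {S : measurableType d} {T : measurableType d'}
    {U : measurableType d2} (E : S -> integrator R T) (g : S * T -> U) :
  measurable_fun setT g -> kernelized E ->
  kernelized (fun s f => E s (fun t => f (g (s, t)))).
Proof.
move=> mg hE; have hg := kernelized_dirac mg.
exact: (kernelized_bind hE hg).
Qed.

Lemma kernelized_mixture {d d'} {S : measurableType d} {T : measurableType d'}
    n (p : 'I_n -> S -> R) (g : 'I_n -> S -> T) :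
  (forall i, measurable_fun setT (p i)) ->
  (forall i, measurable_fun setT (g i)) ->
  (forall i s, 0 <= p i s)%R -> (forall s, \sum_(i < n) p i s = 1)%R ->
  kernelized (fun s f => \sum_(i < n) (p i s)%:E * f (g i s)).
Proof.
case: n p g => [|n] p g mp mg p0 p1.
  exfalso; have := p1 point; rewrite big_ord0 => /esym/eqP.
  by rewrite oner_eq0.
pose m s : nat -> {measure set T -> \bar R} := fun j =>
   mscale (NngNum (p0 (inord j) s)) (dirac (g (inord j) s)).
have E s f : measurable_fun setT f -> (forall t, 0 <= f t) ->
   \int[msum (m s) n.+1]_t f t = \sum_(i < n.+1) (p i s)%:E * f (g i s).
  move=> mf f0; rewrite ge0_integral_measure_sum//; apply: eq_bigr => i _.
  by rewrite ge0_integral_mscale//= integral_dirac// diracT mul1e inord_val.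
have mE s U : msum (m s) n.+1 U = \sum_(i < n.+1) (p i s)%:E * \d_(g i s) U.
  by apply: eq_bigr => i _; rewrite /m /mscale/= inord_val.
apply: (@kernelizedI _ _ _ _ _ (fun s => msum (m s) n.+1)).
- move=> U mU; rewrite (_ : (fun s => _) =
      (fun s => \sum_(i < n.+1) (p i s)%:E * \d_(g i s) U)); last first.
    by apply/funext => s; exact: mE.
  apply: emeasurable_sum => i; apply: emeasurable_funM.
    exact/measurable_EFinP.
  exact: (measurable_kernel (kdirac (mg i)) U mU).
- move=> s; transitivity (\sum_(i < n.+1) (p i s)%:E * \d_(g i s) setT).
    exact: mE.
  under eq_bigr do rewrite diracT mule1.
  by rewrite sumEFin p1.
- by move=> s f mf f0; rewrite -E.
Qed.

Lemma kernelized_draws {d d'} {S : measurableType d} {T : measurableType d'}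
    n (E : 'I_n -> S -> integrator R T) :
  (forall i, kernelized (E i)) ->
  kernelized (fun s => independent_draws (fun i => E i s)).
Proof.
elim: n d S E => [|n IH] d S E hE /=.
  exact: (@kernelized_dirac _ _ S (0.-tuple T) (fun=> [tuple]) (measurable_cst _)).
pose E2 (st : S * T) : integrator R (n.+1.-tuple T) := fun F =>
   independent_draws (fun i => E (lift ord0 i) st.1)
     (fun ts => F [tuple of st.2 :: ts]).
have : kernelized E2.
  apply: (@kernelized_map _ _ _ _ _ _ (fun st : S * T => independent_draws (fun i => E (lift ord0 i) st.1))
     (fun p => [tuple of p.1.2 :: p.2])).
    apply: measurable_cons => //.
    by apply: measurableT_comp => //.
  apply: (@kernelized_comp _ _ _ _ _ _ (fun s => independent_draws (fun i => E (lift ord0 i) s)) fst) => //.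
  by apply: IH.
exact: (kernelized_bind (hE ord0)).
Qed.

End kernelized.

(** * Normal laws *)

Section density.
Local Open Scope ereal_scope.
Context d (T : measurableType d) (R : realType).
Variables (mu nu : {measure set T -> \bar R}) (g : T -> R).
Hypotheses (mg : measurable_fun setT g) (g0 : forall x, (0 <= g x)%R).
Hypothesis nuE : forall A, measurable A -> nu A = \int[mu]_(x in A) (g x)%:E.

Import HBNNSimple.

Let integral_density_indic A : measurable A ->
  \int[nu]_x (\1_A x)%:E = \int[mu]_x ((\1_A x)%:E * (g x)%:E).
Proof.
move=> mA; rewrite integral_indic// setIT nuE// integral_mkcond.
apply: eq_integral => x _; rewrite patchE indicE.
by case: ifPn => _; rewrite ?mul1e ?mul0e.
Qed.

Let integral_density_nnsfun (f : {nnsfun T >-> R}) :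
  \int[nu]_x (f x)%:E = \int[mu]_x ((f x)%:E * (g x)%:E).
Proof.
under [LHS]eq_integral do rewrite fimfunE -fsumEFin//.
rewrite [LHS]ge0_integral_fsum//; last 2 first.
  - by move=> r; exact/measurable_EFinP/measurableT_comp.
  - by move=> n x _; rewrite EFinM nnfun_muleindic_ge0.
under [RHS]eq_integral.
  move=> x _; rewrite fimfunE -fsumEFin// ge0_mule_fsuml; last first.
    by move=> r; rewrite EFinM nnfun_muleindic_ge0.
  over.
rewrite [RHS]ge0_integral_fsum//; last 2 first.
  - move=> r; apply: emeasurable_funM; last exact/measurable_EFinP.
    exact/measurable_EFinP/measurableT_comp.
  - move=> n x _; apply: mule_ge0; last by rewrite lee_fin.
    by rewrite EFinM nnfun_muleindic_ge0.
apply: eq_fsbigr => r _.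
under [RHS]eq_integral do rewrite EFinM -muleA.
have [r0|r0] := leP 0%R r.
  rewrite ge0_integralZl//; last 2 first.
  - apply: emeasurable_funM; last exact/measurable_EFinP.
    exact/measurable_EFinP.
  - by move=> x _; rewrite mule_ge0 ?lee_fin.
  rewrite -integral_density_indic//.
  under eq_integral do rewrite EFinM.
  by rewrite ge0_integralZl//; exact/measurable_EFinP.
rewrite integral0_eq; last first.
  by move=> x _; rewrite preimage_nnfun0// indic0 mulr0.
rewrite integral0_eq// => x _.
by rewrite preimage_nnfun0// indic0 mul0e mule0.
Qed.

(** A normal law is defined by the integrals of its density over sets; the
    identity passes to functions through simple functions. *)
Lemma integral_density (f : T -> \bar R) : measurable_fun setT f ->
  (forall x, 0 <= f x) -> \int[nu]_x f x = \int[mu]_x (f x * (g x)%:E).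
Proof.
move=> mf f0; pose f_ := nnsfun_approx measurableT mf.
transitivity (limn (fun n => \int[nu]_x (f_ n x)%:E)).
  rewrite -monotone_convergence//=.
  - apply: eq_integral => x _; apply/esym/cvg_lim => //=.
    exact: cvg_nnsfun_approx.
  - by move=> n; exact/measurable_EFinP.
  - by move=> n x _; rewrite lee_fin.
  - by move=> x _ a b ab; rewrite lee_fin; exact/lefP/nd_nnsfun_approx.
transitivity (limn (fun n => \int[mu]_x ((f_ n x)%:E * (g x)%:E))).
  by congr (limn _); apply/funext => n; exact: integral_density_nnsfun.
rewrite -monotone_convergence//=.
- apply: eq_integral => x _; apply/cvg_lim => //=.
  apply: cvgeZr => //.
  exact: cvg_nnsfun_approx.
- move=> n; apply: emeasurable_funM; exact/measurable_EFinP.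
- by move=> n x _; rewrite mule_ge0 ?lee_fin.
- move=> x _ a b ab; apply: lee_wpmul2r; rewrite lee_fin//.
  exact/lefP/nd_nnsfun_approx.
Qed.

End density.

Section le_integral_raw.
Local Open Scope ereal_scope.
Context d (T : measurableType d) (R : realType).
Import HBNNSimple.

(** The integral of a nonnegative function is a supremum over the simple
    functions below it, so no measurability is involved. This spares a
    measurability proof for each integrand of the filter. *)
Lemma ge0_le_integral_any (mu : {measure set T -> \bar R}) (f g : T -> \bar R) :
  (forall x, 0 <= f x) -> (forall x, f x <= g x) ->
  \int[mu]_x f x <= \int[mu]_x g x.
Proof.
move=> f0 fg.
have g0 x : 0 <= g x by apply: le_trans (fg x).
rewrite !ge0_integralTE//; apply: le_ereal_sup => _ [h /= hf <-].
by exists h => // x; apply: le_trans (fg x).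
Qed.

End le_integral_raw.

Section normal.
Local Open Scope ereal_scope.
Context {R : realType}.
Implicit Types (mu s k : R).

Lemma integral_normal_prob mu s (f : R -> \bar R) :
  measurable_fun setT f -> (forall x, 0 <= f x) ->
  \int[normal_prob mu s]_x f x =
  \int[lebesgue_measure]_x (f x * (normal_pdf mu s x)%:E).
Proof.
move=> mf f0; refine (@integral_density _ _ _ lebesgue_measure (normal_prob mu s) (normal_pdf mu s) (measurable_normal_pdf mu s) _ _ f mf f0) => //.
exact: normal_pdf_ge0.
Qed.

(** Completing the square: the exponential times the density is a multiple of
    the density with mean shifted by k s^2. *)
Lemma normal_mgf mu s k : s != 0%R ->
  \int[normal_prob mu s]_x (expR (k * x))%:E =
  (expR (k * mu + k ^+ 2 * s ^+ 2 / 2))%:E.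
Proof.
move=> s0; rewrite integral_normal_prob//; last first.
  by apply/measurable_EFinP; apply: measurableT_comp => //; exact: measurable_funM.
transitivity (\int[lebesgue_measure]_x
    ((expR (k * mu + k ^+ 2 * s ^+ 2 / 2))%:E *
     (normal_pdf (mu + k * s ^+ 2) s x)%:E)).
  apply: eq_integral => x _; rewrite -!EFinM !normal_pdfE//; congr EFin.
  rewrite mulrCA [RHS]mulrCA; congr (_ * _)%R; rewrite /normal_fun -!expRD; congr expR.
  by field.
rewrite ge0_integralZl//; last 2 first.
- by apply/measurable_EFinP; exact: measurable_normal_pdf.
- by move=> x _; rewrite lee_fin normal_pdf_ge0.
by rewrite integral_normal_pdf mule1.
Qed.

(** The density on the interval is at least its value at distance M of the mean. *)
Lemma normal_prob_itv_ge mu s a b M : s != 0%R -> (a <= b)%R ->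
  (forall x, (a <= x <= b)%R -> (`|x - mu| <= M)%R) ->
  ((b - a) * normal_peak s * expR (- M ^+ 2 / (s ^+ 2 *+ 2)))%:E <=
    normal_prob mu s `[a, b]%classic.
Proof.
move=> s0 ab hM; rewrite /normal_prob.
apply: (@le_trans _ _ (\int[lebesgue_measure]_(x in `[a, b])
   (normal_peak s * expR (- M ^+ 2 / (s ^+ 2 *+ 2)))%:E)).
  rewrite integral_cst//= lebesgue_measure_itv/= lte_fin.
  have [ltab|ba] := ltP a b.
    by rewrite -EFinD -EFinM lee_fin [leRHS]mulrC mulrA lexx.
  by rewrite mule0 lee_fin (@le_anti _ _ a b) ?ab// subrr !mul0r.
apply: ge0_le_integral => //=.
- by move=> x _; rewrite lee_fin mulr_ge0 ?normal_peak_ge0 ?expR_ge0.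
- apply/measurable_EFinP; apply: measurable_funTS; exact: measurable_normal_pdf.
- move=> x; rewrite in_itv/= => /hM xM.
  rewrite lee_fin normal_pdfE// ler_wpM2l ?normal_peak_ge0//.
  rewrite ler_expR ler_wpM2r ?invr_ge0 ?mulrn_wge0 ?sqr_ge0// lerN2.
  rewrite -[leLHS]real_normK ?num_real// lerXn2r ?nnegrE//.
  exact: le_trans xM.
Qed.

Lemma kernelized_normal {d} {S : measurableType d} (h : S -> R) s :
  s != 0%R -> measurable_fun setT h ->
  kernelized (fun t (f : R -> \bar R) => \int[normal_prob (h t) s]_u f u).
Proof.
move=> s0 mh.
(* The normal law lives on another copy of the measurable space of reals; it
   is carried over by the identity. *)
have mid : @measurable_fun _ _ (measurableTypeR R) R setT idfun.
  by move=> _ B mB; rewrite setTI.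
pose Mid := @isMeasurableFun.Build _ _ (measurableTypeR R) R idfun mid.
pose X : {mfun measurableTypeR R >-> R} := HB.pack (idfun : R -> R) Mid.
apply: (@kernelizedI R _ _ S R _ (fun t => distribution (normal_prob (h t) s) X)).
- move=> U mU.
pose F (p : S * R) := ((fun x => (normal_pdf (h p.1) s x)%:E) \_ U) p.2.
rewrite (_ : (fun t => _) = (fun t => \int[lebesgue_measure]_x F (t, x))); last first.
  by apply/funext => t; rewrite /= /normal_prob integral_mkcond.
apply: (@measurable_fun_fubini_tonelli_F _ _ _ _ _ lebesgue_measure F); last first.
  by move=> [t x]; rewrite /F/= patchE; case: ifPn => // _; rewrite lee_fin normal_pdf_ge0.
have -> : F = (fun p => (\1_U p.2)%:E * (normal_pdf (h p.1) s p.2)%:E).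
  apply/funext => -[t x]; rewrite /F/= patchE indicE.
  by case: ifPn => _; rewrite ?mul1e ?mul0e.
apply: emeasurable_funM.
  apply/measurable_EFinP.
  by apply: (measurableT_comp (measurable_indic mU)).
apply/measurable_EFinP.
under eq_fun do rewrite normal_pdfE//.
apply: measurable_funM => //.
apply: measurableT_comp => //.
apply: measurable_funM => //.
apply: measurableT_comp => //.
apply: measurable_funX.
apply: measurable_funB => //.
by apply: measurableT_comp.
- by move=> t; exact: probability_setT.
- by move=> t f mf f0; rewrite ge0_integral_distribution.
Qed.

End normal.

(** * The particle filter as a kernel *)

Section measurability_tools.
Context {R : realType} {d : measure_display} {S : measurableType d}.

(** The identity 1 / x = x exp(- ln (x^2)) holds at 0 too, where both sides are 0. *)
Lemma measurable_invR : measurable_fun setT (fun x : R => x^-1).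
Proof.
rewrite (_ : (fun x => _) = (fun x => x * expR (- ln (x ^+ 2)))).
  apply: measurable_funM => //; apply: measurableT_comp => //.
  by apply: measurableT_comp => //; apply: measurableT_comp => //.
apply/funext => x; have [->|x0] := eqVneq x 0; first by rewrite invr0 mul0r.
rewrite expRN lnK; last by rewrite posrE exprn_even_gt0.
by rewrite expr2 invfM mulrA mulfV// mul1r.
Qed.

Lemma measurable_select N (g : S -> 'I_N.+1) (h : 'I_N.+1 -> S -> R) :
  measurable_fun setT g -> (forall i, measurable_fun setT (h i)) ->
  measurable_fun setT (fun s => h (g s) s).
Proof.
move=> mg mh.
rewrite (_ : (fun s => _) =
    (fun s => \sum_(i < N.+1) \1_(g @^-1` [set i]) s * h i s)).
  apply: measurable_sum => i; apply: measurable_funM => //.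
  apply: measurable_indic; rewrite -[X in measurable X]setTI.
  by apply: mg => //.
apply/funext => s; rewrite (bigD1 (g s))//= big1 ?addr0 => [|i ig].
  by rewrite indicE mem_set// mul1r.
by rewrite indicE memNset ?mul0r//= => /esym/eqP; rewrite (negbTE ig).
Qed.

Lemma measurable_tnthT d' (T : measurableType d') n (g : S -> n.-tuple T) i :
  measurable_fun setT g -> measurable_fun setT (fun s => tnth (g s) i).
Proof.
by move=> mg; apply: (measurableT_comp (measurable_tnth i)).
Qed.

End measurability_tools.

Section monotone_integrators.
Local Open Scope ereal_scope.
Context {R : realType}.

(** Monotone on all nonnegative functions, measurable or not, so that
    compositions are monotone without side conditions. *)
Definition monotone_integrator T (E : integrator R T) : Prop :=
  (forall f, (forall t, 0 <= f t) -> 0 <= E f) /\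
  (forall f g, (forall t, 0 <= f t) -> (forall t, f t <= g t) -> E f <= E g).

Lemma monotone_draws T n (E : 'I_n -> integrator R T) :
  (forall i, monotone_integrator (E i)) ->
  monotone_integrator (independent_draws E).
Proof.
elim: n E => [|n IH] E hE; split => /=.
- by move=> f f0.
- by move=> f g f0 fg.
- move=> f f0; apply (hE ord0).1 => t; apply (IH _ (fun i => hE _)).1 => ts.
  exact: f0.
- move=> f g f0 fg; apply (hE ord0).2 => t.
    by apply (IH _ (fun i => hE _)).1 => ts; exact: f0.
  by apply (IH _ (fun i => hE _)).2 => ts; [exact: f0|exact: fg].
Qed.

Lemma monotone_integral d (T : measurableType d) (mu : {measure set T -> \bar R}) :
  monotone_integrator (fun f => \int[mu]_t f t).
Proof.
by split=> [f f0|f g f0 fg]; [exact: integral_ge0|exact: ge0_le_integral_any].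
Qed.

Lemma monotone_mixture T n (p : 'I_n -> R) (g : 'I_n -> T) :
  (forall i, 0 <= p i)%R ->
  monotone_integrator (fun f => \sum_(i < n) (p i)%:E * f (g i)).
Proof.
move=> p0; split=> [f f0|f h f0 fh].
  by apply: sume_ge0 => i _; rewrite mule_ge0 ?lee_fin.
by apply: lee_sum => i _; apply: lee_wpmul2l; rewrite ?lee_fin.
Qed.

End monotone_integrators.

Section filter_kernel.
Local Open Scope ereal_scope.
Context {R : realType}.
Variables (m N : nat) (y : m.+1.-tuple nat) (rho sigma : R).
Hypothesis sigma0 : sigma != 0%R.
Let s0 := Num.sqrt (sigma ^+ 2 / (1 - rho ^+ 2))%R.
Hypothesis s00 : s0 != 0%R.

Lemma obs_prob_gt0 alpha k (u : R) : (0 < obs_prob alpha k u)%R.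
Proof.
by rewrite /obs_prob /poisson_pmf expR_gt0 !mulr_gt0 ?exprn_gt0 ?expR_gt0 ?invr_gt0 ?ltr0n ?fact_gt0.
Qed.

Lemma sum_obs_prob_gt0 alpha k (x : particles R N) :
  (0 < \sum_(l < N.+1) obs_prob alpha k (tnth x l))%R.
Proof.
rewrite big_ord_recl ltr_pwDl ?obs_prob_gt0//.
by apply: sumr_ge0 => i _; exact/ltW/obs_prob_gt0.
Qed.

Lemma norm_weight_ge0 alpha k (x : particles R N) i :
  (0 <= norm_weight alpha k x i)%R.
Proof.
by rewrite /norm_weight divr_ge0// ltW// ?obs_prob_gt0 ?sum_obs_prob_gt0.
Qed.

Lemma sum_norm_weight alpha k (x : particles R N) :
  (\sum_(i < N.+1) norm_weight alpha k x i = 1)%R.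
Proof.
by rewrite /norm_weight -mulr_suml mulfV// gt_eqF// sum_obs_prob_gt0.
Qed.

Section measurable.
Context {d : measure_display} {S : measurableType d}.

Lemma measurable_obs_prob k (a u : S -> R) :
  measurable_fun setT a -> measurable_fun setT u ->
  measurable_fun setT (fun s => obs_prob (a s) k (u s)).
Proof.
move=> ma mu; rewrite /obs_prob.
apply: (measurableT_comp (measurable_poisson_pmf k measurableT)).
by apply: measurableT_comp => //; apply: measurable_funD.
Qed.

Lemma measurable_norm_weight k (a : S -> R) (x : S -> particles R N) i :
  measurable_fun setT a -> measurable_fun setT x ->
  measurable_fun setT (fun s => norm_weight (a s) k (x s) i).
Proof.
move=> ma mx; rewrite /norm_weight; apply: measurable_funM.
  by apply: measurable_obs_prob => //; exact: measurable_tnthT.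
apply: (measurableT_comp measurable_invR); apply: measurable_sum => l.
by apply: measurable_obs_prob => //; exact: measurable_tnthT.
Qed.

End measurable.

Lemma monotone_resample alpha k (x : particles R N) :
  monotone_integrator (pf_resample alpha k x).
Proof.
apply: monotone_draws => i; apply: (@monotone_mixture _ _ _ _ id) => j.
exact: norm_weight_ge0.
Qed.

Lemma monotone_propagate (x : particles R N) a :
  monotone_integrator (pf_propagate rho sigma x a).
Proof. by apply: monotone_draws => i; exact: (monotone_integral (normal_prob _ _)). Qed.

Lemma monotone_steps alpha r k x :
  monotone_integrator (@pf_steps R m N y rho sigma alpha r k x).
Proof.
elim: r k x => [|r IH] k x; first by split=> /= [f f0|f g f0 fg].
split=> /= [f f0|f g f0 fg].
  apply (monotone_resample alpha _ x).1 => a.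
  apply (monotone_propagate x a).1 => x'.
  by apply (IH _ x').1 => xas.
apply (monotone_resample alpha _ x).2 => a.
  apply (monotone_propagate x a).1 => x'.
  by apply (IH _ x').1 => xas.
apply (monotone_propagate x a).2 => x'.
  by apply (IH _ x').1 => xas.
by apply (IH _ x').2 => xas.
Qed.

Lemma monotone_init : monotone_integrator (@pf_init R N rho sigma).
Proof. by apply: monotone_draws => i; exact: (monotone_integral (normal_prob _ _)). Qed.

Lemma monotone_particle_filter alpha :
  monotone_integrator (@particle_filter R m N y rho sigma alpha).
Proof.
split=> [f f0|f g f0 fg].
  by apply monotone_init.1 => x; apply (monotone_steps _ _ _ _).1 => xas.
apply monotone_init.2 => x; first by apply (monotone_steps _ _ _ _).1 => xas.
by apply (monotone_steps _ _ _ _).2 => xas.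
Qed.

Lemma kernelized_resample k :
  kernelized (fun ax : R * particles R N => pf_resample ax.1 k ax.2).
Proof.
apply: (kernelized_draws (E := fun (_ : 'I_N.+1) (ax : R * particles R N)
  (f : 'I_N.+1 -> \bar R) => \sum_(i < N.+1) (norm_weight ax.1 k ax.2 i)%:E * f i)) => _.
apply: (kernelized_mixture (p := fun i (ax : R * particles R N) => norm_weight ax.1 k ax.2 i)
   (g := fun i _ => i)) => //.
- by move=> i; apply: measurable_norm_weight.
- by move=> i ax; exact: norm_weight_ge0.
- by move=> ax; exact: sum_norm_weight.
Qed.

Lemma kernelized_propagate :
  kernelized (fun xa : particles R N * ancestors N =>
    pf_propagate rho sigma xa.1 xa.2).
Proof.
apply: (kernelized_draws (E := fun (j : 'I_N.+1) (xa : particles R N * ancestors N) (f : R -> \bar R) =>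
    \int[normal_prob (rho * tnth xa.1 (tnth xa.2 j)) sigma]_u f u)) => j.
apply: (@kernelized_normal R _ _ (fun xa : particles R N * ancestors N =>
  (rho * tnth xa.1 (tnth xa.2 j))%R)) => //.
apply: measurable_funM => //.
apply: (measurable_select (g := fun xa : particles R N * ancestors N => tnth xa.2 j)
   (h := fun i xa => tnth xa.1 i)).
  exact: measurable_tnthT.
by move=> i; exact: measurable_tnthT.
Qed.

Lemma kernelized_steps r k :
  kernelized (fun ax : R * particles R N =>
    @pf_steps R m N y rho sigma ax.1 r k ax.2).
Proof.
elim: r k => [|r IH] k /=.
  exact: (@kernelized_dirac _ _ _ _ (0.-tuple _ * 0.-tuple _)%type
    (fun=> ([tuple], [tuple])) (measurable_cst _)).
have m3 : measurable_fun setT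
    (fun p : R * particles R N * ancestors N * particles R N => (p.1.1.1, p.2)).
  apply: measurable_fun_pair => //; apply: measurableT_comp => //.
  exact: measurableT_comp.
have m4 : measurable_fun setT
    (fun q : (R * particles R N * ancestors N * particles R N) *
      (r.-tuple (particles R N) * r.-tuple (ancestors N)) =>
      ([tuple of q.1.2 :: q.2.1], [tuple of q.1.1.2 :: q.2.2])).
  apply: measurable_fun_pair; apply: measurable_cons; try exact: measurableT_comp.
  by apply: measurableT_comp => //; exact: measurableT_comp.
have m2 : measurable_fun setT
    (fun p : R * particles R N * ancestors N => (p.1.2, p.2)).
  by apply: measurable_fun_pair => //; exact: measurableT_comp.
have h4 := kernelized_map m4 (kernelized_comp m3 (IH k.+1)).
have h2 := kernelized_comp m2 kernelized_propagate.
exact: (kernelized_bind (kernelized_resample _) (kernelized_bind h2 h4)).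
Qed.

Lemma kernelized_particle_filter :
  kernelized (@particle_filter R m N y rho sigma).
Proof.
have h1 : kernelized (fun _ : R => @pf_init R N rho sigma).
  apply: (kernelized_draws (E := fun (j : 'I_N.+1) (_ : R) (f : R -> \bar R) =>
    \int[normal_prob 0 s0]_u f u)) => j.
  exact: (@kernelized_normal R _ R (fun=> 0%R)).
have m2 : measurable_fun setT
    (fun q : (R * particles R N) *
      (m.-tuple (particles R N) * m.-tuple (ancestors N)) =>
      ([tuple of q.1.2 :: q.2.1], q.2.2)).
  apply: measurable_fun_pair; last exact: measurableT_comp.
  by apply: measurable_cons; exact: measurableT_comp.
exact: (kernelized_bind h1 (kernelized_map m2 (kernelized_steps m 0))).
Qed.

End filter_kernel.

(** * Expectations of independent draws *)

Section expectations.
Local Open Scope ereal_scope.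
Context {R : realType} {d : measure_display} {T : measurableType d}.

Definition is_expectation (E : integrator R T) : Prop :=
  exists mu : {measure set T -> \bar R}, mu setT = 1 /\
    forall f : T -> \bar R, measurable_fun setT f -> (forall t, 0 <= f t) ->
      E f = \int[mu]_t f t.

Lemma kernelized_expectation {d'} {S : measurableType d'}
    (E : S -> integrator R T) s : kernelized E -> is_expectation (E s).
Proof. by move=> [k hk]; exists (k s); split; [exact: prob_kernel|exact: hk]. Qed.

Variable E : integrator R T.
Hypothesis hE : is_expectation E.

Lemma expect_scale (c : R) (f : T -> \bar R) : (0 <= c)%R ->
  measurable_fun setT f -> (forall t, 0 <= f t) ->
  E (fun t => c%:E * f t) = c%:E * E f.
Proof.
move=> c0 mf f0; have [mu [_ hmu]] := hE; rewrite !hmu//.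
- by rewrite ge0_integralZl.
- by apply: emeasurable_funM.
- by move=> t; rewrite mule_ge0 ?lee_fin.
Qed.

Lemma expect_cst (c : R) : (0 <= c)%R -> E (fun=> c%:E) = c%:E.
Proof.
move=> c0; have [mu [mu1 hmu]] := hE; rewrite hmu//.
by rewrite integral_cst// mu1 mule1.
Qed.

Lemma expect_add (f g : T -> \bar R) :
  measurable_fun setT f -> (forall t, 0 <= f t) ->
  measurable_fun setT g -> (forall t, 0 <= g t) ->
  E (fun t => f t + g t) = E f + E g.
Proof.
move=> mf f0 mg g0; have [mu [_ hmu]] := hE; rewrite !hmu//.
- by rewrite ge0_integralD.
- exact: emeasurable_funD.
- by move=> t; rewrite adde_ge0.
Qed.

Lemma expect_sum n (f : 'I_n -> T -> \bar R) :
  (forall i, measurable_fun setT (f i)) -> (forall i t, 0 <= f i t) ->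
  E (fun t => \sum_(i < n) f i t) = \sum_(i < n) E (f i).
Proof.
move=> mf f0; have [mu [_ hmu]] := hE; rewrite hmu.
- rewrite ge0_integral_sum//; apply: eq_bigr => i _; rewrite hmu//.
- exact: emeasurable_sum.
- by move=> t; apply: sume_ge0.
Qed.

End expectations.

Section draws.
Local Open Scope ereal_scope.
Context {R : realType} {d : measure_display} {T : measurableType d}.

(** The constant c carries the factors already drawn through the induction. *)
Lemma draws_prod_le n (E : 'I_n -> integrator R T) (f : 'I_n -> T -> R)
    (e : 'I_n -> R) (c : R) :
  (forall i, is_expectation (E i)) -> (forall i, monotone_integrator (E i)) ->
  (forall i, measurable_fun setT (f i)) -> (forall i t, 0 <= f i t)%R ->
  (0 <= c)%R -> (forall i, E i (fun t => (f i t)%:E) <= (e i)%:E) ->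
  independent_draws E (fun t => (c * \prod_(i < n) f i (tnth t i))%:E) <=
    (c * \prod_(i < n) e i)%:E.
Proof.
elim: n E f e c => [|n IH] E f e c hE mE mf f0 c0 fe /=; first by rewrite !big_ord0.
have e0 i : (0 <= e i)%R.
  by rewrite -lee_fin; apply: le_trans (fe i); apply (mE i).1 => t; rewrite lee_fin.
pose p := (\prod_(i < n) e (lift ord0 i))%R.
have p0 : (0 <= p)%R by apply: prodr_ge0.
apply: (@le_trans _ _ (E ord0 (fun t => (c * p)%:E * (f ord0 t)%:E))).
  apply (mE ord0).2 => t.
    apply (monotone_draws (fun i => mE (lift ord0 i))).1 => ts.
    by rewrite lee_fin mulr_ge0// prodr_ge0.
  have := IH (fun i => E (lift ord0 i)) (fun i => f (lift ord0 i))
    (fun i => e (lift ord0 i)) (c * f ord0 t)%R.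
  rewrite -EFinM (mulrAC c) -/p => H.
  apply: le_trans (H _ _ _ _ _ _) => //; last by rewrite mulr_ge0.
  apply: le_of_eq; congr independent_draws.
  apply/funext => ts; rewrite big_ord_recl tnth0 mulrA; congr (_ * _)%:E.
  by apply: eq_bigr => i _; rewrite tnthS.
rewrite expect_scale//; last 3 first.
- by rewrite mulr_ge0.
- exact/measurable_EFinP.
- by move=> t; rewrite lee_fin.
rewrite big_ord_recl mulrA (mulrAC c) [leRHS]EFinM -/p.
by apply: lee_wpmul2l => //; rewrite lee_fin mulr_ge0.
Qed.

Lemma draws_prod_ge n (E : 'I_n -> integrator R T) (f : 'I_n -> T -> R)
    (e : 'I_n -> R) (c : R) :
  (forall i, is_expectation (E i)) -> (forall i, monotone_integrator (E i)) ->
  (forall i, measurable_fun setT (f i)) -> (forall i t, 0 <= f i t)%R ->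
  (0 <= c)%R -> (forall i, 0 <= e i)%R ->
  (forall i, (e i)%:E <= E i (fun t => (f i t)%:E)) ->
  (c * \prod_(i < n) e i)%:E <=
    independent_draws E (fun t => (c * \prod_(i < n) f i (tnth t i))%:E).
Proof.
elim: n E f e c => [|n IH] E f e c hE mE mf f0 c0 e0 fe /=; first by rewrite !big_ord0.
pose p := (\prod_(i < n) e (lift ord0 i))%R.
have p0 : (0 <= p)%R by apply: prodr_ge0.
apply: (@le_trans _ _ (E ord0 (fun t => (c * p)%:E * (f ord0 t)%:E))).
  rewrite expect_scale//; last 3 first.
  - by rewrite mulr_ge0.
  - exact/measurable_EFinP.
  - by move=> t; rewrite lee_fin.
  rewrite big_ord_recl mulrA (mulrAC c) [leLHS]EFinM -/p.
  by apply: lee_wpmul2l => //; rewrite lee_fin mulr_ge0.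
apply (mE ord0).2 => t; first by rewrite -EFinM lee_fin !mulr_ge0.
have := IH (fun i => E (lift ord0 i)) (fun i => f (lift ord0 i))
  (fun i => e (lift ord0 i)) (c * f ord0 t)%R.
rewrite -EFinM (mulrAC c) -/p => H.
apply: le_trans (H _ _ _ _ _ _ _) _ => //; first by rewrite mulr_ge0.
apply: le_of_eq; congr independent_draws.
apply/funext => ts; rewrite big_ord_recl tnth0 mulrA; congr (_ * _)%:E.
by apply: eq_bigr => i _; rewrite tnthS.
Qed.

Lemma prod_single n (i : 'I_n) (u v : 'I_n -> R) :
  (\prod_(j < n) (if j == i then u j else 1%R) = u i)%R.
Proof.
by rewrite (bigD1 i)//= eqxx big1 ?mulr1// => j /negbTE ->.
Qed.

(** The case of a product all of whose factors but one are 1. *)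
Lemma draws_marginal_le n (E : 'I_n -> integrator R T) (i : 'I_n) (f : T -> R)
    (e c : R) :
  (forall i, is_expectation (E i)) -> (forall i, monotone_integrator (E i)) ->
  measurable_fun setT f -> (forall t, 0 <= f t)%R -> (0 <= c)%R ->
  E i (fun t => (f t)%:E) <= e%:E ->
  independent_draws E (fun t => (c * f (tnth t i))%:E) <= (c * e)%:E.
Proof.
move=> hE mE mf f0 c0 fe.
have := @draws_prod_le _ E (fun j => if j == i then f else fun=> 1%R)
  (fun j => if j == i then e else 1%R) c hE mE.
rewrite (@prod_single _ _ (fun=> e) (fun=> 1%R)) => H.
apply: le_trans (H _ _ _ _); last first.
- move=> j; case: eqP => [->//|_].
  by rewrite expect_cst.
- by [].
- by move=> j t; case: ifP.
- by move=> j; case: ifP.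
apply: le_of_eq; congr independent_draws.
apply/funext => ts; congr (_ * _)%:E.
rewrite -[LHS](@prod_single _ i (fun j => f (tnth ts j)) (fun=> 1%R)).
by apply: eq_bigr => j _; case: ifP.
Qed.

Lemma draws_marginal_ge n (E : 'I_n -> integrator R T) (i : 'I_n) (f : T -> R)
    (e c : R) :
  (forall i, is_expectation (E i)) -> (forall i, monotone_integrator (E i)) ->
  measurable_fun setT f -> (forall t, 0 <= f t)%R -> (0 <= c)%R -> (0 <= e)%R ->
  e%:E <= E i (fun t => (f t)%:E) ->
  (c * e)%:E <= independent_draws E (fun t => (c * f (tnth t i))%:E).
Proof.
move=> hE mE mf f0 c0 e0 fe.
have := @draws_prod_ge _ E (fun j => if j == i then f else fun=> 1%R)
  (fun j => if j == i then e else 1%R) c hE mE.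
rewrite (@prod_single _ _ (fun=> e) (fun=> 1%R)) => H.
apply: le_trans (H _ _ _ _ _) _; first last.
- apply: le_of_eq; congr independent_draws.
  apply/funext => ts; congr (_ * _)%:E.
  rewrite -[RHS](@prod_single _ i (fun j => f (tnth ts j)) (fun=> 1%R)).
  by apply: eq_bigr => j _; case: ifP.
- move=> j; case: eqP => [->//|_].
  by rewrite expect_cst.
- by move=> j; case: ifP.
- by [].
- by move=> j t; case: ifP.
- by move=> j; case: ifP.
Qed.

End draws.

(** * Exponential moments of the filter *)

Section gauss_expectation.
Local Open Scope ereal_scope.
Context {R : realType}.
Implicit Types (mu s k : R).

Lemma expectation_normal mu s : s != 0%R ->
  is_expectation (fun f : R -> \bar R => \int[normal_prob mu s]_u f u).
Proof.
move=> s0.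
refine (@kernelized_expectation R _ R _ R _ mu (@kernelized_normal R _ R id s s0 (@measurable_id _ R setT))).
Qed.

Lemma monotone_normal mu s :
  monotone_integrator (fun f : R -> \bar R => \int[normal_prob mu s]_u f u).
Proof. exact: (monotone_integral (normal_prob _ _)). Qed.

(** The exponential of k |x| is at most the sum of those of k x and - k x. *)
Lemma normal_abs_mgf mu s k : s != 0%R -> (0 <= k)%R ->
  \int[normal_prob mu s]_x (expR (k * `|x|))%:E <=
  (2 * expR (k ^+ 2 * s ^+ 2 / 2) * expR (k * `|mu|))%:E.
Proof.
move=> s0 k0; have hE := expectation_normal mu s0.
have mexp (c : R) : measurable_fun setT (fun x : R => (expR (c * x))%:E).
  by apply/measurable_EFinP; apply: measurableT_comp => //; exact: measurable_funM.
apply: (@le_trans _ _ (\int[normal_prob mu s]_x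
   ((expR (k * x))%:E + (expR (- k * x))%:E))).
  apply (monotone_normal mu s).2 => x; rewrite -?EFinD lee_fin ?expR_ge0//.
  have [x0|x0] := leP 0%R x; first by rewrite ger0_norm// lerDl expR_ge0.
  by rewrite ltr0_norm// mulrN mulNr lerDr expR_ge0.
rewrite (expect_add hE)//.
rewrite !normal_mgf// -EFinD lee_fin sqrrN !expRD -mulrDl mulrC [leRHS]mulrAC.
rewrite [leRHS]mulrC ler_wpM2l ?expR_ge0// [leRHS]mulrC mulr_natr.
rewrite mulr2n lerD// ler_expR; first by rewrite ler_wpM2l// ler_norm.
by rewrite mulNr -mulrN ler_wpM2l// -normrN ler_norm.
Qed.

End gauss_expectation.

Section filter_bounds.
Local Open Scope ereal_scope.
Context {R : realType}.
Variables (m N : nat) (y : m.+1.-tuple nat) (rho sigma : R).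
Hypothesis sigma0 : sigma != 0%R.
Hypothesis rho1 : (-1 < rho < 1)%R.
Let s0 := Num.sqrt (sigma ^+ 2 / (1 - rho ^+ 2))%R.

Lemma rho2_lt1 : (rho ^+ 2 < 1)%R.
Proof. by rewrite -[ltRHS](expr1n _ 2) -real_normK ?num_real// ltrXn2r// ltr_norml. Qed.

Lemma s0_sq : (s0 ^+ 2 = sigma ^+ 2 / (1 - rho ^+ 2))%R.
Proof. by rewrite sqr_sqrtr// divr_ge0 ?sqr_ge0// subr_ge0 ltW// rho2_lt1. Qed.

Lemma s0_neq0 : s0 != 0%R.
Proof.
rewrite gt_eqF// sqrtr_gt0 divr_gt0 ?subr_gt0 ?rho2_lt1//.
by rewrite exprn_even_gt0.
Qed.

Lemma expectation_resample alpha k (x : particles R N) :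
  is_expectation (pf_resample alpha k x).
Proof. exact: (kernelized_expectation (alpha, x) (kernelized_resample N k)). Qed.

Lemma resample_le_cst alpha k (x : particles R N) h (c : R) :
  (0 <= c)%R -> (forall a, 0 <= h a) -> (forall a, h a <= c%:E) ->
  pf_resample alpha k x h <= c%:E.
Proof.
move=> c0 h0 hc.
rewrite -(expect_cst (expectation_resample alpha k x) c0).
exact: (monotone_resample alpha k x).2.
Qed.

Lemma expectation_particle_filter alpha :
  is_expectation (@particle_filter R m N y rho sigma alpha).
Proof. exact: (kernelized_expectation alpha (kernelized_particle_filter N y sigma0 s0_neq0)). Qed.

(** The l1 norm is used because its exponential is a product over the
    independent particles. *)
Definition pnorm (x : particles R N) : R := \sum_(j < N.+1) `|tnth x j|.
Definition psnorm r (xs : r.-tuple (particles R N)) : R :=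
  \sum_(k < r) pnorm (tnth xs k).

Lemma pnorm_ge0 x : (0 <= pnorm x)%R.
Proof. by apply: sumr_ge0. Qed.

Lemma psnorm_ge0 r (xs : r.-tuple (particles R N)) : (0 <= psnorm xs)%R.
Proof. by apply: sumr_ge0 => k _; exact: pnorm_ge0. Qed.

Lemma psnorm_cons r x (xs : r.-tuple (particles R N)) :
  (psnorm [tuple of x :: xs] = pnorm x + psnorm xs)%R.
Proof.
by rewrite /psnorm big_ord_recl tnth0; congr (_ + _)%R; apply: eq_bigr => i _; rewrite tnthS.
Qed.

Lemma le_pnorm (x : particles R N) j : (`|tnth x j| <= pnorm x)%R.
Proof. by rewrite /pnorm (bigD1 j)//= lerDl sumr_ge0. Qed.

Lemma expR_pnorm k x : expR (k * pnorm x) = (\prod_(j < N.+1) expR (k * `|tnth x j|))%R.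
Proof. by rewrite /pnorm mulr_sumr expR_sum. Qed.

(** Each of the N + 1 new particles descends from an old one, whose modulus is
    at most pnorm x: this multiplies the exponent by N + 1. *)
Lemma propagate_moment k : (0 <= k)%R -> exists2 C : R, (0 <= C)%R &
  forall (c : R) x a, (0 <= c)%R ->
  pf_propagate rho sigma x a (fun x' => (c * expR (k * pnorm x'))%:E) <=
    (c * (C * expR (k * N.+1%:R * pnorm x)))%:E.
Proof.
move=> k0; pose C1 := (2 * expR (k ^+ 2 * sigma ^+ 2 / 2))%R.
have C10 : (0 <= C1)%R by rewrite mulr_ge0// expR_ge0.
exists (C1 ^+ N.+1)%R; first by rewrite exprn_ge0.
move=> c x a c0; rewrite (_ : (fun x' => _) = (fun x' : particles R N =>
  (c * \prod_(j < N.+1) expR (k * `|tnth x' j|))%:E)); last first.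
  by apply/funext => x'; rewrite expR_pnorm.
refine (le_trans (@draws_prod_le R _ R N.+1 _ (fun _ u => expR (k * `|u|))
  (fun=> C1 * expR (k * pnorm x))%R c _ _ _ _ _ _) _) => //.
- by move=> j; exact: expectation_normal.
- by move=> j; exact: monotone_normal.
- by move=> j; apply: measurableT_comp => //; apply: measurable_funM.
- move=> j; apply: le_trans (normal_abs_mgf _ _ _) _ => //.
  rewrite lee_fin ler_wpM2l// ler_expR ler_wpM2l// normrM.
  apply: le_trans (le_pnorm x (tnth a j)).
  by rewrite ler_piMl// ltW// ltr_norml.
- rewrite prodr_const card_ord exprMn lee_fin ler_wpM2l//.
  rewrite ler_wpM2l ?exprn_ge0// -expRM_natl ler_expR.
  by rewrite mulrA (mulrC k).
Qed.

Lemma init_moment k : (0 <= k)%R -> exists2 C : R, (0 <= C)%R & forall c : R, (0 <= c)%R ->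
  @pf_init R N rho sigma (fun x' => (c * expR (k * pnorm x'))%:E) <= (c * C)%:E.
Proof.
move=> k0; pose C1 := (2 * expR (k ^+ 2 * s0 ^+ 2 / 2) * expR (k * `|0 : R|))%R.
have C10 : (0 <= C1)%R by rewrite !mulr_ge0// expR_ge0.
exists (C1 ^+ N.+1)%R; first by rewrite exprn_ge0.
move=> c c0; rewrite (_ : (fun x' => _) = (fun x' : particles R N =>
  (c * \prod_(j < N.+1) expR (k * `|tnth x' j|))%:E)); last first.
  by apply/funext => x'; rewrite expR_pnorm.
refine (le_trans (@draws_prod_le R _ R N.+1 _ (fun _ u => expR (k * `|u|))
  (fun=> C1) c _ _ _ _ _ _) _) => //.
- by move=> j; apply: expectation_normal; exact: s0_neq0.
- by move=> j; exact: monotone_normal.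
- by move=> j; apply: measurableT_comp => //; apply: measurable_funM.
- by move=> j; apply: normal_abs_mgf => //; exact: s0_neq0.
- by rewrite prodr_const card_ord.
Qed.

(** Resampling only selects among existing particles, so the constants do not
    depend on alpha although the weights do. *)
Lemma steps_moment r k : (0 <= k)%R -> exists C k' : R, [/\ (0 <= C)%R, (0 <= k')%R &
  forall (c : R) alpha l x, (0 <= c)%R ->
  @pf_steps R m N y rho sigma alpha r l x
    (fun xas => (c * expR (k * psnorm xas.1))%:E) <=
    (c * (C * expR (k' * pnorm x)))%:E].
Proof.
move=> k0; elim: r => [|r [C [k' [C0 k'0 IH]]]].
  exists 1%R, 0%R; split=> // c alpha l x c0 /=.
  by rewrite /psnorm big_ord0 mulr0 mul0r expR0 !mulr1.
have [C2 C20 hC2] := propagate_moment (addr_ge0 k0 k'0).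
exists (C * C2)%R, ((k + k') * N.+1%:R)%R; split; first by rewrite mulr_ge0.
  by rewrite mulr_ge0// addr_ge0.
move=> c alpha l x c0 /=.
apply: resample_le_cst => [|a|a]; first by rewrite !mulr_ge0 ?expR_ge0.
  apply (monotone_propagate rho sigma x a).1 => x'.
  apply (monotone_steps y rho sigma _ _ _ x').1 => xas.
  by rewrite lee_fin mulr_ge0// expR_ge0.
apply: (@le_trans _ _ (pf_propagate rho sigma x a
  (fun x' => (c * C * expR ((k + k') * pnorm x'))%:E))).
  apply (monotone_propagate rho sigma x a).2 => x'.
    apply (monotone_steps y rho sigma _ _ _ x').1 => xas.
    by rewrite lee_fin mulr_ge0// expR_ge0.
  rewrite (_ : (fun xas : r.-tuple _ * r.-tuple _ => _) =
     (fun xas => (c * expR (k * pnorm x') * expR (k * psnorm xas.1))%:E)); last first.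
    by apply/funext => xas /=; rewrite psnorm_cons mulrDr expRD mulrA.
  apply: le_trans (IH _ _ _ _ _) _; first by rewrite mulr_ge0// expR_ge0.
  rewrite lee_fin le_eqVlt; apply/orP; left; apply/eqP.
  rewrite (mulrDl k) expRD -!mulrA; congr (_ * _)%R.
  by rewrite mulrCA.
apply: le_trans (hC2 _ _ _ _) _; first by rewrite mulr_ge0.
by rewrite !mulrA.
Qed.

Definition expz k (z : pf_state R m N) : R := expR (k * psnorm z.1).

Lemma filter_moment k : (0 <= k)%R -> exists2 C : R, (0 <= C)%R &
  forall alpha,
  @particle_filter R m N y rho sigma alpha (fun z => (expz k z)%:E) <= C%:E.
Proof.
move=> k0; have [C [k' [C0 k'0 hC]]] := steps_moment m k0.
have [C2 C20 hC2] := init_moment (addr_ge0 k0 k'0).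
exists (C * C2)%R; first by rewrite mulr_ge0.
move=> alpha; rewrite /particle_filter.
apply: le_trans (hC2 C C0); apply (monotone_init N rho sigma).2 => x.
  apply (monotone_steps y rho sigma _ _ _ x).1 => xas.
  by rewrite lee_fin expR_ge0.
rewrite (_ : (fun xas : m.-tuple _ * m.-tuple _ => _) =
     (fun xas => (expR (k * pnorm x) * expR (k * psnorm xas.1))%:E)); last first.
  by apply/funext => xas /=; rewrite /expz psnorm_cons mulrDr expRD.
apply: le_trans (hC _ _ _ _ _) _; first exact: expR_ge0.
rewrite lee_fin le_eqVlt; apply/orP; left; apply/eqP.
by rewrite (mulrDl k) expRD mulrCA.
Qed.

End filter_bounds.

(** * Likelihood estimate and acceptance probability *)

Section average.
Context {R : realType}.

Lemma average_le n (f : 'I_n.+1 -> R) c :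
  (forall i, f i <= c) -> (n.+1%:R)^-1 * \sum_i f i <= c.
Proof.
move=> fc; rewrite ler_pdivrMl ?ltr0n//.
apply: le_trans (ler_sum _ (fun i _ => fc i)) _.
by rewrite sumr_const card_ord mulr_natl.
Qed.

Lemma average_ge n (f : 'I_n.+1 -> R) c :
  (forall i, c <= f i) -> c <= (n.+1%:R)^-1 * \sum_i f i.
Proof.
move=> fc; rewrite ler_pdivlMl ?ltr0n//.
apply: le_trans _ (ler_sum _ (fun i _ => fc i)).
by rewrite sumr_const card_ord mulr_natl.
Qed.

End average.

Section likelihood.
Context {R : realType}.
Variables (m N : nat) (y : m.+1.-tuple nat).
Implicit Types (alpha theta u : R) (z : pf_state R m N).

Lemma obs_probE alpha k u : obs_prob alpha k u =
  expR (alpha + u) ^+ k * (k`!%:R)^-1 * expR (- expR (alpha + u)).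
Proof. by rewrite /obs_prob /poisson_pmf expR_gt0. Qed.

(** The denominator expR l of the Poisson probability is at least its single
    term l^k / k! of the exponential series. *)
Lemma obs_prob_le1 alpha k u : obs_prob alpha k u <= 1.
Proof.
rewrite obs_probE expRN ler_pdivrMr ?expR_gt0// mul1r.
case: k => [|k].
  by rewrite expr0 mul1r fact0 invr1 -expR0 ler_expR expR_ge0.
apply: le_trans (expR_ge1Dxn k (expR_ge0 (alpha + u))).
by rewrite lerDr.
Qed.

Lemma obs_prob_le_expR alpha k u : obs_prob alpha k u <= expR (k%:R * (alpha + u)).
Proof.
rewrite obs_probE -expRM_natl -mulrA ler_piMr ?expR_ge0//.
rewrite mulr_ile1 ?invr_ge0 ?expR_ge0//.
by rewrite invf_le1 ?ltr0n ?fact_gt0// ler1n fact_gt0.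
Qed.

Lemma obs_prob_ge alpha k u l h : l <= alpha + u -> alpha + u <= h ->
  expR (k%:R * l) * (k`!%:R)^-1 * expR (- expR h) <= obs_prob alpha k u.
Proof.
move=> lu uh; rewrite obs_probE -expRM_natl.
apply: ler_pM.
- by rewrite mulr_ge0 ?expR_ge0 ?invr_ge0.
- exact: expR_ge0.
- by rewrite ler_wpM2r ?invr_ge0// ler_expR ler_wpM2l.
- by rewrite ler_expR lerN2 ler_expR.
Qed.

Lemma Zhat_gt0 alpha z : 0 < Zhat y alpha z.
Proof.
apply: prodr_gt0 => k _; rewrite mulr_gt0 ?invr_gt0 ?ltr0n//.
exact: sum_obs_prob_gt0.
Qed.

Lemma Zhat_le1 alpha z : Zhat y alpha z <= 1.
Proof.
apply: prodr_ile1 => // k _; apply/andP; split.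
  by rewrite mulr_ge0 ?invr_ge0// ltW// sum_obs_prob_gt0.
by apply: average_le => i; exact: obs_prob_le1.
Qed.

Lemma accept_prob_ge0 theta z z' : 0 <= accept_prob y theta z z'.
Proof. by rewrite le_min ler01 divr_ge0// ltW// Zhat_gt0. Qed.

Lemma accept_prob_le1 theta z z' : accept_prob y theta z z' <= 1.
Proof. by rewrite ge_min lexx. Qed.

(** All likelihood estimates are at most 1, and so is the denominator of the ratio. *)
Lemma accept_prob_geZ theta z z' :
  Zhat y (alpha_hat y theta) z' <= accept_prob y theta z z'.
Proof.
rewrite le_min Zhat_le1/= ler_peMr//; first exact/ltW/Zhat_gt0.
by rewrite invf_ge1 ?Zhat_gt0// Zhat_le1.
Qed.

End likelihood.

Section measurability.
Context {R : realType} {d : measure_display} {S : measurableType d}.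
Variables (m N : nat) (y : m.+1.-tuple nat).

Lemma measurable_Zhat (a : S -> R) (z : S -> pf_state R m N) :
  measurable_fun setT a -> measurable_fun setT z ->
  measurable_fun setT (fun s => Zhat y (a s) (z s)).
Proof.
move=> ma mz; apply: measurable_prod => k _.
apply: measurable_funM => //; apply: measurable_sum => i.
apply: measurable_obs_prob => //.
by apply: measurable_tnthT; apply: measurable_tnthT; exact: measurableT_comp.
Qed.

Lemma measurable_alpha_hat (t : S -> R) : measurable_fun setT t ->
  measurable_fun setT (fun s => alpha_hat y (t s)).
Proof.
move=> mt; apply: (@measurableT_comp _ _ _ _ _ _ (@ln R)) => //.
apply: measurable_funM => //; exact: (measurableT_comp measurable_invR).
Qed.

Lemma measurable_accept_prob (t : S -> R) (z z' : S -> pf_state R m N) :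
  measurable_fun setT t -> measurable_fun setT z -> measurable_fun setT z' ->
  measurable_fun setT (fun s => accept_prob y (t s) (z s) (z' s)).
Proof.
move=> mt mz mz'; apply: measurable_minr => //.
apply: measurable_funM.
  by apply: measurable_Zhat => //; exact: measurable_alpha_hat.
apply: (measurableT_comp measurable_invR).
by apply: measurable_Zhat => //; exact: measurable_alpha_hat.
Qed.

(** The line is traced back by reading an array at a random index; as the index
    has finitely many values, events are split along them. *)
Lemma measurable_lineage (a : S -> m.-tuple (ancestors N)) j k :
  measurable_fun setT a -> measurable_fun setT (fun s => lineage (a s) j k).
Proof.
move=> ma; rewrite /lineage.
suff H n : forall (l : S -> n.-tuple (ancestors N)), measurable_fun setT l ->
    forall k, measurable_fun setT
      (fun s => foldr (fun ak b => tnth ak b) j (drop k (l s))) by exact: H.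
elim: n => [|n IH] l ml k'.
  rewrite (_ : (fun s => _) = cst j); first exact: measurable_cst.
  by apply/funext => s; rewrite (tuple0 (l s)).
have mt : measurable_fun setT (fun s => [tuple of behead (l s)]).
  apply/measurable_fun_tnthP => i /=.
  rewrite (_ : _ \o _ = fun s => tnth (l s) (lift ord0 i)).
    exact: measurable_tnthT.
  apply/funext => s /=; rewrite tnth_behead; congr tnth.
  by apply/val_inj; rewrite /= inordK ?/bump ?leq0n ?add1n// ltnS ltn_ord.
case: k' => [|k'].
  have h0 := IH _ mt 0.
  rewrite (_ : (fun s => _) = (fun s => tnth (tnth (l s) ord0)
     (foldr (fun ak b => tnth ak b) j (drop 0 (behead (l s)))))).
    move=> _ Y mY; rewrite setTI.
    rewrite (_ : _ @^-1` _ = \bigcup_(i in setT)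
      (((fun s => foldr (fun ak b => tnth ak b) j (drop 0 (behead (l s)))) @^-1` [set i]) `&`
       ((fun s => tnth (tnth (l s) ord0) i) @^-1` Y))).
      apply: fin_bigcup_measurable => [|i _]; first exact: finite_finset.
      apply: measurableI; first by rewrite -[X in measurable X]setTI; exact: h0.
      rewrite -[X in measurable X]setTI; apply: (measurable_tnthT i) => //.
      exact: measurable_tnthT.
    apply/seteqP; split=> [s /= Ys|s [i _ [/= -> //]]].
    by eexists; [exact: Logic.I|split; [reflexivity|exact: Ys]].
  by apply/funext => s; rewrite !drop0 (tuple_eta (l s)).
rewrite (_ : (fun s => _) = (fun s => foldr (fun ak b => tnth ak b) j (drop k' (behead (l s))))).
  exact: (IH _ mt).
by apply/funext => s; rewrite (tuple_eta (l s)).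
Qed.

Lemma measurable_trajectory (z : S -> pf_state R m N) j k :
  measurable_fun setT z ->
  measurable_fun setT (fun s => tnth (trajectory (z s) j) k).
Proof.
move=> mz; under eq_fun do rewrite tnth_mktuple.
apply: (measurable_select (g := fun s => lineage (z s).2 j k)
   (h := fun i s => tnth (tnth (z s).1 k) i)).
  by apply: measurable_lineage; exact: measurableT_comp.
by move=> i; apply: measurable_tnthT; apply: measurable_tnthT; exact: measurableT_comp.
Qed.

Lemma measurable_psnorm (z : S -> pf_state R m N) :
  measurable_fun setT z -> measurable_fun setT (fun s => psnorm (z s).1).
Proof.
move=> mz; apply: measurable_sum => k; apply: measurable_sum => i.
apply: measurableT_comp => //.
by apply: measurable_tnthT; apply: measurable_tnthT; exact: measurableT_comp.
Qed.

Lemma measurable_expz k (z : S -> pf_state R m N) :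
  measurable_fun setT z -> measurable_fun setT (fun s => expz k (z s)).
Proof.
move=> mz; apply: (@measurableT_comp _ _ _ _ _ _ (@expR R)) => //.
by apply: measurable_funM => //; exact: measurable_psnorm.
Qed.

End measurability.

(** * One step of the chain *)

Section pimh.
Local Open Scope ereal_scope.
Context {R : realType}.
Variables (m N : nat) (y : m.+1.-tuple nat) (rho sigma : R).
Hypothesis sigma0 : sigma != 0%R.
Hypothesis rho1 : (-1 < rho < 1)%R.
Implicit Types (theta : R) (z : pf_state R m N).

Local Notation acc := (accept_prob y).

Definition proposal theta : integrator R (pf_state R m N) :=
  particle_filter y rho sigma (alpha_hat y theta).

Lemma expectation_proposal theta : is_expectation (proposal theta).
Proof. exact: expectation_particle_filter. Qed.

Lemma monotone_proposal theta : monotone_integrator (proposal theta).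
Proof. exact: monotone_particle_filter. Qed.

(** Extends [pimh_kernel] from events to functions: the correctors below are
    unbounded. *)
Definition pimh_step theta z : integrator R (pf_state R m N) := fun f =>
  proposal theta (fun z' =>
    (acc theta z z')%:E * f z' + (1 - acc theta z z')%:E * f z).

Lemma monotone_pimh_step theta z : monotone_integrator (pimh_step theta z).
Proof.
have a0 z' : 0 <= (acc theta z z')%:E by rewrite lee_fin accept_prob_ge0.
have a1 z' : 0 <= (1 - acc theta z z')%:E by rewrite lee_fin subr_ge0 accept_prob_le1.
split=> [f f0|f f' f0 ff'].
  by apply (monotone_proposal theta).1 => z'; rewrite adde_ge0 ?mule_ge0.
apply (monotone_proposal theta).2 => z'; first by rewrite adde_ge0 ?mule_ge0.
by apply: leeD; apply: lee_wpmul2l.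
Qed.

Lemma measurable_acc theta z : measurable_fun setT (fun z' => acc theta z z').
Proof. by apply: measurable_accept_prob. Qed.

Lemma kernelized_pimh_step :
  kernelized (fun tz : R * pf_state R m N => pimh_step tz.1 tz.2).
Proof.
pose p (i : 'I_2) (s : (R * pf_state R m N) * pf_state R m N) : R :=
  if i == ord0 then acc s.1.1 s.1.2 s.2 else (1 - acc s.1.1 s.1.2 s.2)%R.
pose g (i : 'I_2) (s : (R * pf_state R m N) * pf_state R m N) :=
  if i == ord0 then s.2 else s.1.2.
have macc : measurable_fun setT
    (fun s : (R * pf_state R m N) * pf_state R m N => acc s.1.1 s.1.2 s.2).
  by apply: measurable_accept_prob => //; exact: measurableT_comp.
have mp i : measurable_fun setT (p i).
  rewrite /p; case: (i == ord0) => //.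
  by apply: measurable_funB.
have mg i : measurable_fun setT (g i).
  by rewrite /g; case: (i == ord0); [exact: measurable_snd|exact: measurableT_comp].
have p0 i s : (0 <= p i s)%R.
  by rewrite /p; case: ifP => _; rewrite ?subr_ge0 ?accept_prob_ge0 ?accept_prob_le1.
have p1 s : (\sum_(i < 2) p i s = 1)%R.
  by rewrite !big_ord_recl big_ord0 addr0 /p /= addrC subrK.
have h1 : kernelized (fun tz : R * pf_state R m N => proposal tz.1).
  apply: (@kernelized_comp _ _ _ _ _ _ _ (particle_filter y rho sigma)
     (fun tz : R * pf_state R m N => alpha_hat y tz.1)).
    exact: measurable_alpha_hat.
  exact: (kernelized_particle_filter N y sigma0 (s0_neq0 sigma0 rho1)).
have h2 := kernelized_mixture mp mg p0 p1.
have [k hk] := kernelized_bind h1 h2.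
exists k => s f mf f0; rewrite -hk// /pimh_step; congr proposal.
by apply/funext => z'; rewrite !big_ord_recl big_ord0 adde0.
Qed.

Lemma expectation_pimh_step theta z : is_expectation (pimh_step theta z).
Proof. exact: (kernelized_expectation (theta, z) kernelized_pimh_step). Qed.

(** A rejection keeps f z and has probability at most 1 - a; an acceptance
    contributes at most the mean of f under the proposal. *)
Lemma pimh_step_le theta z (f : pf_state R m N -> R) (a C : R) :
  measurable_fun setT f -> (forall z', 0 <= f z')%R ->
  a%:E <= proposal theta (fun z' => (acc theta z z')%:E) ->
  proposal theta (fun z' => (f z')%:E) <= C%:E ->
  pimh_step theta z (fun z' => (f z')%:E) <= (C + (1 - a) * f z)%:E.
Proof.
move=> mf f0 ha hC; have hE := expectation_proposal theta.
have macc := measurable_acc theta z.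
have mrej : measurable_fun setT (fun z' => (1 - acc theta z z')%:E).
  by apply/measurable_EFinP; apply: measurable_funB.
have rej0 z' : 0 <= (1 - acc theta z z')%:E.
  by rewrite lee_fin subr_ge0 accept_prob_le1.
have acc0 z' : 0 <= (acc theta z z')%:E by rewrite lee_fin accept_prob_ge0.
have hrej : proposal theta (fun z' => (1 - acc theta z z')%:E) <= (1 - a)%:E.
  rewrite EFinB leeBrDr// -(expect_cst hE (ler01)).
  apply: le_trans (leeD2l _ ha) _; rewrite -expect_add//; last exact/measurable_EFinP.
  apply (monotone_proposal theta).2 => z'; first by rewrite adde_ge0.
  by rewrite -EFinD subrK.
apply: (@le_trans _ _ (proposal theta (fun z' => (f z')%:E +
   (f z)%:E * (1 - acc theta z z')%:E))).
  apply (monotone_proposal theta).2 => z'.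
    by rewrite adde_ge0// mule_ge0 ?lee_fin// ?accept_prob_ge0// subr_ge0 accept_prob_le1.
  rewrite muleC (muleC _ (f z)%:E); apply: leeD => //.
  by rewrite -EFinM lee_fin ler_piMr// accept_prob_le1.
rewrite expect_add//; last 3 first.
- exact/measurable_EFinP.
- by apply: emeasurable_funM.
- by move=> z'; apply: mule_ge0 => //; rewrite lee_fin.
rewrite expect_scale// EFinD mulrC EFinM; apply: leeD => //.
by apply: lee_wpmul2l; rewrite ?lee_fin.
Qed.

(** Inside B it is enough to bound the accepted moves out of B; from outside, B
    is entered only if the proposal lies in B. *)
Lemma pimh_step_indic_le theta z (B : set (pf_state R m N)) (r q : R) :
  measurable B ->
  r%:E <= proposal theta (fun z' => (acc theta z z' * \1_(~` B) z')%:E) ->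
  proposal theta (fun z' => (\1_B z')%:E) <= q%:E ->
  pimh_step theta z (fun z' => (\1_B z')%:E) <=
    (if z \in B then 1 - r else q)%:E.
Proof.
move=> mB hr hq; have hE := expectation_proposal theta.
have macc := measurable_acc theta z.
have acc0 z' := accept_prob_ge0 y theta z z'.
have acc1 z' := accept_prob_le1 y theta z z'.
rewrite /pimh_step; case: ifPn => zB; last first.
  apply: le_trans hq; apply (monotone_proposal theta).2 => z'.
    by rewrite adde_ge0// mule_ge0 ?lee_fin// subr_ge0.
  have -> : \1_B z = 0%R :> R by rewrite indicE (negbTE zB).
  rewrite mule0 adde0 -EFinM lee_fin.
  by rewrite ler_piMl.
rewrite EFinB leeBrDr// -(expect_cst hE (ler01)).
apply: le_trans (leeD2l _ hr) _.
have mb : measurable_fun setT (fun z' => acc theta z z' * \1_B z' + (1 - acc theta z z') * \1_B z)%R.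
  apply: measurable_funD; apply: measurable_funM => //.
  exact: measurable_funB.
rewrite -expect_add//.
- apply (monotone_proposal theta).2 => z'.
    by rewrite -!EFinM -!EFinD lee_fin !addr_ge0// mulr_ge0// subr_ge0.
  rewrite -!EFinM -!EFinD lee_fin !indicE zB mulr1 in_setC.
  by case: (z' \in B); rewrite /= ?mulr1 ?mulr0 ?addr0 ?add0r ?subrK // addrC subrK.
- by under eq_fun do rewrite -!EFinM -!EFinD; exact/measurable_EFinP.
- by move=> z'; rewrite -!EFinM -!EFinD lee_fin addr_ge0// mulr_ge0// subr_ge0.
- apply/measurable_EFinP; apply: measurable_funM => //.
  by apply: measurable_indic; exact: measurableC.
- by move=> z'; rewrite lee_fin mulr_ge0.
Qed.

End pimh.

(** * Lower bounds for events of the filter *)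

Section normal_indicator.
Local Open Scope ereal_scope.
Context {R : realType}.

Lemma normal_indic_ge (mu s a b M : R) : s != 0%R -> (a <= b)%R ->
  (forall x, (a <= x <= b)%R -> (`|x - mu| <= M)%R) ->
  ((b - a) * normal_peak s * expR (- M ^+ 2 / (s ^+ 2 *+ 2)))%:E <=
    \int[normal_prob mu s]_u (\1_`[a, b]%classic u)%:E.
Proof.
move=> s0 ab hM; apply: le_trans (normal_prob_itv_ge s0 ab hM) _.
by rewrite integral_indic ?setIT//; exact: (measurable_itv `[a, b]).
Qed.

End normal_indicator.

Section filter_events.
Local Open Scope ereal_scope.
Context {R : realType}.
Variables (m N : nat) (y : m.+1.-tuple nat) (rho sigma : R).
Hypothesis sigma0 : sigma != 0%R.
Hypothesis rho1 : (-1 < rho < 1)%R.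
Let s0 := Num.sqrt (sigma ^+ 2 / (1 - rho ^+ 2))%R.

Section event.
Variables (alpha : R) (w : particles R N -> R) (kappa : R).
Hypothesis w01 : forall x, w x = 0%R \/ w x = 1%R.
Hypothesis kappa0 : (0 <= kappa)%R.
Hypothesis step : forall c l x, (0 <= c)%R -> w x = 1%R ->
  (c * kappa)%:E <= pf_resample alpha (nth 0%N y l) x (fun a =>
    pf_propagate rho sigma x a (fun x' => (c * w x')%:E)).

Let w0 x : (0 <= w x)%R. Proof. by case: (w01 x) => ->. Qed.

(** The indicator w is preserved by one step with probability at least kappa. *)
Lemma steps_event_ge r c l x : (0 <= c)%R -> w x = 1%R ->
  (c * kappa ^+ r)%:E <= @pf_steps R m N y rho sigma alpha r l x
    (fun xas => (c * \prod_(k < r) w (tnth xas.1 k))%:E).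
Proof.
elim: r c l x => [|r IH] c l x c0 wx /=; first by rewrite big_ord0.
have := @step (c * kappa ^+ r)%R l x (mulr_ge0 c0 (exprn_ge0 r kappa0)) wx.
rewrite -mulrA -exprSr => /le_trans; apply.
apply (monotone_resample _ _ _).2 => a.
  apply (monotone_propagate _ _ _ _).1 => x'.
  by rewrite lee_fin !mulr_ge0// exprn_ge0.
apply (monotone_propagate _ _ _ _).2 => x'; first by rewrite lee_fin !mulr_ge0// exprn_ge0.
case: (w01 x') => wx'.
  rewrite wx' mulr0; apply (monotone_steps y rho sigma _ _ _ x').1 => xas.
  by rewrite lee_fin mulr_ge0// prodr_ge0.
rewrite wx' mulr1; apply: le_trans (IH c l.+1 x' c0 wx') _.
apply (monotone_steps y rho sigma _ _ _ x').2 => xas.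
  by rewrite lee_fin mulr_ge0// prodr_ge0.
rewrite big_ord_recl tnth0 wx' mul1r /= lee_fin ler_wpM2l//.
by apply: le_of_eq; apply: eq_bigr => i _; rewrite tnthS.
Qed.

Lemma filter_event_ge c p : (0 <= c)%R -> (0 <= p)%R ->
  (forall c : R, (0 <= c)%R -> (c * p)%:E <= @pf_init R N rho sigma (fun x => (c * w x)%:E)) ->
  (c * (kappa ^+ m * p))%:E <=
   particle_filter y rho sigma alpha
    (fun z : pf_state R m N => (c * \prod_(k < m.+1) w (tnth z.1 k))%:E).
Proof.
move=> c0 p0 hp; rewrite mulrA; apply: le_trans (hp _ _) _.
  by rewrite mulr_ge0// exprn_ge0.
apply (monotone_init N rho sigma).2 => x; first by rewrite lee_fin !mulr_ge0// exprn_ge0.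
case: (w01 x) => wx.
  rewrite wx mulr0; apply (monotone_steps y rho sigma _ _ _ x).1 => xas.
  by rewrite lee_fin mulr_ge0// prodr_ge0.
rewrite wx mulr1; apply: le_trans (steps_event_ge m 0 c0 wx) _.
apply (monotone_steps y rho sigma _ _ _ x).2 => xas.
  by rewrite lee_fin mulr_ge0// prodr_ge0.
rewrite big_ord_recl tnth0 wx mul1r /= lee_fin ler_wpM2l//.
by apply: le_of_eq; apply: eq_bigr => i _; rewrite tnthS.
Qed.

End event.

Lemma resample_ge_cst alpha k (x : particles R N) h (c : R) :
  (0 <= c)%R -> (forall a, c%:E <= h a) ->
  c%:E <= pf_resample alpha k x h.
Proof.
move=> c0 hc.
rewrite -[leLHS](expect_cst (expectation_resample alpha k x) c0).
by apply (monotone_resample alpha k x).2.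
Qed.

Definition in_box (x : particles R N) : R :=
  (\prod_(j < N.+1) \1_`[-1%R, 1%R]%classic (tnth x j))%R.

Lemma in_box01 x : in_box x = 0%R \/ in_box x = 1%R.
Proof.
rewrite /in_box; elim/big_ind: _ => [|a b|j _]; first by right.
- by move=> [->|->] [->|->]; rewrite ?mul0r ?mulr0 ?mulr1; [left|left|left|right].
- by rewrite indicE; case: (_ \in _); [right|left].
Qed.

Lemma in_boxP x j : in_box x = 1%R -> (`|tnth x j| <= 1)%R.
Proof.
rewrite /in_box (bigD1 j)//= indicE.
have [|_] := boolP (_ \in _); last by move/eqP; rewrite mul0r eq_sym oner_eq0.
by rewrite inE/= in_itv/= ler_norml.
Qed.

(** From a particle in [-1, 1] the mean of a new one is in [-1, 1] because
    |rho| < 1, whichever the ancestor; hence a bound independent of alpha. *)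
Lemma filter_box_ge : exists2 p : R, (0 < p)%R & forall alpha (c : R), (0 <= c)%R ->
  (c * p)%:E <= particle_filter y rho sigma alpha
    (fun z : pf_state R m N => (c * \prod_(k < m.+1) in_box (tnth z.1 k))%:E).
Proof.
have hm1 : (-1 <= 1 :> R)%R by lra.
pose e1 := ((1 - (-1)) * normal_peak sigma * expR (- 2 ^+ 2 / (sigma ^+ 2 *+ 2)))%R.
pose e2 := ((1 - (-1)) * normal_peak s0 * expR (- 2 ^+ 2 / (s0 ^+ 2 *+ 2)))%R.
have s00 := s0_neq0 sigma0 rho1.
have e10 : (0 < e1)%R by rewrite !mulr_gt0 ?expR_gt0 ?normal_peak_gt0// opprK addr_gt0.
have e20 : (0 < e2)%R by rewrite !mulr_gt0 ?expR_gt0 ?normal_peak_gt0// opprK addr_gt0.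
have mind : measurable_fun setT (\1_(`[-1, 1]%classic : set R) : R -> R)%R.
  by apply: measurable_indic.
exists ((e1 ^+ N.+1) ^+ m * e2 ^+ N.+1)%R.
  by rewrite mulr_gt0// !exprn_gt0.
move=> alpha c c0; apply: filter_event_ge => //.
- exact: in_box01.
- by rewrite exprn_ge0// ltW.
- move=> c' l x c'0 bx; apply: resample_ge_cst => [|a].
    by rewrite mulr_ge0// exprn_ge0// ltW.
  apply: le_trans (@draws_prod_ge R _ R N.+1 _ (fun _ => \1_(`[-1, 1]%classic : set R) : R -> R)%R
    (fun=> e1) c' _ _ _ _ _ _ _) => //.
  + by rewrite prodr_const card_ord.
  + by move=> j; exact: expectation_normal.
  + by move=> j; exact: monotone_normal.
  + by move=> _; exact: ltW.
  + move=> j; apply: normal_indic_ge => // u hu.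
    apply: le_trans (ler_normB _ _) _; rewrite -[leRHS]/(1 + 1)%R; apply: lerD.
      by rewrite ler_norml.
    rewrite normrM mulr_ile1//; first by rewrite ltW// ltr_norml.
    exact: in_boxP.
- by rewrite exprn_ge0// ltW.
- move=> c' c'0; apply: le_trans (@draws_prod_ge R _ R N.+1 _ (fun _ => \1_(`[-1, 1]%classic : set R) : R -> R)%R
    (fun=> e2) c' _ _ _ _ _ _ _) => //.
  + by rewrite prodr_const card_ord.
  + by move=> j; exact: expectation_normal.
  + by move=> j; exact: monotone_normal.
  + by move=> _; exact: ltW.
  + move=> j; apply: normal_indic_ge => // u hu; rewrite subr0.
    by apply: (@le_trans _ _ 1%R); rewrite ?ler1n// ler_norml.
Qed.

End filter_events.

(** * Drift for large parameters *)

Section large_theta.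
Local Open Scope ereal_scope.
Context {R : realType}.
Variables (m N : nat) (y : m.+1.-tuple nat) (rho sigma : R).
Hypothesis sigma0 : sigma != 0%R.
Hypothesis rho1 : (-1 < rho < 1)%R.
Hypothesis hy : (0 < ybar y)%N.

Let Y : R := (ybar y)%:R.

Let Y0 : (0 < Y)%R. Proof. by rewrite ltr0n. Qed.

Lemma le_psnorm (z : pf_state R m N) k i : (`|tnth (tnth z.1 k) i| <= psnorm z.1)%R.
Proof.
apply: le_trans (le_pnorm (tnth z.1 k) i) _.
rewrite /psnorm (bigD1 k)//= lerDl; apply: sumr_ge0 => j _; exact: pnorm_ge0.
Qed.

(** The factor that depends on alpha is common to all states and cancels in the
    acceptance ratio. *)
Lemma Zhat_le alpha (z : pf_state R m N) :
  (Zhat y alpha z <= (\prod_(k < m.+1) expR ((tnth y k)%:R * alpha)) *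
     expR (Y * psnorm z.1))%R.
Proof.
rewrite /Y /ybar natr_sum mulr_suml expR_sum -big_split/=.
apply: ler_prod => k _; apply/andP; split.
  by rewrite mulr_ge0 ?invr_ge0// ltW// sum_obs_prob_gt0.
apply: average_le => i; apply: le_trans (obs_prob_le_expR _ _ _) _.
rewrite -expRD ler_expR mulrDr lerD2l ler_wpM2l//.
by apply: le_trans (le_psnorm z k i); exact: ler_norm.
Qed.

(** Only proposals with all particles in [-1, 1] are counted. For theta >= 1 the
    intensity alpha_hat is at most ln ybar, so that, up to the factor exp(y_k alpha)
    shared with [Zhat_le], their likelihoods are bounded below. *)
Lemma accept_ge : exists2 c : R, (0 < c)%R & forall theta (z : pf_state R m N),
  (1 <= theta)%R ->
  (c * expR (- (Y * psnorm z.1)))%:E <=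
    proposal y rho sigma theta (fun z' => (accept_prob y theta z z')%:E).
Proof.
have [p p0 hp] := filter_box_ge N y sigma0 rho1.
pose ck (k : 'I_m.+1) := (expR (- (tnth y k)%:R) * ((tnth y k)`!%:R)^-1 *
  expR (- expR (ln Y + 1)))%R.
have ck0 k : (0 < ck k)%R.
  by rewrite !mulr_gt0 ?expR_gt0// invr_gt0 ltr0n fact_gt0.
have hexp (a : R) : (0 <= a)%R -> (expR (- a) <= 1)%R.
  by move=> a0; rewrite -[leRHS]expR0 ler_expR oppr_le0.
have ck1 k : (ck k <= 1)%R.
  have hf : ((tnth y k)`!%:R^-1 <= 1 :> R)%R.
    by rewrite invf_le1 ?ltr0n ?ler1n fact_gt0.
  have f0 : (0 <= (tnth y k)`!%:R^-1 :> R)%R by rewrite invr_ge0.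
  have e1 := hexp (tnth y k)%:R (ler0n _ _).
  have e2 := hexp (expR (ln Y + 1)) (expR_ge0 _).
  by apply: mulr_ile1; rewrite ?mulr_ge0 ?expR_ge0// mulr_ile1 ?expR_ge0.
pose c := (\prod_(k < m.+1) ck k)%R.
have c0 : (0 < c)%R by apply: prodr_gt0.
have c1 : (c <= 1)%R by apply: prodr_ile1 => k _; rewrite ltW//=.
exists (c * p)%R; first exact: mulr_gt0.
move=> theta z theta1; rewrite mulrAC.
apply: le_trans (hp (alpha_hat y theta) _ _) _.
  by rewrite mulr_ge0 ?expR_ge0// ltW.
have w0 (z' : pf_state R m N) : (0 <= \prod_(k < m.+1) in_box (tnth z'.1 k))%R.
  by apply: prodr_ge0 => k _; case: (in_box01 (tnth z'.1 k)) => ->.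
apply (monotone_proposal N y rho sigma theta).2 => z'.
  by rewrite lee_fin !mulr_ge0 ?expR_ge0// ltW.
rewrite lee_fin.
have [hz|] := pselect (forall k, in_box (tnth z'.1 k) = 1%R); last first.
  move=> /existsNP [k hk].
  have -> : (\prod_(k < m.+1) in_box (tnth z'.1 k) = 0)%R.
    rewrite (bigD1 k)//=; case: (in_box01 (tnth z'.1 k)) => [->|//].
    by rewrite mul0r.
  by rewrite mulr0 accept_prob_ge0.
rewrite big1 ?mulr1//.
have psz0 : (0 <= Y * psnorm z.1)%R by rewrite mulr_ge0 ?psnorm_ge0.
rewrite le_min; apply/andP; split.
  by apply: mulr_ile1; rewrite ?expR_ge0 ?hexp// ltW.
set alpha := alpha_hat y theta.
have al : (alpha <= ln Y)%R.
  rewrite /alpha /alpha_hat ler_ln ?posrE ?divr_gt0//; last exact: lt_le_trans theta1.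
  by rewrite ler_pdivrMr ?(lt_le_trans _ theta1)// ler_peMr// ltW.
rewrite ler_pdivlMr ?Zhat_gt0//.
apply: le_trans (ler_wpM2l _ (Zhat_le alpha z)) _.
  by rewrite mulr_ge0 ?expR_ge0// ltW.
rewrite mulrACA -expRD addNr expR0.
rewrite mulr1 /c -big_split/=; apply: ler_prod => k _.
apply/andP; split; first by rewrite mulr_ge0 ?expR_ge0// ltW.
apply: average_ge => i.
have hi := in_boxP i (hz k).
apply: (le_trans _ (obs_prob_ge (l := (alpha - 1)%R) (h := (ln Y + 1)%R) _ _ _)).
- rewrite mulrBr mulr1 (expRD _ (- (tnth y k)%:R)) /ck le_eqVlt.
  by apply/orP; left; rewrite mulrC !mulrA.
- by move: hi; rewrite ler_norml => /andP[h _]; rewrite lerD2l.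
- by move: hi; rewrite ler_norml => /andP[_ h]; apply: lerD.
Qed.

Definition maxstat (z : pf_state R m N) : R := (m.+1%:R * expz 1 z)%R.

Lemma maxstat_ge0 z : (0 <= maxstat z)%R.
Proof. by rewrite mulr_ge0 ?expR_ge0. Qed.

Lemma suff_stat_le z j : (suff_stat (trajectory z j) <= maxstat z)%R.
Proof.
rewrite /suff_stat /maxstat.
apply: le_trans (ler_sum _ (fun k _ => _ : _ <= expz 1 z)%R) _; last first.
  by rewrite sumr_const card_ord mulr_natl.
move=> k _; rewrite tnth_mktuple /expz mul1r ler_expR.
apply: le_trans (le_psnorm z k (lineage z.2 j k)); exact: ler_norm.
Qed.

Lemma suff_stat_ge0 (u : m.+1.-tuple R) : (0 <= suff_stat u)%R.
Proof. by apply: sumr_ge0 => k _; exact: expR_ge0. Qed.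

(** The constant g is chosen so that what an acceptance removes from the first
    term, c exp(- ybar |z|) g expz (1 + ybar) z, is exactly maxstat z. *)
Lemma drift_large : exists g k b : R, [/\ (0 <= g)%R, (0 <= k)%R, (1 <= b)%R &
  forall theta z, (1 <= theta)%R ->
  pimh_step y rho sigma theta z (fun z' => (g * expz k z' + maxstat z')%:E) <=
    (g * expz k z + b)%:E].
Proof.
have [c c0 hc] := accept_ge.
have k0 : (0 <= 1 + Y)%R by rewrite addr_ge0// ltW.
have [C1 C10 hC1] := filter_moment N y sigma0 rho1 (@ler01 R).
have [C2 C20 hC2] := filter_moment N y sigma0 rho1 k0.
pose g := (m.+1%:R / c)%R.
have g0 : (0 <= g)%R by rewrite divr_ge0// ltW.
exists g, (1 + Y)%R, (Num.max 1 (g * C2 + m.+1%:R * C1))%R; split => //.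
  by rewrite le_max lexx.
move=> theta z theta1.
have mexp k : measurable_fun setT (fun z : pf_state R m N => expz k z) by exact: measurable_expz.
have hE := expectation_proposal N y sigma0 rho1 theta.
apply: le_trans (pimh_step_le (f := fun z' => (g * expz (1 + Y) z' + maxstat z')%R)
   (C := (g * C2 + m.+1%:R * C1)%R) sigma0 rho1 _ _ (hc theta z theta1) _) _.
- by apply: measurable_funD; apply: measurable_funM.
- by move=> z'; rewrite addr_ge0 ?maxstat_ge0// mulr_ge0// expR_ge0.
- under eq_fun do rewrite EFinD !EFinM.
  rewrite (expect_add hE); last 4 first.
  + by apply: emeasurable_funM => //; exact/measurable_EFinP.
  + by move=> z'; rewrite mule_ge0 ?lee_fin ?expR_ge0.
  + by apply: emeasurable_funM => //; exact/measurable_EFinP.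
  + by move=> z'; rewrite mule_ge0 ?lee_fin ?expR_ge0.
  rewrite !(expect_scale hE)//; try exact/measurable_EFinP; try by move=> z'; rewrite lee_fin expR_ge0.
  rewrite EFinD !EFinM.
  by apply: leeD; (apply: lee_wpmul2l; first by rewrite lee_fin); [exact: hC2|exact: hC1].
- rewrite lee_fin; set b := Num.max _ _; set a := (c * expR _)%R.
  have hb : (g * C2 + m.+1%:R * C1 <= b)%R by rewrite le_max lexx orbT.
  have hT : (a * (g * expz (1 + Y) z) = maxstat z)%R.
    rewrite /a /g /maxstat mulrCA mulrA mulrA divfK ?gt_eqF//.
    rewrite -mulrA /expz -expRD; congr (_ * expR _)%R.
    by rewrite mulrDl addrCA addNr addr0.
  have h0 : (0 <= a * maxstat z)%R.
    by rewrite mulr_ge0 ?maxstat_ge0// mulr_ge0 ?expR_ge0// ltW.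
  rewrite mulrBl mul1r mulrDr hT; move: h0 hb.
  by clear -a b; move: (a * maxstat z)%R (g * C2)%R => *; lra.
Qed.

End large_theta.

(** * Size of the statistic *)

Section statistic.
Context {R : realType}.
Variables (m N : nat) (y : m.+1.-tuple nat).
Implicit Types (theta : R) (z : pf_state R m N).

Lemma weighted_le alpha k (x : particles R N) (f : 'I_N.+1 -> R) c :
  (forall j, f j <= c) -> \sum_j norm_weight alpha k x j * f j <= c.
Proof.
move=> fc; rewrite -[leRHS]mul1r -(sum_norm_weight alpha k x) mulr_suml.
by apply: ler_sum => j _; rewrite ler_wpM2l// norm_weight_ge0.
Qed.

Lemma weighted_ge alpha k (x : particles R N) (f : 'I_N.+1 -> R) c :
  (forall j, c <= f j) -> c <= \sum_j norm_weight alpha k x j * f j.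
Proof.
move=> fc; rewrite -[leLHS]mul1r -(sum_norm_weight alpha k x) mulr_suml.
by apply: ler_sum => j _; rewrite ler_wpM2l// norm_weight_ge0.
Qed.

(** With 4 instead of 1, a state outside this event leaves a drift of at least
    3 theta, which is what [pull] needs. *)
Definition low_event theta : set (pf_state R m N) :=
  [set z | exists j, forall k, expR (tnth (trajectory z j) k) <= 4 * theta].

Lemma H_le theta z : H y theta z + theta <= maxstat z.
Proof. by rewrite /H subrK; apply: weighted_le => j; exact: suff_stat_le. Qed.

Lemma H_ge0 theta z : 0 <= H y theta z + theta.
Proof. by rewrite /H subrK; apply: weighted_ge => j; exact: suff_stat_ge0. Qed.

Lemma H_ge theta z : 0 <= theta ->
  4 * theta * (1 - \1_(low_event theta) z) <= H y theta z + theta.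
Proof.
move=> t0; rewrite indicE; have [|zl] := boolP (_ \in _).
  by rewrite subrr mulr0 H_ge0.
rewrite subr0 mulr1 /H subrK; apply: weighted_ge => j.
move: zl; rewrite notin_setE => /forallNP/(_ j)/existsNP[k /negP].
rewrite -ltNge => hk.
apply: le_trans (ltW hk) _.
by rewrite /suff_stat (bigD1 k)//= lerDl; apply: sumr_ge0 => i _; exact: expR_ge0.
Qed.

Lemma measurable_low_event {d} {S : measurableType d} (t : S -> R)
    (z : S -> pf_state R m N) :
  measurable_fun setT t -> measurable_fun setT z ->
  measurable [set s | low_event (t s) (z s)].
Proof.
move=> mt mz.
rewrite (_ : [set s | _] = \bigcup_(j in setT) \bigcap_(k in setT)
   [set s | expR (tnth (trajectory (z s) j) k) <= 4 * t s]).
  apply: fin_bigcup_measurable => [|j _]; first exact: finite_finset.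
  apply: fin_bigcap_measurable => [|k _]; first exact: finite_finset.
  rewrite -[X in measurable X]setTI; apply: measurable_fun_le => //.
    by apply: measurableT_comp => //; exact: measurable_trajectory.
  exact: measurable_funM.
apply/seteqP; split=> [s [j hj]|s [j _ hj]].
  by exists j => // k _; exact: hj.
by exists j => k; exact: hj.
Qed.

End statistic.

(** * Probability of a low proposal *)

Section draws_sum.
Local Open Scope ereal_scope.
Context {R : realType} {d : measure_display} {T : measurableType d}.

Lemma draws_sum_le n (E : 'I_n -> integrator R T) (f : T -> R) (e c : 'I_n -> R) :
  is_expectation (independent_draws E) ->
  (forall i, is_expectation (E i)) -> (forall i, monotone_integrator (E i)) ->
  measurable_fun setT f -> (forall t, 0 <= f t)%R -> (forall i, 0 <= c i)%R ->
  (forall i, E i (fun t => (f t)%:E) <= (e i)%:E) ->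
  independent_draws E (fun t => (\sum_(i < n) c i * f (tnth t i))%:E) <=
    (\sum_(i < n) c i * e i)%:E.
Proof.
move=> hD hE mE mf f0 c0 fe.
under eq_fun do rewrite -sumEFin.
rewrite (expect_sum hD).
- rewrite -sumEFin; apply: lee_sum => i _.
  exact: draws_marginal_le.
- move=> i; apply/measurable_EFinP; apply: measurable_funM => //.
  exact: (measurableT_comp mf (measurable_tnth i)).
- by move=> i t; rewrite lee_fin mulr_ge0.
Qed.

End draws_sum.

Section low_paths.
Local Open Scope ereal_scope.
Context {R : realType}.
Variables (m N : nat) (y : m.+1.-tuple nat) (rho sigma : R).
Hypothesis sigma0 : sigma != 0%R.
Hypothesis rho1 : (-1 < rho < 1)%R.
Let s0 := Num.sqrt (sigma ^+ 2 / (1 - rho ^+ 2))%R.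
Variable s : R.
Hypothesis s_ge0 : (0 <= s)%R.

Let t := ((1 - rho) * s / sigma ^+ 2)%R.

Definition low (u : R) : R := (u <= - s)%R%:R.
(** On the event u <= - s the tilt exp(c (- s - u)) is at least 1 for c >= 0.
    Integrated over a transition from x, the tilt of exponent t gives step_rate
    times the tilt of exponent rho t at x; at the last time there is none. *)
Definition tilt (r : nat) : R := (if r is 0 then 0 else rho * t)%R.
Definition step_rate : R := (expR (- ((1 - rho) ^+ 2 * s ^+ 2 / (2 * sigma ^+ 2))))%R.

Let sg2 : (0 < sigma ^+ 2)%R. Proof. by rewrite exprn_even_gt0. Qed.
Let t0 : (0 <= t)%R.
Proof. by rewrite divr_ge0 ?sqr_ge0// mulr_ge0// subr_ge0; case/andP: rho1 => _ /ltW. Qed.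

Lemma low_ge0 u : (0 <= low u)%R. Proof. by rewrite ler0n. Qed.

Lemma low_tilt_le (c tau u : R) : (c <= tau)%R ->
  (low u * expR (c * (- s - u)) <= expR (tau * (- s - u)))%R.
Proof.
move=> ct; rewrite /low; have [us|us] := boolP (u <= - s)%R; last by rewrite mul0r expR_ge0.
by rewrite mul1r ler_expR ler_wpM2r// subr_ge0.
Qed.

Lemma tilt_le r : (tilt r <= t)%R.
Proof.
case: r => [|r] //=; rewrite ler_piMl//.
by case/andP: rho1 => _ /ltW.
Qed.

Lemma lineage_cons0 r (a : ancestors N) (l : r.-tuple (ancestors N)) j :
  lineage [tuple of a :: l] j 0 = tnth a (lineage l j 0).
Proof. by rewrite /lineage /= drop0. Qed.

Lemma normal_tilt mu tau sg : sg != 0%R ->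
  \int[normal_prob mu sg]_u (expR (tau * (- s - u)))%:E =
  (expR (- (tau * s) - tau * mu + tau ^+ 2 * sg ^+ 2 / 2))%:E.
Proof.
move=> sg0.
transitivity (\int[normal_prob mu sg]_u
    ((expR (- (tau * s)))%:E * (expR (- tau * u))%:E)).
  by apply: eq_integral => u _; rewrite -EFinM -expRD mulrBr mulrN mulNr.
rewrite (expect_scale (expectation_normal mu sg0) (expR_ge0 _)); last 2 first.
- by apply/measurable_EFinP; apply: measurableT_comp => //; exact: measurable_funM.
- by move=> u; rewrite lee_fin expR_ge0.
by rewrite normal_mgf// -EFinM -expRD sqrrN mulNr addrA.
Qed.

Lemma expectation_propagate (x : particles R N) a :
  is_expectation (pf_propagate rho sigma x a).
Proof. exact: (kernelized_expectation (x, a) (kernelized_propagate N rho sigma0)). Qed.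

(** By induction on the remaining steps, phi being a weight on the particles of
    the current time. The factor N + 1 of each step allows for all the new
    particles to have the same ancestor. *)
Lemma steps_low_le alpha r l (x : particles R N) (phi : 'I_N.+1 -> R) :
  (forall i, 0 <= phi i)%R ->
  @pf_steps R m N y rho sigma alpha r l x (fun xas =>
    (\sum_j phi (lineage xas.2 j 0) *
      \prod_(k < r) low (tnth (tnth xas.1 k) (lineage xas.2 j k.+1)))%:E) <=
  ((N.+1%:R * step_rate) ^+ r *
    \sum_i phi i * expR (tilt r * (- s - tnth x i)))%:E.
Proof.
elim: r l x phi => [|r IH] l x phi phi0 /=.
  rewrite expr0 mul1r lee_fin; apply: ler_sum => j _.
  by rewrite big_ord0 mul0r expR0 /lineage/=.
have K0 : (0 <= (N.+1%:R * step_rate) ^+ r)%R.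
  by rewrite exprn_ge0// mulr_ge0// expR_ge0.
have S0 (f g : 'I_N.+1 -> R) :
   (forall i, 0 <= f i)%R -> (forall i, 0 <= g i)%R -> (0 <= \sum_i f i * g i)%R.
  by move=> f0 g0; apply: sumr_ge0 => i _; rewrite mulr_ge0.
have F0 (a : ancestors N) (x' : particles R N)
    (xas : r.-tuple (particles R N) * r.-tuple (ancestors N)) :
  0%R <= (\sum_j phi (lineage [tuple of a :: xas.2] j 0) *
      \prod_(k < r.+1) low (tnth (tnth [tuple of x' :: xas.1] k)
         (lineage [tuple of a :: xas.2] j k.+1)))%:E.
  rewrite lee_fin; apply: S0 => // j; apply: prodr_ge0 => k _; exact: low_ge0.
apply: resample_le_cst => [|a|a].
- by rewrite mulr_ge0 ?S0// ?exprn_ge0 ?mulr_ge0 ?expR_ge0// => i; exact: expR_ge0.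
- apply (monotone_propagate _ _ _ _).1 => x'.
  by apply (monotone_steps y rho sigma _ _ _ x').1 => xas; exact: F0.
apply: (@le_trans _ _ (pf_propagate rho sigma x a (fun x' =>
  (\sum_b ((N.+1%:R * step_rate) ^+ r * phi (tnth a b)) *
      expR (t * (- s - tnth x' b)))%:E))).
  apply (monotone_propagate _ _ _ _).2 => x'.
    by apply (monotone_steps y rho sigma _ _ _ x').1 => xas; exact: F0.
  have := IH l.+1 x' (fun b => phi (tnth a b) * low (tnth x' b))%R _.
  move=> /(_ (fun i => mulr_ge0 (phi0 _) (low_ge0 _))) H.
  apply: le_trans (le_trans _ H) _.
    apply: le_of_eq; congr pf_steps.
    apply/funext => xas; congr (_%:E); apply: eq_bigr => j _.
    rewrite lineage_cons0 big_ord_recl tnth0 mulrA; congr (_ * _ * _)%R.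
    by apply: eq_bigr => k _; rewrite tnthS.
  rewrite lee_fin mulr_sumr; apply: ler_sum => b _.
  rewrite -[leRHS]mulrA; apply: ler_wpM2l; first exact: K0.
  rewrite -mulrA; apply: ler_wpM2l; first exact: phi0.
  exact: low_tilt_le (tilt_le r).
refine (le_trans (@draws_sum_le R _ R N.+1
    (fun j (f : R -> \bar R) => \int[normal_prob (rho * tnth x (tnth a j)) sigma]_u f u)
    (fun u => expR (t * (- s - u)))%R
    (fun b => step_rate * expR (tilt r.+1 * (- s - tnth x (tnth a b))))%R
    (fun b => (N.+1%:R * step_rate) ^+ r * phi (tnth a b))%R _ _ _ _ _ _ _) _).
- exact: expectation_propagate.
- by move=> j; exact: expectation_normal.
- by move=> j; exact: monotone_normal.
- by apply: measurableT_comp => //; apply: measurable_funM => //; exact: measurable_funB.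
- by move=> u; exact: expR_ge0.
- by move=> b; rewrite mulr_ge0.
- move=> b; rewrite normal_tilt// lee_fin /step_rate -expRD ler_expR /tilt.
  apply: le_of_eq.
  rewrite /t; field; exact: sigma0.
- rewrite lee_fin exprSr; set K := (_ ^+ r)%R.
  pose psi i := (phi i * expR (tilt r.+1 * (- s - tnth x i)))%R.
  have psi0 i : (0 <= psi i)%R by rewrite mulr_ge0// expR_ge0.
  apply: (@le_trans _ _ (\sum_(b < N.+1) K * step_rate * (\sum_i psi i))%R).
    apply: ler_sum => b _; rewrite mulrACA ler_wpM2l ?mulr_ge0 ?expR_ge0//.
    by rewrite -/(psi _) (bigD1 (tnth a b))//= lerDl sumr_ge0.
  rewrite sumr_const card_ord -mulr_natl le_eqVlt; apply/orP; left; apply/eqP.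
  by rewrite /psi; ring.
Qed.

(** Half the quadratic form of the inverse covariance of the stationary AR(1)
    path (X_0, ..., X_m), at the constant path 1. *)
Definition exit_rate : R := ((1 - rho ^+ 2 + m%:R * (1 - rho) ^+ 2) / (2 * sigma ^+ 2))%R.

Lemma filter_low_le alpha :
  particle_filter y rho sigma alpha (fun z : pf_state R m N =>
    (\sum_j \prod_(k < m.+1) low (tnth (trajectory z j) k))%:E) <=
  (N.+1%:R ^+ m.+1 * expR (- (exit_rate * s ^+ 2)))%:E.
Proof.
have r21 := rho2_lt1 rho1.
pose tau := ((1 - rho ^+ 2) * s / sigma ^+ 2)%R.
have tauE : (tau ^+ 2 * s0 ^+ 2 = (1 - rho ^+ 2) * s ^+ 2 / sigma ^+ 2)%R.
  rewrite s0_sq// /tau; field; rewrite sigma0/= gt_eqF// subr_gt0//.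
have tilt_tau : (tilt m <= tau)%R.
  rewrite /tau /tilt /t; case: (m) => [|_].
    by rewrite divr_ge0 ?sqr_ge0// mulr_ge0// subr_ge0 ltW.
  rewrite !mulrA ler_wpM2r ?invr_ge0 ?sqr_ge0// ler_wpM2r//.
  by case/andP: rho1 => h1 h2; nra.
have K0 : (0 <= (N.+1%:R * step_rate) ^+ m)%R.
  by rewrite exprn_ge0// mulr_ge0// expR_ge0.
have F0 (z : pf_state R m N) :
    0%R <= (\sum_j \prod_(k < m.+1) low (tnth (trajectory z j) k))%:E.
  by rewrite lee_fin; apply: sumr_ge0 => j _; apply: prodr_ge0 => k _; exact: low_ge0.
apply: (@le_trans _ _ (@pf_init R N rho sigma (fun x =>
  (\sum_b (N.+1%:R * step_rate) ^+ m * expR (tau * (- s - tnth x b)))%:E))).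
  apply (monotone_init N rho sigma).2 => x.
    by apply (monotone_steps y rho sigma _ _ _ x).1 => xas; exact: F0.
  have := @steps_low_le alpha m 0 x (fun b => low (tnth x b)) (fun i => low_ge0 _).
  move=> H; apply: le_trans (le_trans _ H) _.
    apply: le_of_eq; congr pf_steps.
    apply/funext => xas; congr (_%:E); apply: eq_bigr => j _.
    rewrite big_ord_recl tnth_mktuple tnth0; congr (_ * _)%R.
    by apply: eq_bigr => k _; rewrite tnth_mktuple tnthS.
  rewrite lee_fin mulr_sumr; apply: ler_sum => b _.
  by rewrite ler_wpM2l//; exact: low_tilt_le.
have h1 : kernelized (fun _ : R => @pf_init R N rho sigma).
  apply: (kernelized_draws (E := fun (j : 'I_N.+1) (_ : R) (f : R -> \bar R) =>
    \int[normal_prob 0 s0]_u f u)) => j.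
  apply: (@kernelized_normal R _ R (fun=> 0%R)) => //.
  exact: (s0_neq0 sigma0 rho1).
have s00 := s0_neq0 sigma0 rho1.
refine (le_trans (@draws_sum_le R _ R N.+1
    (fun (j : 'I_N.+1) (f : R -> \bar R) => \int[normal_prob 0 s0]_u f u)
    (fun u => expR (tau * (- s - u)))%R
    (fun b => expR (- ((1 - rho ^+ 2) * s ^+ 2 / (2 * sigma ^+ 2))))%R
    (fun b => (N.+1%:R * step_rate) ^+ m)%R _ _ _ _ _ _ _) _).
- refine (@kernelized_expectation R _ _ _ R _ 0%R h1).
- by move=> j; exact: expectation_normal.
- by move=> j; exact: monotone_normal.
- by apply: measurableT_comp => //; apply: measurable_funM => //; exact: measurable_funB.
- by move=> u; exact: expR_ge0.
- by [].
- move=> b; rewrite normal_tilt// lee_fin ler_expR mulr0 subr0 tauE.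
  apply: le_of_eq.
  rewrite /tau; field; exact: sigma0.
- rewrite sumr_const card_ord lee_fin -[leLHS]mulr_natl exprMn /step_rate -expRM_natl.
  rewrite mulrA mulrA -exprS -mulrA -expRD ler_wpM2l ?exprn_ge0// ler_expR.
  apply: le_of_eq.
  rewrite /exit_rate; field; exact: sigma0.
Qed.

End low_paths.

(** * Leaving the low states *)

Section escape.
Local Open Scope ereal_scope.
Context {R : realType}.
Variables (m N : nat) (y : m.+1.-tuple nat) (rho sigma : R).
Hypothesis sigma0 : sigma != 0%R.
Hypothesis rho1 : (-1 < rho < 1)%R.
Hypothesis hy : (0 < ybar y)%N.
Let s0 := Num.sqrt (sigma ^+ 2 / (1 - rho ^+ 2))%R.
Let Y : R := (ybar y)%:R.
Let L := ln (4 * Y)%R.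

Let Y1 : (1 <= Y)%R. Proof. by rewrite ler1n. Qed.
Let L0 : (0 <= L)%R. Proof. by apply: ln_ge0; move: Y1 => ?; lra. Qed.

Lemma nth_le_ybar l : (nth 0 y l <= ybar y)%N.
Proof.
have [lm|lm] := ltnP l m.+1; last by rewrite nth_default// size_tuple.
rewrite /ybar (bigD1 (Ordinal lm))//= (tnth_nth 0%N)/=; exact: leq_addr.
Qed.

Lemma alpha_hat_expR s : alpha_hat y (expR (- s) / 4) = (L + s)%R.
Proof.
have -> : (expR (- s) / 4 = (4 * expR s)^-1)%R.
  by rewrite invfM expRN mulrC.
rewrite /alpha_hat invrK mulrA lnM ?posrE ?expR_gt0//.
  by rewrite expRK /L mulrC.
by rewrite mulr_gt0// (lt_le_trans _ Y1).
Qed.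

Variable D : R.
Hypothesis D0 : (0 < D)%R.

Let p0 : R := ((ybar y)`!%:R^-1 * expR (- expR (L + D + 1)))%R.

Let p0_gt0 : (0 < p0)%R.
Proof. by rewrite mulr_gt0 ?expR_gt0// invr_gt0 ltr0n fact_gt0. Qed.

(** As alpha_hat is L + s, the intensity alpha + u stays in [L + D, L + D + 1]
    for all s. *)
Lemma obs_prob_ge_p0 s k u : (k <= ybar y)%N ->
  (- (s - D) <= u <= - (s - D) + 1)%R -> (p0 <= obs_prob (L + s) k u)%R.
Proof.
move=> ky /andP[u1 u2].
apply: (le_trans _ (obs_prob_ge (l := (L + D)%R) (h := (L + D + 1)%R) _ _ _)).
- rewrite ler_wpM2r ?expR_ge0// -[leLHS]mul1r ler_pM ?invr_ge0//.
    rewrite -[leLHS]expR0 ler_expR mulr_ge0// addr_ge0// ltW//.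
  rewrite lef_pV2 ?posrE ?ltr0n ?fact_gt0// ler_nat.
  exact: leq_fact.
- by move: u1; lra.
- by move: u2; lra.
Qed.

Variable s : R.
Hypothesis sD : (D + 1 <= s)%R.
Let s' := (s - D)%R.
Let theta : R := (expR (- s) / 4)%R.
Let I : set R := `[(- s')%R, (- s' + 1)%R]%classic.
Let s'1 : (1 <= s')%R. Proof. by move: sD; rewrite /s'; lra. Qed.

Let w (x : particles R N) : R := \1_I (tnth x ord0).

Let w01 x : w x = 0%R \/ w x = 1%R.
Proof. by rewrite /w indicE; case: (_ \in _); [right|left]. Qed.

Let w0 x : (0 <= w x)%R. Proof. by case: (w01 x) => ->. Qed.

Let wP x : w x = 1%R -> (- s' <= tnth x ord0 <= - s' + 1)%R.
Proof.
rewrite /w indicE; have [|_] := boolP (_ \in _).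
  by rewrite inE /I /= in_itv.
by move=> /esym/eqP; rewrite oner_eq0.
Qed.

Let e1 := (normal_peak sigma * expR (- ((1 - rho) * s' + 2) ^+ 2 / (sigma ^+ 2 *+ 2)))%R.
Let kappa := (e1 * (p0 / N.+1%:R))%R.

Let e1_ge0 : (0 <= e1)%R.
Proof. by rewrite mulr_ge0 ?normal_peak_ge0 ?expR_ge0. Qed.

Let mI : measurable_fun setT (\1_I : R -> R).
Proof. by apply: measurable_indic; rewrite /I. Qed.

Let itvI : (- s' <= - s' + 1)%R. Proof. by rewrite lerDl. Qed.

Let transition (v : R) : (- s' <= v <= - s' + 1)%R ->
  e1%:E <= \int[normal_prob (rho * v) sigma]_u (\1_I u)%:E.
Proof.
move=> hv; apply: le_trans (@normal_indic_ge R _ sigma _ _ ((1 - rho) * s' + 2)%R sigma0 itvI _).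
  by rewrite lee_fin addrC addKr mul1r.
move=> u hu; rewrite ler_norml.
case/andP: hu => u1 u2; case/andP: hv => v1 v2; case/andP: rho1 => r1 r2.
set a := (u + s')%R; set b := (v + s')%R.
have hu : u = (a - s')%R by rewrite addrK.
have hv : v = (b - s')%R by rewrite addrK.
have a0 : (0 <= a)%R by rewrite /a; lra.
have a1 : (a <= 1)%R by rewrite /a; lra.
have b0 : (0 <= b)%R by rewrite /b; lra.
have b1 : (b <= 1)%R by rewrite /b; lra.
have s'0 : (0 <= s')%R by apply: le_trans s'1.
clearbody a b; rewrite hu hv.
have rb : (`|rho * b| <= 1)%R.
  rewrite normrM (ger0_norm b0) mulr_ile1// ltW// ltr_norml r1//.
move: rb; rewrite ler_norml => /andP[rb1 rb2].
have q : (0 <= (1 - rho) * s')%R by rewrite mulr_ge0// subr_ge0 ltW.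
have -> : (a - s' - rho * (b - s') = a - rho * b - (1 - rho) * s')%R by ring.
by apply/andP; split; lra.
Qed.

Let kappa0 : (0 <= kappa)%R.
Proof. by rewrite mulr_ge0// divr_ge0// ltW. Qed.

Let weight_ge l (x : particles R N) : w x = 1%R ->
  (p0 / N.+1%:R <= norm_weight (L + s) (nth 0%N y l) x ord0)%R.
Proof.
move=> wx; rewrite /norm_weight; apply: ler_pM.
- exact: ltW.
- by rewrite invr_ge0.
- by apply: obs_prob_ge_p0; [exact: nth_le_ybar|exact: wP].
- rewrite lef_pV2 ?posrE ?ltr0n ?sum_obs_prob_gt0//.
  apply: le_trans (ler_sum _ (fun i _ => obs_prob_le1 _ _ _)) _.
  by rewrite sumr_const card_ord.
Qed.

(* Particle 0 is asked to choose itself as ancestor. *)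
Let step c l x : (0 <= c)%R -> w x = 1%R ->
  (c * kappa)%:E <= pf_resample (L + s) (nth 0%N y l) x (fun a =>
    pf_propagate rho sigma x a (fun x' => (c * w x')%:E)).
Proof.
move=> c0 wx.
pose f (i : 'I_N.+1) : R := (i == ord0)%:R.
apply: (@le_trans _ _ (pf_resample (L + s) (nth 0%N y l) x
   (fun a => (c * e1 * f (tnth a ord0))%:E))).
  rewrite /kappa mulrA.
  refine (@draws_marginal_ge R _ 'I_N.+1 N.+1 _ ord0 f _ _ _ _ _ _ _ _ _).
  - move=> j; refine (@kernelized_expectation R _ _ _ R _ 0%R (@kernelized_mixture R _ _ R 'I_N.+1 N.+1
      (fun i _ => norm_weight (L + s) (nth 0%N y l) x i) (fun i _ => i) _ _ _ _)) => //.
    + by move=> i _; exact: norm_weight_ge0.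
    + by move=> _; exact: sum_norm_weight.
  - move=> j; apply: (@monotone_mixture _ _ _ _ id) => i; exact: norm_weight_ge0.
  - by [].
  - by move=> i; rewrite /f ler0n.
  - by rewrite mulr_ge0.
  - by rewrite divr_ge0// ltW.
  - rewrite big_ord_recl /f eqxx mule1 -[leLHS]adde0; apply: leeD.
      by rewrite lee_fin; exact: weight_ge.
    by apply: sume_ge0 => i _; rewrite mule_ge0// lee_fin norm_weight_ge0.
apply (monotone_resample _ _ _).2 => a.
  by rewrite lee_fin; apply: mulr_ge0; [exact: mulr_ge0|exact: ler0n].
rewrite /f; have [a0|_] := eqVneq (tnth a ord0) ord0; last first.
  rewrite mulr0; apply (monotone_propagate _ _ _ _).1 => x'.
  by rewrite lee_fin mulr_ge0.
rewrite mulr1; refine (@draws_marginal_ge R _ R N.+1 _ ord0 (\1_I) e1 c _ _ _ _ _ _ _) => //.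
- by move=> j; exact: expectation_normal.
- by move=> j; exact: monotone_normal.
- by rewrite a0; apply: transition; exact: wP.
Qed.

Let e2 := (normal_peak s0 * expR (- s' ^+ 2 / (s0 ^+ 2 *+ 2)))%R.
Let e3 := (normal_peak s0 * expR (- 1 ^+ 2 / (s0 ^+ 2 *+ 2)))%R.

Let wj (j : 'I_N.+1) : R -> R :=
  (if j == ord0 then \1_I else \1_(`[0, 1]%classic : set R))%R.

Let winit (x : particles R N) : R := (\prod_(j < N.+1) wj j (tnth x j))%R.

Let wj01 j u : wj j u = 0%R \/ wj j u = 1%R.
Proof.
by rewrite /wj; case: ifP => _; rewrite indicE; case: (_ \in _); [right|left|right|left].
Qed.

Let winit01 x : winit x = 0%R \/ winit x = 1%R.
Proof.
rewrite /winit; elim/big_ind: _ => [|a b|j _]; first by right.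
- by move=> [->|->] [->|->]; rewrite ?mul0r ?mulr0 ?mulr1; [left|left|left|right].
- exact: wj01.
Qed.

Let winit0 x : (0 <= winit x)%R. Proof. by case: (winit01 x) => ->. Qed.

Let winitP x : winit x = 1%R -> w x = 1%R /\ forall j, (- s < tnth x j)%R.
Proof.
move=> h.
have hj j : wj j (tnth x j) = 1%R.
  move: h; rewrite /winit (bigD1 j)//=; case: (wj01 j (tnth x j)) => [->|//].
  by rewrite mul0r => /esym/eqP; rewrite oner_eq0.
have h0 := hj ord0; rewrite /wj eqxx in h0.
split; first exact: h0.
move=> j; have := hj j; rewrite /wj; case: eqP => [-> /wP /andP[h1 _]|_].
  by apply: lt_le_trans h1; rewrite /s'; move: D0; lra.
rewrite indicE; have [|_] := boolP (_ \in _); last by move=> /esym/eqP; rewrite oner_eq0.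
rewrite inE/= in_itv/= => /andP[h1 _] _.
by apply: lt_le_trans h1; move: sD D0; lra.
Qed.

Let init_ge c : (0 <= c)%R ->
  (c * (e2 * e3 ^+ N))%:E <= @pf_init R N rho sigma (fun x => (c * winit x)%:E).
Proof.
move=> c0; have s00 := s0_neq0 sigma0 rho1.
have e20 : (0 <= e2)%R by rewrite mulr_ge0 ?normal_peak_ge0 ?expR_ge0.
have e30 : (0 <= e3)%R by rewrite mulr_ge0 ?normal_peak_ge0 ?expR_ge0.
have -> : (e2 * e3 ^+ N = \prod_(j < N.+1) (if j == ord0 then e2 else e3))%R.
  rewrite big_ord_recl eqxx; congr (_ * _)%R.
  by rewrite prodr_const card_ord.
refine (@draws_prod_ge R _ R N.+1 _ wj
  (fun j => if j == ord0 then e2 else e3) c _ _ _ _ _ _ _) => //.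
- by move=> j; exact: expectation_normal.
- by move=> j; exact: monotone_normal.
- by move=> j; rewrite /wj; case: ifP => // _; apply: measurable_indic.
- by move=> j t; case: (wj01 j t) => ->.
- by move=> j; case: ifP.
- move=> j; rewrite /wj; case: ifP => _.
    apply: le_trans (@normal_indic_ge R 0 s0 _ _ s' s00 itvI _).
      by rewrite lee_fin (addrC (- s')%R) addrK mul1r.
    move=> u /andP[u1 u2]; rewrite subr0 ler_norml u1/=.
    by apply: le_trans u2 _; move: s'1; lra.
  apply: le_trans (@normal_indic_ge R 0 s0 0 1 1%R s00 ler01 _).
    by rewrite lee_fin subr0 mul1r.
  by move=> u /andP[u1 u2]; rewrite subr0 ger0_norm.
Qed.

(** Particle 0 moves in I, slightly above - s, and has itself as ancestor; its
    likelihood alone keeps [Zhat] above (p0 / (N + 1))^(m + 1). The other particles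
    start in [0, 1]. So all trajectories start above - s, and the state is not low. *)
Lemma escape_ge z :
  ((p0 / N.+1%:R) ^+ m.+1 * (kappa ^+ m * (e2 * e3 ^+ N)))%:E <=
  proposal y rho sigma theta (fun z' =>
    (accept_prob y theta z z' * \1_(~` @low_event R m N theta) z')%:E).
Proof.
have thE : alpha_hat y theta = (L + s)%R by rewrite alpha_hat_expR.
have pN : (0 <= p0 / N.+1%:R)%R by rewrite divr_ge0// ltW.
rewrite /proposal thE (mulrA ((p0 / N.+1%:R) ^+ m.+1)%R).
have H := @init_ge ((p0 / N.+1%:R) ^+ m.+1 * kappa ^+ m)%R.
apply: le_trans (H _) _; first by rewrite mulr_ge0// exprn_ge0.
apply (monotone_init N rho sigma).2 => x.
  by rewrite lee_fin !mulr_ge0// exprn_ge0.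
have F0 z' : 0%R <= (accept_prob y theta z z' * \1_(~` @low_event R m N theta) z')%:E.
  by rewrite lee_fin mulr_ge0// accept_prob_ge0.
case: (winit01 x) => wx.
  by rewrite wx mulr0; apply (monotone_steps y rho sigma _ _ _ x).1 => xas; exact: F0.
have [wx1 hx] := winitP wx.
rewrite wx mulr1; have H2 := steps_event_ge w01 kappa0 step m 0 (exprn_ge0 m.+1 pN) wx1.
apply: le_trans H2 _.
apply (monotone_steps y rho sigma _ _ _ x).2 => xas.
  by rewrite lee_fin mulr_ge0 ?exprn_ge0// prodr_ge0.
have [hw|] := pselect (forall k, w (tnth xas.1 k) = 1%R); last first.
  move=> /existsNP [k hk].
  have -> : (\prod_(k < m) w (tnth xas.1 k) = 0)%R.
    by rewrite (bigD1 k)//=; case: (w01 (tnth xas.1 k)) => [->|//]; rewrite mul0r.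
  by rewrite mulr0; exact: F0.
rewrite big1 ?mulr1//.
set z' : pf_state R m N := ([tuple of x :: xas.1], xas.2).
have -> : \1_(~` @low_event R m N theta) z' = 1%R :> R.
  rewrite indicE mem_set//= => -[j /(_ ord0)].
  rewrite tnth_mktuple tnth0 /theta mulrC divfK//.
  by rewrite ler_expR leNgt hx.
rewrite mulr1 lee_fin; apply: le_trans (accept_prob_geZ _ _ _ _).
rewrite thE /Zhat -[X in (_ ^+ X)%R](card_ord m.+1) -prodr_const.
apply: ler_prod => k _; rewrite pN/= mulrC ler_wpM2l ?invr_ge0//.
rewrite (bigD1 ord0)//= -[leLHS]addr0; apply: lerD.
  apply: obs_prob_ge_p0.
    by rewrite (tnth_nth 0%N); exact: nth_le_ybar.
  apply: wP; rewrite /z' /=.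
  have [->|[k' ->]] : k = ord0 \/ exists k', k = lift ord0 k'.
    by case: (unliftP ord0 k) => [k' ->|->]; [right; exists k'|left].
    by rewrite tnth0.
  by rewrite tnthS.
by apply: sumr_ge0 => i _; exact/ltW/obs_prob_gt0.
Qed.

End escape.

(** * Drift for small parameters *)

Section small_theta.
Local Open Scope ereal_scope.
Context {R : realType}.
Variables (m N : nat) (y : m.+1.-tuple nat) (rho sigma : R).
Hypothesis sigma0 : sigma != 0%R.
Hypothesis rho1 : (-1 < rho < 1)%R.
Hypothesis hy : (0 < ybar y)%N.
Let s0 := Num.sqrt (sigma ^+ 2 / (1 - rho ^+ 2))%R.
Let Q : R := exit_rate m rho sigma.
Let A : R := (3 * N.+1%:R ^+ m.+1)%R.

Let sg2 : (0 < sigma ^+ 2)%R. Proof. by rewrite exprn_even_gt0. Qed.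

Lemma exit_rate_gt0 : (0 < Q)%R.
Proof.
rewrite /Q /exit_rate; apply: divr_gt0; last exact: mulr_gt0.
by rewrite ltr_pwDl ?subr_gt0 ?(rho2_lt1 rho1)// mulr_ge0 ?sqr_ge0.
Qed.

Let A_gt0 : (0 < A)%R. Proof. by rewrite mulr_gt0// exprn_gt0. Qed.

(** With s - D instead of s, the exponent gains 2 Q D s, against losses at most
    P s + O(1). The choice 2 Q D = 1 + P leaves a margin s, which absorbs the
    constants, among them the factor 3 in A. *)
Lemma escape_rate : exists2 S0 : R, (0 <= S0)%R & forall s (z : pf_state R m N), (S0 <= s)%R ->
  (A * expR (- (Q * s ^+ 2)) <= 1)%R /\
  (A * expR (- (Q * s ^+ 2)))%:E <=
    proposal y rho sigma (expR (- s) / 4)%R (fun z' =>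
    (accept_prob y (expR (- s) / 4) z z' *
      \1_(~` @low_event R m N (expR (- s) / 4)) z')%:E).
Proof.
have Q0 := exit_rate_gt0.
pose p (D : R) : R := ((ybar y)`!%:R^-1 * expR (- expR (ln (4 * (ybar y)%:R) + D + 1)))%R.
have p_gt0 D : (0 < p D)%R by rewrite mulr_gt0 ?expR_gt0// invr_gt0 ltr0n fact_gt0.
pose P : R := (2 * m%:R * (1 - rho) / sigma ^+ 2)%R.
have P0 : (0 <= P)%R.
  by rewrite divr_ge0 ?sqr_ge0// !mulr_ge0// subr_ge0; case/andP: rho1 => _ /ltW.
pose D : R := ((1 + P) / (2 * Q))%R.
have D0 : (0 < D)%R by apply: divr_gt0; [apply: ltr_pwDl|apply: mulr_gt0].
have s00 : s0 != 0%R := s0_neq0 sigma0 rho1.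
pose e3 : R := (normal_peak s0 * expR (- 1 ^+ 2 / (s0 ^+ 2 *+ 2)))%R.
have e30 : (0 < e3)%R by rewrite mulr_gt0 ?expR_gt0 ?normal_peak_gt0.
pose b : R := (p D / N.+1%:R)%R.
have b0 : (0 < b)%R by rewrite divr_gt0.
pose C0 : R := (b ^+ m.+1 * ((normal_peak sigma * b) ^+ m * (normal_peak s0 * e3 ^+ N)))%R.
have C00 : (0 < C0)%R.
  have pk0 := normal_peak_gt0 sigma0; have pk1 := normal_peak_gt0 s00.
  apply: mulr_gt0; first exact: exprn_gt0.
  apply: mulr_gt0; first by apply: exprn_gt0; exact: mulr_gt0.
  by apply: mulr_gt0 => //; exact: exprn_gt0.
pose S1 : R := (Q * D ^+ 2 + 2 * m%:R / sigma ^+ 2 + ln (A / C0))%R.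
exists (Num.max (D + 1) (Num.max S1 (ln A / Q)))%R.
  by rewrite le_max addr_ge0// ltW.
move=> s z; rewrite !ge_max => /and3P[sD sS1 sA]; split.
  have s1 : (1 <= s)%R by apply: le_trans sD; rewrite lerDr ltW.
  rewrite -[A]lnK ?posrE// -expRD -[leRHS]expR0 ler_expR subr_le0.
  apply: (@le_trans _ _ (Q * s)%R); first by rewrite -ler_pdivrMl// mulrC.
  by rewrite ler_wpM2l ?(ltW Q0)// expr2 ler_peMl// (le_trans _ s1).
have H := @escape_ge R m N y rho sigma sigma0 rho1 hy D D0 s sD z.
apply: le_trans H; rewrite lee_fin -/(p D) -/b -/s0 -/e3.
set s' := (s - D)%R.
have s'0 : (0 <= s')%R by rewrite subr_ge0 (le_trans _ sD)// lerDl.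
rewrite [leRHS](_ : _ = C0 * expR (- (Q * s' ^+ 2 + P * s' + 2 * m%:R / sigma ^+ 2)))%R.
  rewrite -[A]lnK ?posrE// -[C0]lnK ?posrE// -!expRD ler_expR.
  have -> : s' = (s - D)%R by [].
  move: sS1; rewrite /S1 lnM ?posrE ?invr_gt0// lnV ?posrE//.
  have hD : (2 * Q * D = 1 + P)%R by rewrite /D mulrCA divff ?mulr1// gt_eqF// mulr_gt0.
  have PD : (0 <= P * D)%R by rewrite mulr_ge0// ltW.
  have hD2 : (2 * Q * D * s = (1 + P) * s)%R by rewrite hD.
  move=> h; clear -h hD2 PD.
  set M := (2 * m%:R / sigma ^+ 2)%R in h *.
  have -> : (Q * (s - D) ^+ 2 = Q * s ^+ 2 - 2 * Q * D * s + Q * D ^+ 2)%R by ring.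
  rewrite hD2; clear hD2; move: (ln A) (ln C0) (Q * s ^+ 2)%R (Q * D ^+ 2)%R h => ? ? ? ? h.
  rewrite mulrDl mul1r mulrBr; clearbody M; clear -h PD; move: (P * s)%R (P * D)%R PD h => *; lra.
rewrite /C0 -/s'.
set pk := normal_peak sigma; set pk0 := normal_peak s0.
set E1 := expR (- ((1 - rho) * s' + 2) ^+ 2 / (sigma ^+ 2 *+ 2)).
set E2 := expR (- s' ^+ 2 / (s0 ^+ 2 *+ 2)).
transitivity (b ^+ m.+1 * ((pk * b) ^+ m * (pk0 * e3 ^+ N)) * (E1 ^+ m * E2))%R.
  have -> : (pk * E1 * b = pk * b * E1)%R by rewrite mulrAC.
  rewrite (exprMn _ _ E1).
  by clearbody E1 E2 pk pk0 b e3; ring.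
congr (_ * _)%R; rewrite /E1 /E2 -expRM_natl -expRD; congr expR.
rewrite s0_sq// /Q /exit_rate /P; field.
rewrite sigma0/= gt_eqF// subr_gt0; exact: rho2_lt1.
Qed.

Lemma low_event_le s (t : R) (z : pf_state R m N) :
  t = (expR (- s) / 4)%R ->
  (\1_(low_event t) z <= \sum_j \prod_(k < m.+1) low s (tnth (trajectory z j) k) :> R)%R.
Proof.
move=> ->; rewrite indicE; have [|_] := boolP (_ \in _); last first.
  by apply: sumr_ge0 => j _; apply: prodr_ge0 => k _; exact: low_ge0.
rewrite inE => -[j hj]; rewrite (bigD1 j)//= [X in (X + _)%R]big1 => [|k _].
  by rewrite lerDl; apply: sumr_ge0 => i _; apply: prodr_ge0 => k _; exact: low_ge0.
have := hj k; rewrite mulrC divfK// ler_expR /low => ->.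
by [].
Qed.

(** Equal to 2 t / r, where r = A exp(- Q s^2) with s = - ln (4 t) bounds from below
    the probability of leaving [low_event]. *)
Definition corrector (t : R) : R := (2 * t / A * expR (Q * (ln (4 * t)) ^+ 2))%R.

(** In the event, leaving it removes corrector t * r = 2 t on average. Outside,
    it is entered with probability at most r / 3. *)
Lemma drift_small : exists a q : R, [/\ (0 < a)%R, (0 <= q)%R,
  (forall t, 0 < t <= a -> corrector t <= expR (q / t))%R &
  forall t (z : pf_state R m N), (0 < t <= a)%R ->
  pimh_step y rho sigma t z (fun z' =>
    ((corrector t + 4 * t) * \1_(low_event t) z')%:E) <=
  (corrector t * \1_(low_event t) z + 2 * t)%:E].
Proof.
have [S0 S00 hS] := escape_rate; have Q0 := exit_rate_gt0.
have ht t : (0 < t <= expR (- S0) / 4)%R ->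
    t = (expR (- - ln (4 * t)) / 4)%R /\ (S0 <= - ln (4 * t))%R.
  move=> /andP[t0 ta].
  have t40 : (0 < 4 * t)%R by rewrite mulr_gt0.
  split; first by rewrite opprK lnK ?posrE// mulrAC mulfV// mul1r.
  rewrite lerNr -[leRHS]expRK ler_ln ?posrE ?expR_gt0//.
  by move: ta; rewrite ler_pdivlMr// mulrC.
exists (expR (- S0) / 4)%R, (Q / 2)%R; split.
- by rewrite divr_gt0// expR_gt0.
- by rewrite divr_ge0// ltW.
- move=> t tI; have [tE sS] := ht t tI; case/andP: tI => t0 ta.
  set s := (- ln (4 * t))%R in tE sS *.
  have s_ge0 : (0 <= s)%R by exact: le_trans sS.
  rewrite /corrector -[leRHS]mul1r; apply: ler_pM.
  + by rewrite divr_ge0 ?mulr_ge0// ltW.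
  + exact: expR_ge0.
  + rewrite ler_pdivrMr// mul1r.
    have A3 : (1 <= A)%R.
      by rewrite /A -[leLHS]mulr1 ler_pM ?ler1n// exprn_ege1// ler1n//.
    apply: le_trans A3.
    have : (expR (- S0) <= 1)%R by rewrite -[leRHS]expR0 ler_expR oppr_le0.
    by move: ta; lra.
  + rewrite ler_expR -mulrA; apply: ler_wpM2l; first exact: ltW.
    rewrite (_ : ln (4 * t) = - s)%R; last by rewrite opprK.
    rewrite sqrrN.
    have h := expR_ge1Dxn 1 s_ge0.
    have tE' : (t^-1 = 4 * expR s)%R by rewrite tE invfM expRN !invrK mulrC.
    rewrite tE'; move: h; rewrite (_ : 2`! = 2%N)//.
    by move: (s ^+ 2)%R (expR s) => ? ?; lra.
- move=> t z tI; have [tE sS] := ht t tI; case/andP: tI => t0 ta.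
  set s := (- ln (4 * t))%R in tE sS.
  have s_ge0 : (0 <= s)%R by exact: le_trans sS.
  have [r1 hr] := hS s z sS.
  set r := (A * expR (- (Q * s ^+ 2)))%R in r1 hr.
  rewrite -tE in hr.
  have r0 : (0 < r)%R by rewrite mulr_gt0// expR_gt0.
  have Kr : (corrector t * r = 2 * t)%R.
    rewrite /corrector /r -(sqrrN (ln _)) -/s mulrACA -expRD subrr expR0 mulr1.
    by rewrite divfK// gt_eqF.
  have K0 : (0 <= corrector t)%R by rewrite mulr_ge0 ?expR_ge0// divr_ge0 ?mulr_ge0// ltW.
  have mlow : measurable (@low_event R m N t).
    exact: (measurable_low_event (t := fun=> t) (z := id)).
  have hq : proposal y rho sigma t (fun z' => (\1_(@low_event R m N t) z')%:E) <= (r / 3)%:E.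
    apply: (@le_trans _ _ (proposal y rho sigma t (fun z' : pf_state R m N =>
       (\sum_j \prod_(k < m.+1) low s (tnth (trajectory z' j) k))%:E))).
      apply (monotone_proposal N y rho sigma t).2 => z' //.
      by rewrite lee_fin low_event_le.
    apply: le_trans (filter_low_le N y sigma0 rho1 s_ge0 _) _.
    rewrite lee_fin /r /A -/Q; move: (expR _) (_ ^+ m.+1)%R => u v.
    by rewrite mulrAC (mulrAC 3%R) mulfV// mul1r.
  have h := pimh_step_indic_le sigma0 rho1 mlow hr hq.
  under eq_fun do rewrite EFinM.
  rewrite (expect_scale (expectation_pimh_step y sigma0 rho1 t z)).
  + apply: (@le_trans _ _ ((corrector t + 4 * t) * (if z \in low_event t then 1 - r else r / 3))%:E).
      by rewrite EFinM; apply: lee_wpmul2l => //; rewrite lee_fin addr_ge0// mulr_ge0// ltW.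
    rewrite lee_fin indicE; case: (z \in _).
      have tr : (0 <= t * r)%R by rewrite mulr_ge0// ltW.
      have -> : ((corrector t + 4 * t) * (1 - r) =
          corrector t + 4 * t - corrector t * r - 4 * (t * r))%R by ring.
      rewrite mulr1 Kr; move: tr; move: (t * r)%R (corrector t) => ? ? ?; lra.
    have tr : (t * r <= t)%R by rewrite ler_piMr// ltW.
    have -> : ((corrector t + 4 * t) * (r / 3) =
        (corrector t * r) / 3 + 4 * (t * r) / 3)%R by ring.
    rewrite mulr0 Kr; move: tr; move: (t * r)%R => ? ?; lra.
  + by rewrite addr_ge0// mulr_ge0// ltW.
  + by apply/measurable_EFinP/measurable_indic.
  + by move=> z'; rewrite lee_fin.
Qed.

Lemma measurable_corrector : measurable_fun setT corrector.
Proof.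
apply: measurable_funM.
  by apply: measurable_funM => //; apply: measurable_funM.
apply: (@measurableT_comp _ _ _ _ _ _ (@expR R)) => //.
apply: measurable_funM => //; apply: measurable_funX.
exact: (@measurableT_comp _ _ _ _ _ _ (@ln R)).
Qed.

Lemma corrector_ge0 t : (0 <= t)%R -> (0 <= corrector t)%R.
Proof. by move=> t0; rewrite mulr_ge0 ?expR_ge0// divr_ge0 ?mulr_ge0// ltW. Qed.

End small_theta.

(** * Joint laws from conditional laws *)

Section conditional_law.
Local Open Scope ereal_scope.
Context {R : realType} {d d1 d2 : measure_display}.
Context {Omega : measurableType d} {T : measurableType d1} {S : measurableType d2}.
Variables (P : probability Omega R) (Y : Omega -> T) (X : Omega -> S).
Hypotheses (mY : measurable_fun setT Y) (mX : measurable_fun setT X).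

(** The two sides are integrals against finite measures on T * S that agree on
    rectangles. *)
Lemma integral_conditional_law (K : T -> integrator R S) : kernelized K ->
  (forall C B, measurable C -> measurable B ->
    P (Y @^-1` C `&` X @^-1` B) =
      \int[P]_(w in Y @^-1` C) K (Y w) (fun z => (\1_B z)%:E)) ->
  forall f : T * S -> \bar R, measurable_fun setT f -> (forall p, 0 <= f p) ->
  \int[P]_w f (Y w, X w) = \int[P]_w K (Y w) (fun z => f (Y w, z)).
Proof.
move=> kK hP f mf f0; have [k hk] := kK.
pose MY := @isMeasurableFun.Build _ _ Omega T Y mY.
pose Y' : {mfun Omega >-> T} := HB.pack Y MY.
have mYX : measurable_fun setT (fun w => (Y w, X w)) by exact: measurable_fun_pair.
pose MYX := @isMeasurableFun.Build _ _ Omega (T * S)%type (fun w => (Y w, X w)) mYX.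
pose YX : {mfun Omega >-> (T * S)%type} := HB.pack (fun w => (Y w, X w)) MYX.
have k1 : @kernelized R _ _ unit T (fun _ g => \int[P]_w g (Y w)).
  apply: (@kernelizedI R _ _ unit T _ (fun _ => distribution P Y')).
  - by move=> U mU; exact: measurable_cst.
  - by move=> s; exact: probability_setT.
  - by move=> _ g mg g0; rewrite ge0_integral_distribution.
have k2 : kernelized (fun (ut : unit * T) (g : T * S -> \bar R) =>
    K ut.2 (fun z => g (ut.2, z))).
  apply: (@kernelized_map R _ _ _ (unit * T)%type S (T * S)%type (fun ut => K ut.2)
     (fun p => (p.1.2, p.2))).
    by apply: measurable_fun_pair => //; exact: measurableT_comp.
  exact: (@kernelized_comp R _ _ _ (unit * T)%type T S K snd).
have [m2 hm2] := kernelized_bind k1 k2.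
transitivity (\int[m2 tt]_p f p); last by rewrite -hm2.
transitivity (\int[distribution P YX]_p f p).
  by rewrite ge0_integral_distribution.
apply: eq_measure_integral => A mA _.
pose G : set (set (T * S)) :=
  [set C | exists A, measurable A /\ exists B, measurable B /\ C = A `*` B].
apply: (measure_unique G (fun=> setT)) => //.
- rewrite measurable_prod_measurableType //; congr (<<s _ >>).
  rewrite predeqE; split => [[A1 mA1 [B mB <-]]|[A1 [mA1 [B [mB ->]]]]].
    by exists A1; split => //; exists B.
  by exists A1 => //; exists B.
- move=> _ _ [X1 [mX1 [X2 [mX2 ->]]]] [Y1 [mY1 [Y2 [mY2 ->]]]].
  rewrite -setXI; exists (X1 `&` Y1); split; first exact: measurableI.
  by exists (X2 `&` Y2); split => //; exact: measurableI.
- by move=> _; exists setT; split => //; exists setT; split => //; rewrite setXTT.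
- by rewrite bigcup_const.
- move=> _ [A1 [mA1 [B [mB ->]]]].
  transitivity (P (Y @^-1` A1 `&` X @^-1` B)); first by [].
  rewrite hP//.
  transitivity (\int[m2 tt]_p (\1_(A1 `*` B) p)%:E); last first.
    by rewrite integral_indic ?setIT//; exact: measurableX.
  rewrite -hm2/=; last 2 first.
  + by apply/measurable_EFinP/measurable_indic; exact: measurableX.
  + by move=> p; rewrite lee_fin.
  have mAB w : measurable_fun setT (fun z : S => (\1_(A1 `*` B) (Y w, z) : R)%:E).
    apply/measurable_EFinP.
    apply: (measurableT_comp (f := \1_(A1 `*` B) : T * S -> R)).
      by apply: measurable_indic; exact: measurableX.
    exact: measurable_fun_pair.
  rewrite integral_mkcond; apply: eq_integral => w _ /=.
  rewrite patchE; case: ifPn => wA.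
    rewrite (hk _ (fun z => (\1_B z)%:E))//; last first.
      exact/measurable_EFinP/measurable_indic.
    rewrite (hk _ _ (mAB w)); last by move=> t; rewrite lee_fin.
    apply: eq_integral => z _; rewrite !indicE; congr (_%:R%:E).
    rewrite in_setX/=.
    by move: wA; rewrite in_setE/= => /mem_set ->.
  rewrite (hk _ _ (mAB w)); last by move=> t; rewrite lee_fin.
  rewrite integral0_eq// => z _; rewrite indicE in_setX/=.
  have -> // : (Y w \in A1) = false.
  by apply/negbTE; move: wA; rewrite !notin_setE.
- by move=> _; rewrite -ge0_fin_numE ?fin_num_measure.
Qed.

End conditional_law.

Section uniform.
Context {R : realType}.

Lemma uniform_prob_le (p : R) : 0 <= p <= 1 ->
  uniform_prob (@ltr01 R) `]-oo, p]%classic = p%:E.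
Proof.
move=> /andP[p0 p1].
have mB : measurable (`]-oo, p]%classic : set R) by exact: measurable_itv.
transitivity (\int[uniform_prob (@ltr01 R)]_x (\1_(`]-oo, p]%classic) x)%:E)%E.
  by rewrite integral_indic ?setIT.
rewrite integral_uniform//; last by apply/measurable_EFinP; exact: measurable_indic.
rewrite subr0 invr1 mul1e integral_indic//.
rewrite (_ : `]-oo, p]%classic `&` `[0, 1]%classic = `[0, p]%classic); last first.
  apply/seteqP; split=> x /=; rewrite !in_itv/=.
    by move=> [-> /andP[->]].
  by move=> /andP[-> xp]; rewrite xp (le_trans xp).
apply: etrans (lebesgue_measure_itv `[0, p]) _ => /=.
rewrite lte_fin; case: ltP => [_|p0']; first by rewrite oppr0 adde0.
by have -> : p = 0 by apply/eqP; rewrite eq_le p0' p0.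
Qed.

End uniform.

(** * An almost supermartingale lemma *)

Section almost_supermartingale.
Local Open Scope ereal_scope.
Context {R : realType} {d : measure_display} {Omega : measurableType d}.
Variables (P : probability Omega R) (F : nat -> set (set Omega)).
Hypothesis F_measurable : forall i A, F i A -> measurable A.
Hypothesis F_T : forall i, F i setT.
Hypothesis F_I : forall i A B, F i A -> F i B -> F i (A `&` B).
Hypothesis F_S : forall i A, F i A -> F i.+1 A.
Variables (V W : nat -> Omega -> R) (k0 : nat) (dr b e : nat -> R).
Hypothesis mV : forall i, measurable_fun setT (V i).
Hypothesis mW : forall i, measurable_fun setT (W i).
Hypothesis W_ge0 : forall i w, (k0 <= i)%N -> (0 <= W i w)%R.
Hypothesis W_le : forall i w, (k0 <= i)%N -> (W i w <= V i w)%R.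
Hypothesis F_W : forall i x, F i [set w | (W i w < x)%R].
Hypothesis dr_ge0 : forall i, (0 <= dr i)%R.
Hypothesis b_ge0 : forall i, (0 <= b i)%R.
Hypothesis drift : forall i A, (k0 <= i)%N -> F i A ->
  \int[P]_(w in A) (V i.+1 w)%:E + (dr i)%:E * \int[P]_(w in A) (W i w)%:E <=
  \int[P]_(w in A) (V i w)%:E + (b i)%:E.
Hypothesis V_fin : \int[P]_w (V k0 w)%:E < +oo.
Hypothesis V_W : forall i, (k0 <= i)%N ->
  \int[P]_w (V i w)%:E <= \int[P]_w (W i w)%:E + (e i)%:E.
Hypothesis dr_dvg : forall k M, exists n, (M <= \sum_(k <= i < n) dr i)%R.
Hypothesis b_cvg : forall eps : R, (0 < eps)%R -> exists k1, forall k n,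
  (k1 <= k)%N -> (\sum_(k <= i < n) b i <= eps)%R.
Hypothesis e_cvg : forall eps : R, (0 < eps)%R -> exists k1, forall k,
  (k1 <= k)%N -> (e k <= eps)%R.

Let V_ge0 i w : (k0 <= i)%N -> (0 <= V i w)%R.
Proof. by move=> ki; apply: le_trans (W_le w ki); exact: W_ge0. Qed.

Let mVE i A : measurable_fun A (fun w => (V i w)%:E).
Proof. by apply/measurable_EFinP; exact: measurable_funTS. Qed.

Let mWE i A : measurable_fun A (fun w => (W i w)%:E).
Proof. by apply/measurable_EFinP; exact: measurable_funTS. Qed.

Let mean_step i : (k0 <= i)%N -> \int[P]_w (V i.+1 w)%:E + (dr i)%:E * \int[P]_w (W i w)%:E <=
  \int[P]_w (V i w)%:E + (b i)%:E.
Proof. by move=> ki; exact: drift. Qed.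

Let EV_ge0 i : (k0 <= i)%N -> 0 <= \int[P]_w (V i w)%:E.
Proof. by move=> ki; apply: integral_ge0 => w _; rewrite lee_fin V_ge0. Qed.

Let EW_ge0 i : (k0 <= i)%N -> 0 <= \int[P]_w (W i w)%:E.
Proof. by move=> ki; apply: integral_ge0 => w _; rewrite lee_fin W_ge0. Qed.

Let EV_fin i : (k0 <= i)%N -> \int[P]_w (V i w)%:E \is a fin_num.
Proof.
move=> ki; rewrite ge0_fin_numE ?EV_ge0//.
elim: i ki => [|i IH]; first by rewrite leqn0 => /eqP h; rewrite -h.
rewrite leq_eqVlt => /predU1P[<-//|ki].
rewrite ltnS in ki.
apply: (@le_lt_trans _ _ (\int[P]_w (V i w)%:E + (b i)%:E)); last first.
  by rewrite lte_add_pinfty ?ltry// IH.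
apply: le_trans (mean_step ki); rewrite leeDl// mule_ge0 ?EW_ge0// lee_fin.
exact: dr_ge0.
Qed.

Let EW_le i : (k0 <= i)%N -> \int[P]_w (W i w)%:E <= \int[P]_w (V i w)%:E.
Proof.
move=> ki; apply: ge0_le_integral => //.
- by move=> w _; rewrite lee_fin W_ge0.
- by move=> w _; rewrite lee_fin W_le.
Qed.

Let EW_fin i : (k0 <= i)%N -> \int[P]_w (W i w)%:E \is a fin_num.
Proof.
move=> ki; rewrite ge0_fin_numE ?EW_ge0//.
by apply: le_lt_trans (EW_le ki) _; rewrite -ge0_fin_numE ?EV_fin ?EV_ge0.
Qed.

Let v i : R := fine (\int[P]_w (V i w)%:E).
Let u i : R := fine (\int[P]_w (W i w)%:E).

Let v_step i : (k0 <= i)%N -> (v i.+1 + dr i * u i <= v i + b i)%R.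
Proof.
move=> ki; have ki1 : (k0 <= i.+1)%N by exact: leqW.
rewrite -lee_fin !EFinD EFinM !fineK ?EV_fin ?EW_fin//.
exact: mean_step.
Qed.

Let v_sum k n : (k0 <= k)%N -> (k <= n)%N ->
  (v n + \sum_(k <= i < n) dr i * u i <= v k + \sum_(k <= i < n) b i)%R.
Proof.
move=> kk; elim: n => [|n IH].
  by rewrite leqn0 => /eqP ->; rewrite !big_geq// !addr0.
rewrite leq_eqVlt => /predU1P[<-|kn]; first by rewrite !big_geq// !addr0.
rewrite ltnS in kn; rewrite !big_nat_recr//=.
have := v_step (leq_trans kk kn); have := IH kn.
move: (\sum_(_ <= _ < _) _)%R (\sum_(_ <= _ < _) _)%R (dr n * u n)%R => ? ? ? h1 h2.
lra.
Qed.

(** Otherwise the decrements dr_i E W_i would have an infinite sum. *)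
Lemma mean_small eps k : (0 < eps)%R -> (k0 <= k)%N ->
  exists2 i, (k <= i)%N & (u i < eps)%R.
Proof.
move=> eps0 kk; apply/not_exists2P => h.
have hu i : (k <= i)%N -> (eps <= u i)%R.
  by move=> ki; rewrite leNgt; apply/negP => ui; case: (h i).
have [k1 hb] := b_cvg (@ltr01 R).
pose k2 := maxn k k1.
have kk2 : (k0 <= k2)%N by rewrite (leq_trans kk)// leq_maxl.
have [n hn] := dr_dvg k2 ((v k2 + 1 + 1) / eps)%R.
have [kn|nk] := leqP k2 n; last first.
  move: hn; rewrite big_geq ?(ltnW nk)// ler_pdivrMr// mul0r.
  have : (0 <= v k2)%R by rewrite fine_ge0// EV_ge0.
  by move: (v k2) => ? ? ?; lra.
have := v_sum kk2 kn; have := hb k2 n (leq_maxr _ _).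
have vn : (0 <= v n)%R by rewrite fine_ge0// EV_ge0// (leq_trans kk2).
have : (v k2 + 1 + 1 <= \sum_(k2 <= i < n) dr i * u i)%R.
  move: hn; rewrite ler_pdivrMr// => /le_trans; apply.
  rewrite mulr_suml !big_seq; apply: ler_sum => i.
  rewrite mem_index_iota => /andP[ki _].
  by rewrite ler_wpM2l// hu// (leq_trans _ ki)// leq_maxl.
move: vn; move: (\sum_(_ <= _ < _) _)%R (\sum_(_ <= _ < _) _)%R => ? ? ? ? ? ?; lra.
Qed.

Section maximal.
Variables (delta : R) (k : nat).
Hypothesis delta0 : (0 < delta)%R.
Hypothesis kk : (k0 <= k)%N.

Definition below n : set Omega := [set w | forall i, (k <= i <= n)%N -> (W i w < delta)%R].

Lemma belowS n : (k <= n)%N ->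
  below n.+1 = below n `&` [set w | (W n.+1 w < delta)%R].
Proof.
move=> kn; apply/seteqP; split=> w.
  move=> h; split; last by apply: h; rewrite leqnn andbT leqW.
  by move=> i /andP[ki ni]; apply: h; rewrite ki leqW.
move=> [h hn] i /andP[ki]; rewrite leq_eqVlt => /predU1P[->//|ni].
by apply: h; rewrite ki.
Qed.

Lemma below_k : below k = [set w | (W k w < delta)%R].
Proof.
apply/seteqP; split=> w; first by apply; rewrite leqnn.
by move=> h i /andP[ki ik]; have -> : i = k by apply/eqP; rewrite eqn_leq ik.
Qed.

Lemma F_below n : (k <= n)%N -> F n (below n).
Proof.
elim: n => [|n IH]; first by rewrite leqn0 => /eqP h; rewrite -h below_k.
rewrite leq_eqVlt => /predU1P[<-|kn]; first by rewrite below_k.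
by rewrite belowS//; apply: F_I => //; apply: F_S; exact: IH.
Qed.

Let split_V n (A : set Omega) : (k0 <= n)%N -> measurable A ->
  \int[P]_(w in A `&` [set w | (W n w < delta)%R]) (V n w)%:E +
    delta%:E * P (A `\` [set w | (W n w < delta)%R]) <=
  \int[P]_(w in A) (V n w)%:E.
Proof.
move=> kn mA; set B := [set w | _].
have mB : measurable B by exact: (F_measurable (F_W n delta)).
have mAB : measurable (A `&` B) by exact: measurableI.
have mADB : measurable (A `\` B) by exact: measurableD.
rewrite -[in leRHS](setUIDK A B) ge0_integral_setU; [|by []|by []|exact: mVE| |]; last 2 first.
- by move=> w _; rewrite lee_fin V_ge0.
- by apply/disj_setPS => w [[_ h1] [_ h2]]; exact: h2.
apply: leeD => //; rewrite -integral_cst//.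
apply: ge0_le_integral => //.
- by move=> w _; rewrite lee_fin ltW.
- move=> w [_ /negP]; rewrite -leNgt => h; rewrite lee_fin.
  exact: le_trans h (W_le w kn).
Qed.

(** The drift is used on the paths that have stayed below delta so far; those
    that exceed it at time n have V >= delta there and are dropped from the integral. *)
Lemma maximal_inequality n : (k <= n)%N ->
  \int[P]_(w in below n) (V n w)%:E + delta%:E * P (~` below n) <=
  \int[P]_w (V k w)%:E + (\sum_(k <= i < n) b i)%:E.
Proof.
have base : \int[P]_(w in below k) (V k w)%:E + delta%:E * P (~` below k) <=
  \int[P]_w (V k w)%:E + (\sum_(k <= i < k) b i)%:E.
  rewrite big_geq// adde0 below_k; have := split_V kk measurableT.
  by rewrite setTI setTD.
elim: n => [|n IH]; first by rewrite leqn0 => /eqP h; move: base; rewrite h.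
rewrite leq_eqVlt => /predU1P[<-//|kn]; rewrite ltnS in kn.
have kn0 := leq_trans kk kn.
have mb := F_measurable (F_below kn).
have mb1 := F_measurable (F_below (leqW kn)).
have h1 := split_V (leqW kn0) mb; rewrite -belowS// in h1.
have PD : P (~` below n.+1) = P (~` below n) + P (below n `\` [set w | (W n.+1 w < delta)%R]).
  have mD : measurable (below n `\` [set w | (W n.+1 w < delta)%R]).
    by apply: measurableD => //; exact: (F_measurable (F_W n.+1 delta)).
  rewrite -measureU//; last 2 first.
  - exact: measurableC.
  - by apply/seteqP; split=> w // [h [h' _]]; exact: h.
  congr (P _); rewrite belowS// setCI; apply/seteqP; split=> w.
    move=> [?|?]; first by left.
    by have [?|?] := pselect (below n w); [right|left].
  by move=> [?|[_ ?]]; [left|right].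
rewrite PD ge0_muleDr ?measure_ge0// (addeC (delta%:E * P (~` below n))) addeA.
apply: le_trans (leeD2r _ h1) _.
have h2 := drift kn0 (F_below kn).
apply: (@le_trans _ _ (\int[P]_(w in below n) (V n w)%:E + (b n)%:E + delta%:E * P (~` below n))).
  apply: leeD => //; apply: le_trans h2; rewrite leeDl// mule_ge0 ?lee_fin//.
  by apply: integral_ge0 => w _; rewrite lee_fin W_ge0.
rewrite addeAC big_nat_recr//= EFinD addeA; apply: leeD => //; exact: IH.
Qed.

End maximal.

(** Started at a time when E V is small, which exists by [mean_small] and V_W,
    the maximal inequality bounds the probability of ever exceeding delta. *)
Theorem almost_supermartingale_cvg0 (delta : R) : (0 < delta)%R ->
  P (\bigcup_k \bigcap_(i in [set i | (k <= i)%N]) [set w | (W i w < delta)%R]) = 1.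
Proof.
move=> delta0; set E := \bigcup_k _.
have mWd i : measurable [set w | (W i w < delta)%R] by exact: (F_measurable (F_W i delta)).
have mEk k : measurable (\bigcap_(i in [set i | (k <= i)%N]) [set w | (W i w < delta)%R]).
  by apply: bigcap_measurable => [|i _]; [exists k => /=|exact: mWd].
have mE : measurable E by apply: bigcup_measurable => k _; exact: mEk.
suff h (eps : R) : (0 < eps)%R -> P (~` E) <= eps%:E.
  have PC0 : P (~` E) = 0.
    apply/eqP; rewrite eq_le measure_ge0 andbT.
    by apply/lee_addgt0Pr => eps /h; rewrite add0e.
  have := probability_setC P mE; rewrite PC0 => h0.
  have : P E \is a fin_num by rewrite fin_num_measure.
  move: h0; case: (P E) => // r h0 _; congr EFin.
  by move: h0; rewrite -EFinB => -[] h0; lra.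
move=> eps0.
have de0 : (0 < delta * eps / 3)%R by rewrite !mulr_gt0.
have [k1 hk1] := b_cvg de0.
have [k2 hk2] := e_cvg de0.
pose k3 := maxn k0 (maxn k1 k2).
have k03 : (k0 <= k3)%N by rewrite leq_maxl.
have k13 : (k1 <= k3)%N by rewrite /k3 !leq_max leqnn orbT.
have k23 : (k2 <= k3)%N by rewrite /k3 !leq_max leqnn !orbT.
have [k k3k uk] := mean_small de0 k03.
have kk0 := leq_trans k03 k3k.
have vk : (v k <= 2 * (delta * eps / 3))%R.
  have ek := hk2 k (leq_trans k23 k3k).
  have : (v k <= u k + e k)%R.
    by rewrite -lee_fin EFinD !fineK ?EV_fin ?EW_fin//; exact: V_W.
  by move: ek uk; move: (delta * eps)%R => *; lra.
have hn n : (k <= n)%N -> P (~` below delta k n) <= eps%:E.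
  move=> kn; have := maximal_inequality delta0 kk0 kn.
  rewrite -[X in _ <= X + _]fineK ?EV_fin// -/(v k) -EFinD => h.
  have bk := hk1 k n (leq_trans k13 k3k).
  have : delta%:E * P (~` below delta k n) <= (delta * eps)%:E.
    apply: le_trans (le_trans _ h) _.
      by rewrite leeDr//; apply: integral_ge0 => w _; rewrite lee_fin V_ge0// (leq_trans kk0).
    by rewrite lee_fin; move: bk vk; move: (delta * eps)%R => *; lra.
  by rewrite EFinM lee_pmul2l.
have mbelow n : (k <= n)%N -> measurable (below delta k n).
  by move=> kn; exact: (F_measurable (F_below delta kn)).
pose G n := ~` below delta k (k + n)%N.
have mG n : measurable (G n) by apply: measurableC; apply: mbelow; rewrite leq_addr.
have ndG : nondecreasing_seq G.
  move=> n1 n2 n12; apply/subsetPset => w; apply: contra_not => h i /andP[ki ik].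
  by apply: h; rewrite ki (leq_trans ik)// leq_add2l.
have mUG : measurable (\bigcup_n G n) by apply: bigcup_measurable => n _; exact: mG.
apply: (@le_trans _ _ (P (\bigcup_n G n))).
  apply: le_measure; rewrite ?inE//; first exact: measurableC.
  move=> w; apply: contraPP => h [] //=; exists k => // i /= ki.
  apply: contra_notP h => h; exists (i - k)%N => // hb.
  by apply: h; apply: hb; rewrite ki subnKC//=.
have hcvg : P \o G @ \oo --> P (\bigcup_n G n).
  exact: nondecreasing_cvg_mu.
rewrite -(cvg_lim _ hcvg)//; apply: lime_le.
  by apply: ereal_nondecreasing_is_cvgn => n1 n2 n12; apply: le_measure; rewrite ?inE//; exact/subsetPset/ndG.
by apply: nearW => n; apply: hn; rewrite leq_addr.
Qed.

End almost_supermartingale.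

(** * Sums and rates *)

Section rates.
Context {R : realType}.
Implicit Types (c t : R).

(** Comparison with the increments of ln. *)
Lemma harmonic_dvg c (k : nat) (M : R) : 0 < c ->
  exists n, M <= \sum_(k <= i < n) (c / i.+1%:R).
Proof.
move=> c0.
have step i : c * ln (i.+2%:R : R) - c * ln (i.+1%:R : R) <= c / i.+1%:R.
  rewrite -mulrBr ler_pM2l// -ln_div ?posrE//.
  have -> : (i.+2%:R / i.+1%:R : R) = 1 + i.+1%:R^-1.
    by rewrite -[i.+2]addn1 natrD mulrDl mulfV// mul1r.
  apply: le_ln1Dx; have : 0 < (i.+1%:R : R)^-1 by rewrite invr_gt0.
  by move: _^-1 => ? ?; lra.
have tel n : (k <= n)%N ->
    c * ln (n.+1%:R : R) - c * ln (k.+1%:R : R) <= \sum_(k <= i < n) (c / i.+1%:R).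
  elim: n => [|n IH]; first by rewrite leqn0 => /eqP ->; rewrite subrr big_geq.
  rewrite leq_eqVlt => /predU1P[<-|kn]; first by rewrite subrr big_geq.
  rewrite ltnS in kn; rewrite big_nat_recr//=.
  have := IH kn; have := step n; move: (\sum_(_ <= _ < _) _) (c / n.+1%:R) => ? ? ? ?.
  lra.
set x := M / c + ln (k.+1%:R : R).
exists (k + Num.bound (expR x))%N; apply: le_trans (tel _ (leq_addr _ _)).
rewrite -mulrBr -ler_pdivrMl// mulrC lerBrDr -/x -[leLHS]expRK ler_ln ?posrE ?expR_gt0//.
apply: le_trans (ltW (archi_boundP (expR_ge0 x))) _.
by rewrite ler_nat leqW// leq_addl.
Qed.

Lemma powR_neg_small (B t : R) : 0 < t -> 0 <= B -> forall eps : R, 0 < eps ->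
  exists k1, forall k, (k1 <= k)%N -> B * k.+1%:R `^ (- t) <= eps.
Proof.
move=> t0 B0 eps eps0.
exists (Num.bound ((B / eps) `^ t^-1)) => k kk.
rewrite powRN ler_pdivrMr ?powR_gt0// -ler_pdivrMl// mulrC.
have -> : B / eps = ((B / eps) `^ t^-1) `^ t.
  by rewrite -powRrM mulVf ?gt_eqF// powRr1// divr_ge0// ltW.
apply: ge0_ler_powR; rewrite ?nnegrE ?powR_ge0 ?(ltW t0)//.
apply: le_trans (ltW (archi_boundP (powR_ge0 _ _))) _.
by rewrite ler_nat leqW.
Qed.

(** With x = i + 1 this is (1 - 1 / x)^(- t) >= 1 + t / x, by exp u >= 1 + u and
    ln (1 - u) <= - u. *)
Lemma riemann_step t (i : nat) : 0 < t -> (0 < i)%N ->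
  t * i.+1%:R `^ (- (1 + t)) <= i%:R `^ (- t) - i.+1%:R `^ (- t).
Proof.
move=> t0 i0; set x : R := i.+1%:R.
have x0 : 0 < x by rewrite ltr0n.
have i0' : 0 < (i%:R : R) by rewrite ltr0n.
have E : i%:R = x * (1 - x^-1).
  by rewrite mulrBr mulr1 mulfV ?gt_eqF// /x -natr1 addrK.
have -> : x `^ (- (1 + t)) = x^-1 * x `^ (- t).
  by rewrite opprD powRD ?powR_inv1 ?ltW// (gt_eqF x0) implybT.
have -> : (i%:R : R) `^ (- t) = x `^ (- t) * expR (- t * ln (1 - x^-1)).
  have -> : expR (- t * ln (1 - x^-1)) = (1 - x^-1) `^ (- t).
    rewrite /powR ifF//; apply/eqP => h.
    by have := i0'; rewrite E h mulr0 ltxx.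
  rewrite -powRM ?(ltW x0)//; last by rewrite subr_ge0 invf_le1// /x ler1n.
  by rewrite E.
rewrite -[X in _ - X]mulr1 -mulrBr mulrCA mulrA [leRHS]mulrC ler_wpM2r ?powR_ge0//.
have h1 : ln (1 - x^-1) <= - x^-1.
  by apply: le_ln1Dx; rewrite ltrNl opprK invf_lt1// /x ltr1n.
have h2 := expR_ge1Dx (- t * ln (1 - x^-1)).
have : t * x^-1 <= - t * ln (1 - x^-1).
  by rewrite mulNr -mulrN ler_pM2l// lerNr.
rewrite mulrC [X in _ -> X <= _]mulrC => h3; rewrite lerBrDl mulrC.
by apply: le_trans h2; rewrite lerD2l.
Qed.

Lemma riemann_tail t (B : R) : 0 < t -> 0 <= B -> forall eps : R, 0 < eps ->
  exists k1, forall k n, (k1 <= k)%N ->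
    \sum_(k <= i < n) (B * i.+1%:R `^ (- (1 + t))) <= eps.
Proof.
move=> t0 B0 eps eps0.
have [k1 hk1] := @powR_neg_small (B / t) t t0 (divr_ge0 B0 (ltW t0)) eps eps0.
exists k1.+1 => -[//|k] n; rewrite ltnS => kk.
apply: le_trans (hk1 _ kk).
have [kn|/ltnW nk] := leqP k.+1 n; last first.
  by rewrite big_geq// mulr_ge0 ?powR_ge0// divr_ge0// ltW.
have : \sum_(k.+1 <= i < n) (B * i.+1%:R `^ (- (1 + t))) <=
    B / t * (k.+1%:R `^ (- t) - n%:R `^ (- t)).
  elim: n kn => [//|n IH]; rewrite leq_eqVlt => /predU1P[<-|kn].
    by rewrite subrr mulr0 big_geq.
  rewrite ltnS in kn; rewrite big_nat_recr//=.
  have n0 : (0 < n)%N by exact: leq_trans kn.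
  have := ler_wpM2l (divr_ge0 B0 (ltW t0)) (riemann_step t0 n0).
  rewrite mulrA divfK ?gt_eqF// => h.
  by have := lerD (IH kn) h; rewrite -mulrDr addrA subrK.
move/le_trans; apply; rewrite ler_wpM2l// ?divr_ge0 ?(ltW t0)//.
by rewrite gerBl powR_ge0.
Qed.

Section projection_bounds.
Variables (lo hi : R^nat).
Hypothesis lo_noninc : nonincreasing_seq lo.
Hypothesis lo_rate : limn_einf (fun i => (lo i * ln (i%:R : R))%:E) = +oo%E.
Hypothesis hi_rate : forall eps : R, 0 < eps ->
  limn_esup (fun i => (hi i / i%:R `^ eps)%:E) = 0%E.

Lemma lo_ln_ge (M : R) : exists k, forall i, (k <= i)%N -> M <= lo i * ln (i%:R : R).
Proof.
set u := (fun i => (lo i * ln (i%:R : R))%:E).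
have : einfs u @ \oo --> +oo%E.
  by rewrite -lo_rate limn_einf_lim; exact: is_cvg_einfs.
move/cvgey_ge => /(_ M) [k _ hk]; exists k => i ki.
have := hk i ki; rewrite /= => /le_trans h; rewrite -lee_fin; apply: h.
by apply: ereal_inf_lbound; exists i => //=.
Qed.

Lemma lo_gt0 i : 0 < lo i.
Proof.
have [k hk] := lo_ln_ge 1.
have h := hk (maxn i k.+2) (leq_trans (leqW (leqnSn k)) (leq_maxr _ _)).
apply: lt_le_trans (lo_noninc (leq_maxl i k.+2)).
have : 0 < lo (maxn i k.+2) * ln ((maxn i k.+2)%:R : R) by apply: lt_le_trans h.
rewrite pmulr_lgt0//; apply: ln_gt0; rewrite ltr1n.
by apply: leq_trans (leq_maxr _ _).
Qed.

Lemma hi_le (e : R) : 0 < e -> exists k, forall i, (k <= i)%N -> hi i <= i%:R `^ e.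
Proof.
move=> e0; set u := (fun i => (hi i / i%:R `^ e)%:E).
have : esups u @ \oo --> 0%E.
  by rewrite -(hi_rate e0) limn_esup_lim; exact: is_cvg_esups.
have h1 : nbhs (0%E : \bar R) [set x | (x < 1)%E].
  by apply: open_nbhs_nbhs; split; [exact: open_ereal_lt_ereal|rewrite /= lte_fin].
move=> /(_ _ h1) [k _ hk]; exists k.+1 => i ki.
have := hk i (ltnW ki); rewrite /= => h.
have : (u i <= 1)%E.
  by apply: le_trans (ltW h); apply: ereal_sup_ubound; exists i => //=.
have i0 : 0 < (i%:R : R) `^ e by rewrite powR_gt0// ltr0n (leq_trans _ ki).
by rewrite lee_fin ler_pdivrMr// mul1r.
Qed.

(** Follows from lo_i ln i >= q / e. With [hi_le], all the constants attached to
    the projection sets are smaller than any power of i. *)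
Lemma expR_lo_le (q e : R) : 0 < e -> 0 <= q ->
  exists k, forall i, (k <= i)%N -> expR (q / lo i) <= i%:R `^ e.
Proof.
move=> e0 q0; have [k hk] := lo_ln_ge (q / e); exists k.+1 => i ki.
rewrite /powR ifF ?ler_expR; last by rewrite pnatr_eq0 gtn_eqF// (leq_trans _ ki).
have := hk i (ltnW ki); rewrite !ler_pdivrMr ?lo_gt0// => /le_trans; apply.
by rewrite [leRHS]mulrAC (mulrC e) mulrAC.
Qed.

(** Here lo_i >= 1 / (e ln i), and e ln i = ln (i^e) <= i^e. *)
Lemma lo_ge (e : R) : 0 < e ->
  exists k, forall i, (k <= i)%N -> i%:R `^ (- e) <= lo i.
Proof.
move=> e0; have [k hk] := lo_ln_ge e^-1; exists k.+2 => i ki.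
have i0 : 0 < (i%:R : R) by rewrite ltr0n (leq_trans _ ki).
have := hk i (ltnW (ltnW ki)); rewrite -ler_pdivrMr; last first.
  by apply: ln_gt0; rewrite ltr1n (leq_trans _ ki).
apply: le_trans; rewrite powRN -invfM lef_pV2 ?posrE ?powR_gt0//; last first.
  by rewrite mulr_gt0// ln_gt0// ltr1n (leq_trans _ ki).
rewrite -ln_powR; have := @le_ln1Dx R (i%:R `^ e - 1).
rewrite [1 + _]addrC subrK => h; apply: le_trans (h _) _; last by rewrite gerBl.
by rewrite ltrBrDr addrC subrr powR_gt0.
Qed.

End projection_bounds.
End rates.

(** * Squared distance to an interval *)

Section distance.
Context {R : realType}.
Variables a b : R.
Implicit Types t u : R.

Definition excess t : R := Num.max (t - b) 0.
Definition deficit t : R := Num.max (a - t) 0.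
Definition dist2 t : R := excess t ^+ 2 + deficit t ^+ 2.

Lemma excess_ge0 t : 0 <= excess t. Proof. by rewrite le_max lexx orbT. Qed.
Lemma deficit_ge0 t : 0 <= deficit t. Proof. by rewrite le_max lexx orbT. Qed.
Lemma dist2_ge0 t : 0 <= dist2 t. Proof. by rewrite addr_ge0// sqr_ge0. Qed.

Lemma deficit_le t : 0 <= a -> 0 <= t -> deficit t <= a.
Proof. by move=> a0 t0; rewrite /deficit; case: (leP (a - t) 0) => ?; lra. Qed.

Lemma measurable_excess : measurable_fun setT excess.
Proof. by apply: measurable_maxr => //; apply: measurable_funB. Qed.

Lemma measurable_deficit : measurable_fun setT deficit.
Proof. by apply: measurable_maxr => //; apply: measurable_funB. Qed.

Lemma measurable_dist2 : measurable_fun setT dist2.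
Proof.
apply: measurable_funD; apply: measurable_funX; [exact: measurable_excess|exact: measurable_deficit].
Qed.

Lemma measurable_dist2_lt (c : R) : measurable [set t | dist2 t < c].
Proof.
rewrite (_ : [set t | _] = dist2 @^-1` `]-oo, c[%classic); last first.
  by apply/seteqP; split => t /=; rewrite in_itv.
by rewrite -[X in measurable X]setTI; apply: measurable_dist2.
Qed.

(** The distance of t + u to the interval is at most its distance to the
    projection of t, and excess t - deficit t is t minus that projection. *)
Lemma dist2_step t u : a <= b ->
  dist2 (t + u) <= dist2 t + 2 * (excess t - deficit t) * u + u ^+ 2.
Proof.
rewrite /dist2 /excess /deficit => ab.
by case: (leP (t - b) 0) => ?; case: (leP (a - t) 0) => ?;
  case: (leP (t + u - b) 0) => ?; case: (leP (a - (t + u)) 0) => ?; nra.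
Qed.

Lemma dist2_clamp l h t : l <= a -> a <= b -> b <= h ->
  dist2 (Num.min (Num.max l t) h) <= dist2 t.
Proof.
rewrite /dist2 /excess /deficit => la ab bh.
case: (leP l t) => lt; [case: (leP t h) => th //|case: (leP l h) => th; last by lra].
- by case: (leP (h - b) 0) => ?; case: (leP (a - h) 0) => ?;
  case: (leP (t - b) 0) => ?; case: (leP (a - t) 0) => ?; nra.
- by case: (leP (l - b) 0) => ?; case: (leP (a - l) 0) => ?;
  case: (leP (t - b) 0) => ?; case: (leP (a - t) 0) => ?; nra.
Qed.

Lemma dist2_lt t (c : R) : 0 <= c -> dist2 t < c ^+ 2 -> a - c <= t <= b + c.
Proof.
rewrite /dist2 /excess /deficit => c0.
by case: (leP (t - b) 0) => ?; case: (leP (a - t) 0) => ? ?; apply/andP; split; nra.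
Qed.

Lemma dist2_le_hi t (h : R) : 0 <= a -> 0 <= b -> 0 <= t <= h -> a <= h ->
  dist2 t <= 2 * h ^+ 2.
Proof.
rewrite /dist2 /excess /deficit => a0 b0 /andP[t0 th] ah.
by case: (leP (t - b) 0) => ?; case: (leP (a - t) 0) => ?; nra.
Qed.

(** Below a, (l / a) deficit^2 <= l deficit <= t deficit, since deficit <= a; above
    b, l / a <= 1. *)
Lemma dist2_le_loss t (l : R) : 0 < a -> a <= b -> 0 < l <= a -> l <= t ->
  l / a * dist2 t <= 2 * excess t ^+ 2 + 2 * deficit t * t.
Proof.
rewrite /dist2 => a0 ab /andP[l0 la] lt.
have x0 := excess_ge0 t; have d0 := deficit_ge0 t.
have da : deficit t <= a by rewrite /deficit; case: (leP (a - t) 0) => ?; lra.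
rewrite mulrDr; apply: lerD.
  have : l / a <= 1 by rewrite ler_pdivrMr// mul1r.
  have : 0 <= l / a by rewrite divr_ge0// ltW.
  have := sqr_ge0 (excess t); move: (l / a) (excess t ^+ 2) => u v ? ? ?; nra.
rewrite mulrAC ler_pdivrMr//; move: d0 da; move: (deficit t) => v ? ?.
have : l * v ^+ 2 <= l * (v * a) by rewrite ler_pM2l// expr2; nra.
move/le_trans; apply; rewrite mulrA ler_pM2r//.
by nra.
Qed.

End distance.

(** * The corrected drift *)

Section corrected_drift.
Context {R : realType}.
Variables (m N : nat) (y : m.+1.-tuple nat) (rho sigma : R).
Hypothesis sigma0 : sigma != 0.
Hypothesis rho1 : -1 < rho < 1.
Variables (a b g k : R).
Hypothesis g0 : 0 <= g.
Hypothesis b1 : 1 <= b.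
Implicit Types (t : R) (z : pf_state R m N).

Local Notation K := (corrector m N rho sigma).
Local Notation low t := (@low_event R m N t).

(** Multiplying the inequalities [large] and [small] by 2 excess and 2 deficit
    makes their gains match the linear term of [dist2_step]: per unit of step size,
    S raises [dist2] by at most [gain], and - theta lowers it by at least [pull]. *)
Definition correction t z : R :=
  2 * excess b t * (g * expz k z) + 2 * deficit a t * (K t * \1_(low t) z).
Definition gain t z : R :=
  2 * excess b t * maxstat z + 2 * deficit a t * (4 * t * \1_(low t) z).
Definition pull t : R := 2 * excess b t * t + 6 * deficit a t * t.
Definition loss t : R := 2 * excess b t ^+ 2 + 2 * deficit a t * t.

Hypothesis large : forall t z, 1 <= t ->
  (pimh_step y rho sigma t z (fun z' => (g * expz k z' + maxstat z')%:E) <=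
   (g * expz k z + b)%:E)%E.
Hypothesis small : forall t z, 0 < t <= a ->
  (pimh_step y rho sigma t z (fun z' => ((K t + 4 * t) * \1_(low t) z')%:E) <=
   (K t * \1_(low t) z + 2 * t)%:E)%E.

Let expz_ge0 c z : 0 <= expz c z. Proof. exact: expR_ge0. Qed.

Lemma correction_ge0 t z : 0 <= t -> 0 <= correction t z.
Proof.
move=> t0; have := excess_ge0 b t; have := deficit_ge0 a t => ? ?.
by rewrite addr_ge0// !mulr_ge0// ?corrector_ge0// indicE.
Qed.

Lemma gain_ge0 t z : 0 <= t -> 0 <= gain t z.
Proof.
move=> t0; have := excess_ge0 b t; have := deficit_ge0 a t => ? ?.
by rewrite addr_ge0// !mulr_ge0// ?maxstat_ge0// indicE.
Qed.

Lemma pull_ge0 t : 0 <= t -> 0 <= pull t.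
Proof.
move=> t0; have := excess_ge0 b t; have := deficit_ge0 a t => ? ?.
by rewrite addr_ge0// !mulr_ge0.
Qed.

Lemma loss_ge0 t : 0 <= t -> 0 <= loss t.
Proof.
move=> t0; have := excess_ge0 b t; have := deficit_ge0 a t => ? ?.
by rewrite addr_ge0// !mulr_ge0// sqr_ge0.
Qed.

Section measurability.
Context {d : measure_display} {S : measurableType d}.
Variables (t : S -> R) (z : S -> pf_state R m N).
Hypothesis mt : measurable_fun setT t.
Hypothesis mz : measurable_fun setT z.

Let mx : measurable_fun setT (fun s => 2 * excess b (t s)).
Proof. by apply: measurable_funM => //; exact: measurableT_comp (measurable_excess b) mt. Qed.

Let md : measurable_fun setT (fun s => 2 * deficit a (t s)).
Proof. by apply: measurable_funM => //; exact: measurableT_comp (measurable_deficit a) mt. Qed.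

Lemma measurable_low_indic : measurable_fun setT (fun s => \1_(low (t s)) (z s) : R).
Proof.
rewrite (_ : (fun s => _) = \1_[set s | low (t s) (z s)]).
  by apply: measurable_indic; exact: measurable_low_event.
by apply/funext => s; rewrite !indicE; congr ((nat_of_bool _)%:R); apply/asboolP/asboolP.
Qed.

Lemma measurable_correction : measurable_fun setT (fun s => correction (t s) (z s)).
Proof.
apply: measurable_funD; apply: measurable_funM => //; apply: measurable_funM => //.
- exact: measurable_expz.
- exact: measurableT_comp (measurable_corrector m N rho sigma) mt.
- exact: measurable_low_indic.
Qed.

Lemma measurable_maxstat : measurable_fun setT (fun s => maxstat (z s)).
Proof. by apply: measurable_funM => //; exact: measurable_expz. Qed.

Lemma measurable_gain : measurable_fun setT (fun s => gain (t s) (z s)).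
Proof.
apply: measurable_funD; apply: measurable_funM => //; first exact: measurable_maxstat.
by apply: measurable_funM; [exact: measurable_funM|exact: measurable_low_indic].
Qed.

Lemma measurable_pull : measurable_fun setT (fun s => pull (t s)).
Proof.
apply: measurable_funD; apply: measurable_funM => //.
by apply: measurable_funM => //; exact: measurableT_comp (measurable_deficit a) mt.
Qed.

Lemma measurable_loss : measurable_fun setT (fun s => loss (t s)).
Proof.
apply: measurable_funD; apply: measurable_funM => //.
by apply: measurable_funX; exact: measurableT_comp (measurable_excess b) mt.
Qed.

End measurability.

Lemma correction_drift t z : 0 < t ->
  (pimh_step y rho sigma t z (fun z' => (correction t z' + gain t z')%:E) +
   (loss t)%:E <= (correction t z + pull t)%:E)%E.
Proof.
move=> t0; have hE := expectation_pimh_step y sigma0 rho1 t z.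
have x0 := excess_ge0 b t; have d0 := deficit_ge0 a t.
have K0 : 0 <= K t := corrector_ge0 m N rho sigma (ltW t0).
set f1 := fun z' => (g * expz k z' + maxstat z')%:E.
set f2 := fun z' => ((K t + 4 * t) * \1_(low t) z')%:E.
have mid : measurable_fun setT (fun z : pf_state R m N => z) by exact: measurable_id.
have mct : measurable_fun setT (fun _ : pf_state R m N => t) by exact: measurable_cst.
have mf1 : measurable_fun setT f1.
  apply/measurable_EFinP/measurable_funD; last exact: measurable_maxstat.
  by apply: measurable_funM => //; exact: measurable_expz.
have f10 z' : (0 <= f1 z')%E by rewrite lee_fin addr_ge0 ?mulr_ge0// maxstat_ge0.
have mf2 : measurable_fun setT f2.
  by apply/measurable_EFinP/measurable_funM => //; exact: measurable_low_indic.
have f20 z' : (0 <= f2 z')%E.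
  by rewrite lee_fin !mulr_ge0// ?addr_ge0 ?mulr_ge0 ?indicE// ltW.
have -> : (fun z' => (correction t z' + gain t z')%:E) =
    ((fun z' => (2 * excess b t)%:E * f1 z') \+ (fun z' => (2 * deficit a t)%:E * f2 z'))%E.
  apply/funext => z'; rewrite /f1 /f2 /= -!EFinM -EFinD /correction /gain.
  by congr EFin; ring.
rewrite expect_add//; first last.
- by move=> z'; rewrite mule_ge0// lee_fin mulr_ge0.
- by apply: emeasurable_funM => //; exact: measurable_cst.
- by move=> z'; rewrite mule_ge0// lee_fin mulr_ge0.
- by apply: emeasurable_funM => //; exact: measurable_cst.
rewrite !expect_scale// ?mulr_ge0//.
have h1 : ((2 * excess b t)%:E * pimh_step y rho sigma t z f1 <=
    (2 * excess b t * (g * expz k z + b))%:E)%E.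
  have [bt|tb] := leP b t.
    by rewrite [leRHS]EFinM; apply: lee_wpmul2l; rewrite ?lee_fin ?mulr_ge0// large// (le_trans b1).
  have -> : excess b t = 0 by rewrite /excess; case: (leP (t - b) 0) => ?; lra.
  by rewrite mulr0 mul0e mul0r.
have h2 : ((2 * deficit a t)%:E * pimh_step y rho sigma t z f2 <=
    (2 * deficit a t * (K t * \1_(low t) z + 2 * t))%:E)%E.
  have [ta|at'] := leP t a.
    by rewrite [leRHS]EFinM; apply: lee_wpmul2l; rewrite ?lee_fin ?mulr_ge0// small// t0.
  have -> : deficit a t = 0 by rewrite /deficit; case: (leP (a - t) 0) => ?; lra.
  by rewrite mulr0 mul0e mul0r.
apply: le_trans (leeD2r _ (leeD h1 h2)) _.
rewrite -!EFinD lee_fin /correction /loss /pull.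
have hx : excess b t * b = excess b t * t - excess b t ^+ 2.
  by rewrite /excess; case: (leP (t - b) 0) => ?; ring.
rewrite [in leLHS]mulrDr -[2 * _ * b]mulrA hx.
by move: (excess b t) (deficit a t) (K t) (g * _) (\1_(_) _) => *; lra.
Qed.

End corrected_drift.

(** * One update of the parameter *)

Section lyapunov_step.
Context {R : realType}.
Variables (m N : nat) (y : m.+1.-tuple nat) (rho sigma : R).
Variables (a b g k q : R).
Hypothesis g0 : 0 <= g.
Hypothesis k0 : 0 <= k.
Hypothesis q0 : 0 <= q.
Hypothesis a0 : 0 < a.
Hypothesis ab : a <= b.
Implicit Types (t l h s : R) (z : pf_state R m N).

Local Notation K := (corrector m N rho sigma).
Local Notation correct := (correction rho sigma a b g k).

Hypothesis K_le : forall t, 0 < t <= a -> K t <= expR (q / t).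

Definition moment_order : R := k + 2.
Local Notation kap := moment_order.

(** Bounds the squared increment of [dist2_step] and the correction at the new
    parameter, both up to a factor expz moment_order. *)
Definition remainder l h : R :=
  (m.+1%:R + h) ^+ 2 + 2 * h * g + 2 * a * expR (q / l).

Lemma expz_mono (c c' : R) z : c <= c' -> expz c z <= expz c' z.
Proof. by move=> cc; rewrite ler_expR ler_wpM2r// psnorm_ge0. Qed.

Lemma expz_ge1 (c : R) z : 0 <= c -> 1 <= expz c z.
Proof. by move=> c0; rewrite -expR0 ler_expR mulr_ge0// psnorm_ge0. Qed.

Lemma correction_le l h t z : 0 < l -> l <= t <= h ->
  correct t z <= (2 * h * g + 2 * a * expR (q / l)) * expz kap z.
Proof.
move=> l0 /andP[lt th]; have t0 : 0 < t by exact: lt_le_trans lt.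
have b0 : 0 <= b by apply: le_trans ab; exact: ltW.
have xh : excess b t <= h by rewrite /excess; case: (leP (t - b) 0) => ?; lra.
have e1 := expz_mono z (_ : k <= kap); have e2 := @expz_ge1 kap z.
have {}e1 : expz k z <= expz kap z by apply: e1; rewrite lerDl.
have {}e2 : 1 <= expz kap z by apply: e2; rewrite addr_ge0.
have Ke : t <= a -> K t <= expR (q / l).
  move=> ta; apply: le_trans (K_le _) _; first by rewrite t0.
  by rewrite ler_expR ler_wpM2l// lef_pV2 ?posrE.
have K0 : 0 <= K t by apply: corrector_ge0; exact: ltW.
rewrite /correction; move: (K t) Ke K0 => Kt Ke K0.
rewrite [leRHS]mulrDl; apply: lerD.
  rewrite mulrA ler_pM ?expR_ge0 ?mulr_ge0 ?excess_ge0//.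
  by rewrite ler_wpM2r// ler_wpM2l.
rewrite -!mulrA ler_wpM2l//.
have [ta|at'] := leP t a; last first.
  have -> : deficit a t = 0 by rewrite /deficit; case: (leP (a - t) 0) => ?; lra.
  by rewrite mul0r !mulr_ge0 ?expR_ge0// ltW.
have da : deficit a t <= a by rewrite /deficit; case: (leP (a - t) 0) => ?; lra.
have I0 : 0 <= \1_(low_event t) z :> R by rewrite indicE.
have I1 : \1_(low_event t) z <= expz kap z.
  by apply: le_trans e2; rewrite indicE; case: (_ \in _).
apply: ler_pM => //; [exact: deficit_ge0|exact: mulr_ge0|].
by apply: ler_pM => //; exact: Ke.
Qed.

Lemma dist2_update_le l h t s z : 0 < t <= h -> 0 <= s -> l <= a -> b <= h ->
  dist2 a b (Num.min (Num.max l (t + s * H y t z)) h) + s * pull a b t <=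
  dist2 a b t + s * gain a b t z + s ^+ 2 * (m.+1%:R + h) ^+ 2 * expz kap z.
Proof.
move=> /andP[t0 th] s0 la bh.
have h1 := dist2_clamp (t + s * H y t z) la ab bh.
have h2 := dist2_step t (s * H y t z) ab.
have Hle := H_le y t z; have Hge0 := H_ge0 y t z; have Hge := H_ge y z (ltW t0).
have x0 := excess_ge0 b t; have d0 := deficit_ge0 a t.
have M0 := maxstat_ge0 z.
set I := \1_(low_event t) z in Hge *.
have hx : excess b t * H y t z <= excess b t * (maxstat z - t).
  by rewrite ler_wpM2l//; lra.
have hd : - (deficit a t * H y t z) <= deficit a t * (4 * t * I - 3 * t).
  rewrite -mulrN ler_wpM2l//; move: Hge; rewrite mulrBr mulr1.
  by move: (4 * t * _) => ? ?; lra.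
have hH : (s * H y t z) ^+ 2 <= s ^+ 2 * (m.+1%:R + h) ^+ 2 * expz kap z.
  rewrite exprMn -mulrA ler_wpM2l ?sqr_ge0//.
  have e1 : expz 2 z <= expz kap z by apply: expz_mono; rewrite lerDr.
  apply: (@le_trans _ _ ((m.+1%:R + h) ^+ 2 * expz 2 z)); last by rewrite ler_wpM2l ?sqr_ge0.
  have -> : expz 2 z = expz 1 z ^+ 2 by rewrite /expz -expRM_natl mul1r mulr_natl.
  rewrite -exprMn -real_normK ?num_real//.
  rewrite lerXn2r ?nnegrE ?normr_ge0//; first by rewrite mulr_ge0 ?expR_ge0// addr_ge0// ltW// (lt_le_trans t0).
  have e0 := expz_ge1 z (@ler01 R).
  have h0 : 0 < h by apply: lt_le_trans th.
  have : maxstat z + h <= (m.+1%:R + h) * expz 1 z.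
    by rewrite mulrDl lerD2l ler_peMr// ltW.
  by rewrite ler_norml => ?; apply/andP; split; lra.
apply: le_trans (lerD h1 (lexx _)) _; apply: le_trans (lerD h2 (lexx _)) _.
have E : 2 * (excess b t - deficit a t) * (s * H y t z) <=
    s * (2 * (excess b t * (maxstat z - t)) + 2 * (deficit a t * (4 * t * I - 3 * t))).
  rewrite mulrCA ler_wpM2l//; move: hx hd.
  by move: (excess b t) (deficit a t) (H y t z) => ? ? ? ? ?; lra.
move: E hH; rewrite /gain /pull -/I; move: (dist2 a b t) (_ ^+ 2 * _ * _) ((s * H y t z) ^+ 2) => D F G.
move: (excess b t) (deficit a t) (maxstat z) => x d M h3 h4.
by move: h3; rewrite mulrA; nra.
Qed.

(** The flag J tells whether the step is taken; if not, theta stays put, as the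
    projection sets grow. When it is taken the new correction depends on the new
    theta, and is only bounded, its weight c being already of the order of the mean
    step size. *)
Lemma lyapunov_step (J : bool) l h t t' s c c' z : 0 < l -> l <= t <= h -> 0 <= s ->
  l <= a -> b <= h -> 0 <= c' <= c ->
  t' = Num.min (Num.max l (t + (if J then s else 0) * H y t z)) h ->
  dist2 a b t' + c' * correct t' z + (if J then s else 0) * pull a b t <=
  dist2 a b t + c * correct t z + (if J then 1 else 0) *
    (s * gain a b t z + (s ^+ 2 + c) * remainder l h * expz kap z).
Proof.
move=> l0 /andP[lt th] s0 la bh /andP[c'0 cc] t'E.
have t0 : 0 < t by exact: lt_le_trans lt.
have lh : l <= h by exact: le_trans th.
have C0 x : 0 <= x -> 0 <= correct x z by move=> x0; exact: correction_ge0.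
have c0 : 0 <= c by exact: le_trans cc.
have h0 : 0 < h by exact: lt_le_trans th.
have e1 := expR_ge0 (kap * psnorm z.1); rewrite -/(expz kap z) in e1.
case: J t'E => t'E; last first.
  have -> : t' = t by rewrite t'E mul0r addr0 max_r// min_l.
  by rewrite !mul0r !addr0 lerD2l ler_wpM2r// C0// ltW.
have lt' : l <= t' by rewrite t'E le_min le_max lexx lh.
have th' : t' <= h by rewrite t'E ge_min lexx orbT.
have h1 := @dist2_update_le l h t s z _ s0 la bh.
have {}h1 := h1 (introT andP (conj t0 th)).
rewrite -t'E in h1.
have h2 := @correction_le l h t' z l0 (introT andP (conj lt' th')).
have h3 : c' * correct t' z <= c * ((2 * h * g + 2 * a * expR (q / l)) * expz kap z).
  by apply: ler_pM => //; apply: C0; exact: le_trans (ltW l0) lt'.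
rewrite mul1r addrAC; apply: le_trans (lerD h1 h3) _.
have : 0 <= c * correct t z by rewrite mulr_ge0// C0// ltW.
have : 0 <= s ^+ 2 * (2 * h * g + 2 * a * expR (q / l)) * expz kap z.
  by rewrite !mulr_ge0 ?sqr_ge0// addr_ge0// !mulr_ge0 ?expR_ge0// ltW.
have : 0 <= c * (m.+1%:R + h) ^+ 2 * expz kap z by rewrite mulr_ge0// mulr_ge0// sqr_ge0.
have -> : remainder l h = (m.+1%:R + h) ^+ 2 + (2 * h * g + 2 * a * expR (q / l)).
  by rewrite /remainder !addrA.
move: (expz kap z) ((_ + h) ^+ 2) (2 * h * g + _) (c * correct _ _) (s * gain _ _ _ _) => e A B C D.
by move: (dist2 a b t) (s ^+ 2) => W S; lra.
Qed.

End lyapunov_step.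

(** * Integrals over the probability space *)

Section integration.
Context {R : realType} {d : measure_display} {Omega : measurableType d}.
Variable P : probability Omega R.

Lemma measurable_mem_indic {d'} {T : measurableType d'} (A : set T) : measurable A ->
  measurable_fun setT (fun t => t \in A).
Proof.
move=> mA _ B mB; rewrite setTI.
have [/eqP->|/eqP->|/eqP->|/eqP->] := set_bool B.
- rewrite (_ : _ @^-1` _ = A)//; apply/seteqP; split=> t /=; first by move/set_mem.
  by move/mem_set.
- rewrite (_ : _ @^-1` _ = ~` A); first exact: measurableC.
  apply/seteqP; split=> t /=; first by move=> h /mem_set; rewrite h.
  by move=> h; apply/negbTE; rewrite notin_setE.
- by rewrite preimage_set0.
- by rewrite preimage_setT.
Qed.

Lemma integral_restrict (A : set Omega) (f : Omega -> \bar R) :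
  (\int[P]_(w in A) f w = \int[P]_w (if w \in A then f w else 0))%E.
Proof. by rewrite integral_mkcond; apply: eq_integral => w _; rewrite patchE. Qed.

Lemma integral_probability_cst (c : R) :
  (\int[P]__ c%:E = c%:E)%E.
Proof.
rewrite integral_cst//; transitivity (c%:E * 1)%E; last exact: mule1.
by congr (_ * _)%E; exact: probability_setT.
Qed.

(** Real-valued versions, whose measurability hypotheses are on the whole space
    so that they hold for all events A of a filtration. *)
Lemma integralD_real (A : set Omega) (f h : Omega -> R) : measurable A ->
  measurable_fun setT f -> measurable_fun setT h ->
  (forall w, 0 <= f w) -> (forall w, 0 <= h w) ->
  (\int[P]_(w in A) (f w + h w)%:E =
   \int[P]_(w in A) (f w)%:E + \int[P]_(w in A) (h w)%:E)%E.
Proof.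
move=> mA mf mh f0 h0; under eq_integral do rewrite EFinD.
rewrite ge0_integralD//; last 4 first.
- by move=> w _; rewrite lee_fin.
- by apply/measurable_EFinP; exact: measurable_funTS.
- by move=> w _; rewrite lee_fin.
- by apply/measurable_EFinP; exact: measurable_funTS.
Qed.

Lemma integralZ_real (A : set Omega) (f : Omega -> R) (c : R) : measurable A ->
  measurable_fun setT f -> (forall w, 0 <= f w) -> 0 <= c ->
  (\int[P]_(w in A) (c * f w)%:E = c%:E * \int[P]_(w in A) (f w)%:E)%E.
Proof.
move=> mA mf f0 c0; under eq_integral do rewrite EFinM.
rewrite ge0_integralZl//.
- by apply/measurable_EFinP; exact: measurable_funTS.
- by move=> w _; rewrite lee_fin.
Qed.

Lemma le_integral_real (A : set Omega) (f h : Omega -> R) : measurable A ->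
  measurable_fun setT f -> measurable_fun setT h ->
  (forall w, 0 <= f w) -> (forall w, f w <= h w) ->
  (\int[P]_(w in A) (f w)%:E <= \int[P]_(w in A) (h w)%:E)%E.
Proof.
move=> mA mf mh f0 fh; apply: ge0_le_integral => //.
- by move=> w _; rewrite lee_fin.
- by apply/measurable_EFinP; exact: measurable_funTS.
- by apply/measurable_EFinP; exact: measurable_funTS.
- by move=> w _; rewrite lee_fin.
Qed.

End integration.

Lemma ereal_cancel {R : realType} (v' cq w cc cg e cx cl kw : \bar R) :
  (cq \is a fin_num -> v' + cq <= w + cc + (cg + e) -> cc + cg + cl <= cx + cq ->
   kw <= cl -> v' + kw <= w + cx + e)%E.
Proof.
move=> hcq h1 h2 h3; rewrite -(leeD2rE _ _ hcq) addeAC.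
apply: le_trans (leeD h1 h3) _.
have -> : (w + cc + (cg + e) + cl = (w + e) + (cc + cg + cl))%E.
  rewrite -!addeA; congr (w + _)%E; rewrite [RHS]addeCA; congr (cc + _)%E.
  by rewrite addeCA.
by apply: le_trans (leeD2l _ h2) _; rewrite addeA (addeAC w).
Qed.

Lemma ereal_scale {R : realType} (c x1 x2 x3 x4 x5 : \bar R) :
  (0 <= c -> 0 <= x1 -> 0 <= x2 -> 0 <= x3 -> 0 <= x4 -> 0 <= x5 ->
   x1 + x2 + x3 <= x4 + x5 -> c * x1 + c * x2 + c * x3 <= c * x4 + c * x5)%E.
Proof.
move=> *; rewrite -!ge0_muleDr ?adde_ge0//; exact: lee_wpmul2l.
Qed.

Lemma le_add_pow {R : realType} (x u : R) (L : nat) : 0 < x -> 0 <= u ->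
  u <= x + u ^+ L.+1 / x ^+ L.
Proof.
move=> x1 u0; have [ux|xu] := leP u x.
  by rewrite -[leLHS]addr0 lerD// divr_ge0 ?exprn_ge0// ltW.
apply: (@le_trans _ _ (u ^+ L.+1 / x ^+ L)); last by rewrite lerDr ltW.
rewrite exprS -mulrA -expr_div_n ler_peMr// exprn_ege1// ler_pdivlMr// mul1r.
exact: ltW.
Qed.

(** * Step sizes *)

Section step_rates.
Context {R : realType}.
Variables (m : nat) (lo hi : R^nat) (cg cp etag etap a b g q : R).
Hypothesis lo_noninc : nonincreasing_seq lo.
Hypothesis lo_cvg : lo @ \oo --> (0 : R).
Hypothesis hi_cvg : hi @ \oo --> +oo.
Hypothesis lo_rate : limn_einf (fun i => (lo i * ln (i%:R : R))%:E) = +oo%E.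
Hypothesis hi_rate : forall eps : R, 0 < eps ->
  limn_esup (fun i => (hi i / i%:R `^ eps)%:E) = 0%E.
Hypothesis cg0 : 0 < cg.
Hypothesis cp0 : 0 < cp.
Hypothesis heta1 : etag + etap < 1.
Hypothesis heta2 : 1 < 2 * etag + etap.
Hypothesis heta3 : 1 < etag + 2 * etap.
Hypothesis etag0 : 0 < etag.
Hypothesis etap0 : 0 < etap.
Hypothesis a0 : 0 < a.
Hypothesis b0 : 0 <= b.
Hypothesis g0 : 0 <= g.
Hypothesis q0 : 0 <= q.

Definition gain_size (n : nat) : R := cg * n%:R `^ (- etag).
Definition update_prob (n : nat) : R := cp * n%:R `^ (- etap).
(** The mean step size of the update from time i to time i + 1. *)
Definition weight (i : nat) : R := gain_size i.+1 * update_prob i.+1.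

Lemma gain_size_ge0 n : 0 <= gain_size n.
Proof. by rewrite mulr_ge0 ?powR_ge0// ltW. Qed.

Lemma update_prob_ge0 n : 0 <= update_prob n.
Proof. by rewrite mulr_ge0 ?powR_ge0// ltW. Qed.

Lemma weight_ge0 i : 0 <= weight i.
Proof. by rewrite mulr_ge0 ?gain_size_ge0 ?update_prob_ge0. Qed.

Lemma weight_noninc i : weight i.+1 <= weight i.
Proof.
have h (e : R) : 0 < e -> (i.+2%:R : R) `^ (- e) <= i.+1%:R `^ (- e).
  move=> e0; rewrite !powRN lef_pV2 ?posrE ?powR_gt0//.
  by apply: ge0_ler_powR; rewrite ?nnegrE ?(ltW e0)// ler_nat.
apply: ler_pM; rewrite ?gain_size_ge0 ?update_prob_ge0//.
- by apply: ler_wpM2l; [exact: ltW|exact: h].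
- by apply: ler_wpM2l; [exact: ltW|exact: h].
Qed.

Lemma exponent_margin : exists2 e : R, 0 < e &
  [/\ 1 + 4 * e <= 2 * etag + etap, 1 + 4 * e <= etag + 2 * etap,
      4 * e <= etag + etap & etag + etap + e <= 1].
Proof.
have pos_min (u v : R) : 0 < u -> 0 < v -> exists2 w : R, 0 < w & w <= u /\ w <= v.
  move=> u0 v0; exists (Num.min u v); first by rewrite lt_min u0.
  by split; rewrite ge_min lexx ?orbT.
move: (heta1) (heta2) (heta3) (etag0) (etap0) => *.
have [c1 c10 [h1 h2]] := pos_min (2 * etag + etap - 1) (etag + 2 * etap - 1)
  ltac:(lra) ltac:(lra).
have [c2 c20 [h3 h4]] := pos_min (etag + etap) (1 - etag - etap) ltac:(lra) ltac:(lra).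
have [c c0 [hc1 hc2]] := pos_min _ _ c10 c20.
by exists (c / 4); [lra|split; lra].
Qed.

Lemma eventually_proj_set : exists k0, forall i, (k0 <= i)%N -> lo i <= a /\ b <= hi i.
Proof.
have [k1 _ h1] : \forall i \near \oo, lo i < a by exact: cvgr_lt lo_cvg _ a0.
have [k2 _ h2] : \forall i \near \oo, b <= hi i by move/cvgryPge : hi_cvg; exact.
exists (maxn k1 k2) => i; rewrite geq_max => /andP[i1 i2].
by split; [exact: ltW (h1 i i1)|exact: h2].
Qed.

(** With n = i + 1 and x = n^e, the constants are: [remainder] at most Cr x^2, the
    moments at most CM x, and lo_i at least 1 / x. Each claim then compares two
    exponents of n, with the margin of [exponent_margin]. *)
Lemma step_rates : exists2 e : R, 0 < e & forall CM, 0 <= CM ->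
  exists B k0, 0 <= B /\ forall i, (k0 <= i)%N ->
  [/\ update_prob i.+1 * ((gain_size i.+1 ^+ 2 + weight i) *
        remainder m a g q (lo i.+1) (hi i.+1)) * (CM * i.+1%:R `^ e) <=
        B * i.+1%:R `^ (- (1 + e)),
      weight i * ((2 * hi i.+1 * g + 2 * a * expR (q / lo i.+1)) *
        (CM * i.+1%:R `^ e)) <= B * i.+1%:R `^ (- e) &
      cg * cp / a / i.+1%:R <= weight i * (lo i / a)] /\
  [/\ update_prob i.+1 <= 1, lo i <= a & b <= hi i.+1].
Proof.
have [e e0 [he1 he2 he3 he4]] := exponent_margin.
exists e => // CM CM0.
move: (a0) (b0) (g0) => *.
pose Cr : R := m.+2%:R ^+ 2 + 2 * g + 2 * a.
have Cr0 : 0 <= Cr by rewrite /Cr; have := sqr_ge0 (m.+2%:R : R); lra.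
pose B1 := cp * cg * (cg + cp) * Cr * CM.
pose B2 := cp * cg * (2 * g + 2 * a) * CM.
have B10 : 0 <= B1 by rewrite /B1 !mulr_ge0// ?addr_ge0// ltW.
have B20 : 0 <= B2 by rewrite /B2 !mulr_ge0// ?addr_ge0 ?mulr_ge0// ltW.
have [k1 hk1] := hi_le hi_rate e0.
have [k2 hk2] := expR_lo_le lo_noninc lo_rate e0 q0.
have [k3 hk3] := lo_ge lo_rate e0.
have [k4 hk4] := eventually_proj_set.
have [k5 hk5] := powR_neg_small etap0 (ltW cp0) (@ltr01 R).
exists (B1 + B2), (maxn (maxn k1 k2) (maxn k3 (maxn k4 k5))); split; first exact: addr_ge0.
move=> i; rewrite !geq_max => /andP[/andP[i1 i2] /andP[i3 /andP[i4 i5]]].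
have [la _] := hk4 i i4; have [_ bh] := hk4 i.+1 (leqW i4).
split; last by split => //; exact: hk5.
have hx := hk1 i.+1 (leqW i1); have ex := hk2 i.+1 (leqW i2); have lx := hk3 i.+1 (leqW i3).
have loi : lo i.+1 <= lo i := lo_noninc (leqnSn i).
rewrite /weight /update_prob /gain_size.
set n : R := i.+1%:R in hx ex lx *.
have n1 : 1 <= n by rewrite ler1n.
have n0 : n != 0 by rewrite gt_eqF// (lt_le_trans _ n1).
have pD r s : n `^ r * n `^ s = n `^ (r + s) by rewrite powRD// n0 implybT.
have -> : n `^ (- (1 + e)) = n^-1 * n `^ (- e).
  by rewrite -powR_inv1 ?(le_trans ler01)// pD opprD.
have pX r (j : nat) : (n `^ r) ^+ j = n `^ (r * j%:R).
  by rewrite powRrM powR_mulrn ?powR_ge0.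
have ninv : n^-1 = n `^ (-1) by rewrite powR_inv1// (le_trans ler01).
set u := n `^ (- etag); set v := n `^ (- etap); set x := n `^ e in hx ex *.
set z := n `^ (- e) in lx *.
have u0 : 0 <= u := powR_ge0 _ _; have v0 : 0 <= v := powR_ge0 _ _.
have z0 : 0 <= z := powR_ge0 _ _.
have x1 : 1 <= x by rewrite -(powRr0 n) ler_powR// ltW.
have F1 : v * u ^+ 2 * x ^+ 3 <= n^-1 * z.
  by rewrite ninv !pX !pD ler_powR//; lra.
have F2 : v ^+ 2 * u * x ^+ 3 <= n^-1 * z.
  by rewrite ninv !pX !pD ler_powR//; lra.
have F3 : u * v * x ^+ 2 <= z by rewrite !pX !pD ler_powR//; lra.
have F4 : n^-1 <= u * v * z by rewrite ninv !pD ler_powR//; lra.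
have nz0 : 0 <= n^-1 * z by rewrite mulr_ge0// invr_ge0 (le_trans ler01).
have h0 : 0 <= hi i.+1 by exact: le_trans bh.
have x0 : 0 <= x by exact: le_trans x1.
have xx : x <= x ^+ 2 by rewrite expr2 ler_peMl.
have lin : 2 * hi i.+1 * g + 2 * a * expR (q / lo i.+1) <= (2 * g + 2 * a) * x.
  rewrite [leRHS]mulrDl; apply: lerD; last by rewrite ler_wpM2l// mulr_ge0// ltW.
  by rewrite mulrAC ler_wpM2l// mulr_ge0.
split.
- have rx : remainder m a g q (lo i.+1) (hi i.+1) <= Cr * x ^+ 2.
    rewrite /remainder /Cr -[leLHS]addrA -[_ + 2 * g + _]addrA [leRHS]mulrDl; apply: lerD.
      rewrite -exprMn lerXn2r ?nnegrE ?addr_ge0 ?mulr_ge0//.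
      by rewrite -[m.+2]addn1 natrD [leRHS]mulrDl mul1r lerD// ler_peMr.
    by apply: le_trans lin _; rewrite ler_wpM2l// addr_ge0// mulr_ge0// ltW.
  have r0 : 0 <= remainder m a g q (lo i.+1) (hi i.+1).
    by rewrite /remainder !addr_ge0 ?sqr_ge0// !mulr_ge0 ?expR_ge0// ltW.
  have cgu : 0 <= cg * u by rewrite mulr_ge0// ltW.
  have cpv : 0 <= cp * v by rewrite mulr_ge0// ltW.
  have K0 : 0 <= (cg * u) ^+ 2 + cg * u * (cp * v) by rewrite addr_ge0 ?sqr_ge0// mulr_ge0.
  apply: (@le_trans _ _ (cp * v * (((cg * u) ^+ 2 + cg * u * (cp * v)) * (Cr * x ^+ 2)) * (CM * x))).
    by rewrite ler_wpM2r ?mulr_ge0// ler_wpM2l// ler_wpM2l.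
  have -> : cp * v * (((cg * u) ^+ 2 + cg * u * (cp * v)) * (Cr * x ^+ 2)) * (CM * x) =
      cp * cg * Cr * CM * (cg * (v * u ^+ 2 * x ^+ 3) + cp * (v ^+ 2 * u * x ^+ 3)) by ring.
  apply: (@le_trans _ _ (B1 * (n^-1 * z))); last by rewrite ler_wpM2r// lerDl.
  have -> : B1 * (n^-1 * z) = cp * cg * Cr * CM * (cg * (n^-1 * z) + cp * (n^-1 * z)).
    by rewrite /B1; ring.
  rewrite ler_wpM2l//; first by rewrite !mulr_ge0// ltW.
  by apply: lerD; rewrite ler_pM2l.
- apply: (@le_trans _ _ (cg * u * (cp * v) * ((2 * g + 2 * a) * x * (CM * x)))).
    rewrite ler_wpM2l ?mulr_ge0// ?(ltW cg0) ?(ltW cp0)//.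
    by rewrite ler_wpM2r// mulr_ge0.
  have -> : cg * u * (cp * v) * ((2 * g + 2 * a) * x * (CM * x)) = B2 * (u * v * x ^+ 2).
    by rewrite /B2; ring.
  apply: (@le_trans _ _ (B2 * z)); first by rewrite ler_wpM2l.
  by rewrite ler_wpM2r// lerDr.
- apply: (@le_trans _ _ (cg * u * (cp * v) * (z / a))); last first.
    rewrite ler_wpM2l ?mulr_ge0// ?(ltW cg0) ?(ltW cp0)//.
    by rewrite ler_wpM2r ?invr_ge0 ?(ltW a0)// (le_trans lx).
  have -> : cg * u * (cp * v) * (z / a) = cg * cp / a * (u * v * z) by ring.
  by rewrite ler_wpM2l// divr_ge0 ?mulr_ge0// ltW.
Qed.

End step_rates.

(** * The recursion *)

Section process.
Context {R : realType} {d : measure_display} {Omega : measurableType d}.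
Variables (m N : nat) (P : probability Omega R) (y : m.+1.-tuple nat)
  (rho sigma : R) (lo hi : R^nat) (cg cp etag etap theta0 : R)
  (x0 : pf_state R m N) (U theta : nat -> {mfun Omega >-> R})
  (X : nat -> {mfun Omega >-> pf_state R m N}).
Hypothesis hP : pimh_em_process P y rho sigma lo hi cg cp etag etap theta0 x0 U theta X.
Hypothesis sigma0 : sigma != 0.
Hypothesis rho1 : -1 < rho < 1.

Local Notation Gam := (step_size cg cp etag etap U).
Local Notation gsz := (gain_size cg etag).
Local Notation upr := (update_prob cp etap).
Local Notation weight := (weight cg cp etag etap).

Section history.
Local Open Scope ereal_scope.

Lemma measurable_step_size i : measurable_fun setT (Gam i).
Proof.
apply: measurable_funM => //; apply: measurable_indic.
rewrite -[X in measurable X]setTI; apply: measurable_fun_le => //.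
Qed.

Lemma history_measurable i A : history theta X Gam i A -> measurable A.
Proof.
apply: smallest_sub; first exact: sigma_algebra_measurable.
move=> B [[k _ [|]]|[k _]] [C mC <-].
- by rewrite setTI -[X in measurable X]setTI; exact: (measurable_funP (theta k)).
- by rewrite setTI -[X in measurable X]setTI; exact: (measurable_funP (X k)).
- exact: measurable_step_size.
Qed.

Lemma history_theta i k C : (k <= i)%N -> measurable C ->
  history theta X Gam i (theta k @^-1` C).
Proof.
move=> ki mC; apply: sub_sigma_algebra; left; exists k => //; left.
by exists C => //; rewrite setTI.
Qed.

Lemma history_state i k C : (k <= i)%N -> measurable C ->
  history theta X Gam i (X k @^-1` C).
Proof.
move=> ki mC; apply: sub_sigma_algebra; left; exists k => //; right.
by exists C => //; rewrite setTI.
Qed.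

Lemma history_step i A : history theta X Gam i A -> history theta X Gam i.+1 A.
Proof.
apply: sub_sigma_algebra2 => B [[k ki h]|[k /andP[k1 ki] h]].
  by left; exists k => //=; exact: leqW.
by right; exists k => //=; rewrite k1 leqW.
Qed.

Lemma history_sub_next i A : history theta X Gam i A -> history_next theta X Gam i A.
Proof. by apply: sub_sigma_algebra2 => B hB; left. Qed.

Lemma historyI i A B : history theta X Gam i A -> history theta X Gam i B ->
  history theta X Gam i (A `&` B).
Proof.
move=> hA hB.
exact: (@measurableI _ (g_sigma_algebraType (history_gen theta X Gam i))).
Qed.

Lemma historyT i : history theta X Gam i setT.
Proof. exact: (@measurableT _ (g_sigma_algebraType (history_gen theta X Gam i))). Qed.

(** The event A enters through the boolean coordinate of the pair
    (w \in A, (theta_i, X_i)), which is measurable for the history. *)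
Lemma integral_kernel_step i A (g : R * pf_state R m N -> \bar R) :
  history theta X Gam i A -> measurable_fun setT g -> (forall p, 0 <= g p) ->
  \int[P]_(w in A) g (theta i w, X i.+1 w) =
  \int[P]_(w in A) pimh_step y rho sigma (theta i w) (X i w) (fun z => g (theta i w, z)).
Proof.
move=> hA mg g0; have mA := history_measurable hA.
pose T := (bool * (R * pf_state R m N))%type.
pose Y w : T := (w \in A, (theta i w, X i w)).
pose f (p : T * pf_state R m N) : \bar R := if p.1.1 then g (p.1.2.1, p.2) else 0.
have mf : measurable_fun setT f.
  apply: measurable_fun_if => //.
  - by do 2 apply: measurableT_comp => //.
  - apply: measurable_funTS; apply: (measurableT_comp mg).
    apply: measurable_fun_pair => //.
    by apply: measurableT_comp => //; apply: measurableT_comp => //.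
have f0 p : 0 <= f p by rewrite /f; case: ifP.
pose G := history_gen theta X Gam i.
have mYG : @measurable_fun _ _ (g_sigma_algebraType G) T setT Y.
  apply: measurable_fun_pair.
    by apply: (@measurable_mem_indic _ (g_sigma_algebraType G)).
  apply: measurable_fun_pair.
    by move=> _ C mC; rewrite setTI; exact: history_theta.
  by move=> _ C mC; rewrite setTI; exact: history_state.
have mY : measurable_fun setT Y.
  move=> _ C mC; rewrite setTI; apply: (@history_measurable i).
  by have := mYG measurableT C mC; rewrite setTI.
have kK : kernelized (fun t : T => @pimh_step R m N y rho sigma t.2.1 t.2.2).
  refine (@kernelized_comp R _ _ _ T (R * pf_state R m N)%type (pf_state R m N)
    (fun tz => pimh_step y rho sigma tz.1 tz.2) snd _ _) => //.
  exact: kernelized_pimh_step.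
have := @integral_conditional_law R _ _ _ Omega T (pf_state R m N) P Y (X i.+1)
  mY (measurable_funP (X i.+1)) _ kK _ f mf f0.
move=> H; rewrite integral_restrict [RHS]integral_restrict.
transitivity (\int[P]_w f (Y w, X i.+1 w)).
  by apply: eq_integral => w _; rewrite /f/=; case: ifP.
rewrite H; last first.
  move=> C B mC mB.
  rewrite (process_kernel hP)//.
  by have := mYG measurableT C mC; rewrite setTI.
apply: eq_integral => w _; rewrite /f/=; case: ifP => // wA.
by rewrite (expect_cst (expectation_pimh_step y sigma0 rho1 (theta i w) (X i w)) (lexx 0%R)).
Qed.

(** As in [integral_kernel_step], with the new state added to the conditioning. *)
Lemma integral_indep_step i A (p : R) (g : R * pf_state R m N -> \bar R) :
  (0 <= p <= 1)%R ->
  history theta X Gam i A -> measurable_fun setT g -> (forall q, 0 <= g q) ->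
  \int[P]_(w in A `&` [set w | (U i.+1 w <= p)%R]) g (theta i w, X i.+1 w) =
  p%:E * \int[P]_(w in A) g (theta i w, X i.+1 w).
Proof.
move=> p01 hA mg g0; have mA := history_measurable hA.
have p0 : (0 <= p)%R by case/andP: p01.
pose T := (bool * (R * pf_state R m N))%type.
pose Y w : T := (w \in A, (theta i w, X i.+1 w)).
pose f (q : T * R) : \bar R := if q.1.1 && (q.2 <= p)%R then g q.1.2 else 0.
have mf : measurable_fun setT f.
  apply: measurable_fun_if => //.
  - apply: measurable_and; first by do 2 apply: measurableT_comp => //.
    by apply: measurable_fun_ler.
  - apply: measurable_funTS; apply: (measurableT_comp mg).
    by apply: measurableT_comp => //.
have f0 q : 0 <= f q by rewrite /f; case: ifP.
pose G := history_gen theta X Gam i `|` preimage_set_system setT (X i.+1) measurable.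
have mYG : @measurable_fun _ _ (g_sigma_algebraType G) T setT Y.
  apply: measurable_fun_pair.
    apply: (@measurable_mem_indic _ (g_sigma_algebraType G)).
    exact: history_sub_next.
  apply: measurable_fun_pair.
    move=> _ C mC; rewrite setTI; apply: history_sub_next; exact: history_theta.
  move=> _ C mC; rewrite setTI; apply: sub_sigma_algebra; right.
  by exists C => //; rewrite setTI.
have mY : measurable_fun setT Y.
  apply: measurable_fun_pair; first exact: measurable_mem_indic.
  by apply: measurable_fun_pair; exact: measurable_funP.
have kK : kernelized (fun (_ : T) (h : R -> \bar R) => \int[distribution P (U i.+1)]_u h u).
  apply: (@kernelizedI R _ _ T R _ (fun _ => distribution P (U i.+1))) => //.
  by move=> _; exact: probability_setT.
have := @integral_conditional_law R _ _ _ Omega T R P Y (U i.+1)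
  mY (measurable_funP (U i.+1)) _ kK _ f mf f0.
have mle : measurable [set u : R | (u <= p)%R].
  by rewrite -[X in measurable X]setTI; exact: measurable_fun_le.
move=> H.
transitivity (\int[P]_w f (Y w, U i.+1 w)).
  rewrite integral_restrict; apply: eq_integral => w _; rewrite /f/=.
  by rewrite in_setI; case: (w \in A) => //=; rewrite mem_setE.
rewrite H; last first.
  move=> C B mC mB.
  rewrite (process_indep hP)//; last first.
    by have := mYG measurableT C mC; rewrite setTI.
  rewrite integral_indic// setIT integral_cst//.
    by rewrite muleC.
  by rewrite -[X in measurable X]setTI; exact: mY.
rewrite [X in _ = _ * X]integral_restrict.
rewrite -ge0_integralZl//; last 2 first.
- apply: measurable_fun_if => //; first exact: measurable_mem_indic.
  apply: measurable_funTS; apply: (measurableT_comp mg).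
  by apply: measurable_fun_pair; exact: measurable_funP.
- by move=> w _; case: ifP.
apply: eq_integral => w _; rewrite /f/=; case: (w \in A) => /=; last first.
  by rewrite mule0 integral0.
transitivity (\int[distribution P (U i.+1)]_u (g (theta i w, X i.+1 w) * (\1_[set u : R | (u <= p)%R] u)%:E)).
  apply: eq_integral => u _; rewrite indicE; case: ifP => h.
    by rewrite mem_set// mule1.
  by rewrite memNset ?mule0//= h.
rewrite ge0_integralZl//; last by apply/measurable_EFinP/measurable_indic.
rewrite integral_indic// setIT muleC; congr (_ * _).
apply: etrans (process_uniform hP i mle) _.
by rewrite -(uniform_prob_le p01); congr (uniform_prob _ _).
Qed.

End history.

Hypothesis lo_noninc : nonincreasing_seq lo.
Hypothesis lo_cvg : lo @ \oo --> (0 : R).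
Hypothesis hi_nondec : nondecreasing_seq hi.
Hypothesis hi_cvg : hi @ \oo --> +oo.
Hypothesis lo_rate : limn_einf (fun i => (lo i * ln (i%:R : R))%:E) = +oo%E.
Hypothesis hi_rate : forall eps : R, 0 < eps ->
  limn_esup (fun i => (hi i / i%:R `^ eps)%:E) = 0%E.
Hypothesis theta00 : lo 0%N <= theta0 <= hi 0%N.

Let lo0 : forall i, 0 < lo i := lo_gt0 lo_noninc lo_rate.

Lemma step_sizeE i w :
  Gam i w = if U i w <= upr i then gsz i else 0.
Proof.
rewrite /step_size indicE; case: ifP => h; first by rewrite mem_set ?mulr1.
by rewrite memNset ?mulr0//= h.
Qed.

Lemma lo_le_hi i : lo i <= hi i.
Proof.
apply: le_trans (lo_noninc (leq0n i)) _; apply: le_trans (hi_nondec (leq0n i)).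
by case/andP: theta00 => /le_trans; apply.
Qed.

(** The projection fixes the points of the projection set. *)
Lemma theta_clamp i w :
  theta i.+1 w = Num.min (Num.max (lo i.+1)
    (theta i w + Gam i.+1 w * H y (theta i w) (X i.+1 w))) (hi i.+1).
Proof.
have := process_update hP i w; rewrite /=; set t := theta i w + _ => ->.
case: ifPn => // /set_mem[_ /andP[lt th]].
by rewrite max_r// min_l.
Qed.

Lemma theta_bounds i w : lo i <= theta i w <= hi i.
Proof.
case: i => [|i]; first by rewrite (process_init hP w).1.
by rewrite theta_clamp le_min le_max lexx lo_le_hi ge_min lexx orbT.
Qed.

Lemma theta_gt0 i w : 0 < theta i w.
Proof. by apply: lt_le_trans (lo0 i) _; case/andP: (theta_bounds i w). Qed.

(** The integrand only has to be nonnegative at nonnegative parameters: it is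
    composed with the absolute value, which fixes theta_i. *)
Lemma integral_kernel_theta i A (f : R -> pf_state R m N -> R) :
  history theta X Gam i A ->
  measurable_fun setT (fun p : R * pf_state R m N => f p.1 p.2) ->
  (forall t z, 0 <= t -> 0 <= f t z) ->
  (\int[P]_(w in A) (f (theta i w) (X i.+1 w))%:E =
   \int[P]_(w in A) pimh_step y rho sigma (theta i w) (X i w)
     (fun z => (f (theta i w) z)%:E))%E.
Proof.
move=> hA mf f0.
have E w : `|theta i w| = theta i w by rewrite ger0_norm// ltW// theta_gt0.
have mg : measurable_fun setT (fun p : R * pf_state R m N => (f `|p.1| p.2)%:E).
  have ma : measurable_fun setT (fun p : R * pf_state R m N => (`|p.1|, p.2)).
    by apply: measurable_fun_pair => //; exact: measurableT_comp.
  by apply/measurable_EFinP; exact: measurableT_comp mf ma.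
have g0 (p : R * pf_state R m N) : (0 <= (f `|p.1| p.2)%:E)%E by rewrite lee_fin f0.
transitivity (\int[P]_(w in A) (f `|theta i w| (X i.+1 w))%:E)%E.
  by apply: eq_integral => w _; rewrite E.
rewrite (integral_kernel_step hA mg g0).
by apply: eq_integral => w _ /=; rewrite E.
Qed.

Lemma integral_update_theta i A (f : R -> pf_state R m N -> R) :
  0 <= upr i.+1 <= 1 ->
  history theta X Gam i A ->
  measurable_fun setT (fun p : R * pf_state R m N => f p.1 p.2) ->
  (forall t z, 0 <= t -> 0 <= f t z) ->
  (\int[P]_(w in A) ((if U i.+1 w <= upr i.+1 then 1 else 0) *
     f (theta i w) (X i.+1 w))%:E =
   (upr i.+1)%:E * \int[P]_(w in A) (f (theta i w) (X i.+1 w))%:E)%E.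
Proof.
move=> p01 hA mf f0.
have E w : `|theta i w| = theta i w by rewrite ger0_norm// ltW// theta_gt0.
have mg : measurable_fun setT (fun p : R * pf_state R m N => (f `|p.1| p.2)%:E).
  have ma : measurable_fun setT (fun p : R * pf_state R m N => (`|p.1|, p.2)).
    by apply: measurable_fun_pair => //; exact: measurableT_comp.
  by apply/measurable_EFinP; exact: measurableT_comp mf ma.
have g0 (p : R * pf_state R m N) : (0 <= (f `|p.1| p.2)%:E)%E by rewrite lee_fin f0.
transitivity ((upr i.+1)%:E * \int[P]_(w in A) (f `|theta i w| (X i.+1 w))%:E)%E; last first.
  by congr (_ * _)%E; apply: eq_integral => w _; rewrite E.
rewrite -(integral_indep_step p01 hA mg g0) integral_mkcondr.
apply: eq_integral => w _; rewrite patchE /= E.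
have -> : (w \in [set w | U i.+1 w <= upr i.+1]) = (U i.+1 w <= upr i.+1).
  by apply/idP/idP; [move/set_mem|move/mem_set].
by case: ifP => h; rewrite ?mul1r ?mul0r.
Qed.

(** The proposal adds at most a constant to the moment of the previous state, so
    the growth is at most linear. *)
Lemma state_moment c : 0 <= c -> exists2 C, 0 <= C & forall i,
  (\int[P]_w (expz c (X i w))%:E <= (expz c x0 + C * i%:R)%:E)%E.
Proof.
move=> c0; have [C C0 hC] := filter_moment N y sigma0 rho1 c0; exists C => //.
have mexp i : measurable_fun setT (fun w => (expz c (X i w))%:E).
  by apply/measurable_EFinP/measurable_expz; exact: measurable_funP.
elim=> [|i IH].
  under eq_integral do rewrite (process_init hP _).2.
  by rewrite integral_probability_cst mulr0 addr0.
rewrite (integral_kernel_theta (f := fun _ z => expz c z)); last 3 first.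
- exact: historyT.
- exact: measurable_expz.
- by move=> *; exact: expR_ge0.
apply: (@le_trans _ _ (\int[P]_w (C%:E + (expz c (X i w))%:E)))%E.
  apply: ge0_le_integral_any => w.
    apply (monotone_pimh_step y rho sigma (theta i w) (X i w)).1 => z.
    by rewrite lee_fin expR_ge0.
  have := @pimh_step_le R m N y rho sigma sigma0 rho1 (theta i w) (X i w) (expz c) 0 C.
  rewrite subr0 mul1r EFinD; apply.
  - exact: measurable_expz.
  - by move=> z; exact: expR_ge0.
  - apply (monotone_proposal N y rho sigma (theta i w)).1 => z.
    by rewrite lee_fin accept_prob_ge0.
  - exact: hC.
rewrite ge0_integralD//; last by move=> w _; rewrite lee_fin expR_ge0.
rewrite integral_probability_cst.
apply: le_trans (leeD2l C%:E IH) _; rewrite -EFinD lee_fin -natr1 mulrDr mulr1.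
by rewrite addrC addrA.
Qed.

(** With u = expz c and x = (i + 1)^e in [le_add_pow], the linear growth of the moment
    of order c (L + 1) is divided by (i + 1)^(e L) >= i + 1. *)
Lemma state_moment_rate c e : 0 <= c -> 0 < e -> exists2 C, 0 <= C &
  forall i j, (j <= i.+1)%N ->
  (\int[P]_w (expz c (X j w))%:E <= (C * i.+1%:R `^ e)%:E)%E.
Proof.
move=> c0 e0; pose L := Num.bound e^-1.
have eL : 1 <= e * L%:R.
  rewrite mulrC -ler_pdivrMr// mul1r; apply: ltW; apply: archi_boundP.
  by rewrite invr_ge0 ltW.
have cL : 0 <= c * L.+1%:R by rewrite mulr_ge0.
have [C C0 hC] := state_moment cL.
set D := expz (c * L.+1%:R) x0 + C.
have D0 : 0 <= D by rewrite addr_ge0// expR_ge0.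
exists (1 + D); first by rewrite addr_ge0.
move=> i j ji; set n : R := i.+1%:R.
have n1 : 1 <= n by rewrite ler1n.
have n0 : 0 < n by exact: lt_le_trans n1.
set x := n `^ e; have x0' : 0 < x by exact: powR_gt0.
have xL : n <= x ^+ L.
  rewrite -powR_mulrn ?powR_ge0// /x -powRrM -[leLHS](powRr1 (ltW n0)).
  exact: ler_powR.
have xL0 : 0 < x ^+ L by exact: exprn_gt0.
have mexp k : measurable_fun setT (fun w => (expz k (X j w))%:E).
  by apply/measurable_EFinP/measurable_expz; exact: measurable_funP.
apply: (@le_trans _ _ (\int[P]_w (x%:E + (x ^+ L)^-1%:E * (expz (c * L.+1%:R) (X j w))%:E))%E).
  apply: ge0_le_integral_any => w; first by rewrite lee_fin expR_ge0.
  rewrite -EFinM -EFinD lee_fin.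
  have -> : expz (c * L.+1%:R) (X j w) = expz c (X j w) ^+ L.+1.
    by rewrite /expz -expRM_natl mulrCA -mulrA mulr_natl.
  by rewrite mulrC; apply: le_add_pow => //; exact: expR_ge0.
rewrite ge0_integralD//; first last.
- by apply: emeasurable_funM => //; exact: measurable_cst.
- by move=> w _; rewrite mule_ge0// lee_fin ?expR_ge0// invr_ge0 ltW.
- by move=> w _; rewrite lee_fin ltW.
rewrite integral_probability_cst ge0_integralZl//; last 2 first.
- by move=> w _; rewrite lee_fin expR_ge0.
- by rewrite lee_fin invr_ge0 ltW.
have -> : ((1 + D) * x)%:E = (x%:E + (D * x)%:E)%E by rewrite -EFinD mulrDl mul1r.
rewrite leeD2l//.
apply: (@le_trans _ _ ((x ^+ L)^-1%:E * (D * n)%:E)%E).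
  apply: lee_wpmul2l; first by rewrite lee_fin invr_ge0 ltW.
  apply: le_trans (hC j) _; rewrite lee_fin mulrDl; apply: lerD.
    by rewrite ler_peMr// expR_ge0.
  by rewrite ler_wpM2l// ler_nat.
rewrite -EFinM lee_fin mulrCA ler_wpM2l//.
apply: (@le_trans _ _ 1); first by rewrite mulrC ler_pdivrMr// mul1r.
rewrite -[leLHS](powRr0 n); apply: ler_powR => //; exact: ltW.
Qed.

Hypothesis cg0 : 0 < cg.
Hypothesis cp0 : 0 < cp.
Hypothesis etag0 : 0 < etag.
Hypothesis etap0 : 0 < etap.
Hypothesis heta1 : etag + etap < 1.
Hypothesis heta2 : 1 < 2 * etag + etap.
Hypothesis heta3 : 1 < etag + 2 * etap.

Variables (a b g k q : R).
Hypothesis g0 : 0 <= g.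
Hypothesis k0 : 0 <= k.
Hypothesis q0 : 0 <= q.
Hypothesis a0 : 0 < a.
Hypothesis ab : a <= b.
Hypothesis b1 : 1 <= b.

Local Notation K := (corrector m N rho sigma).
Local Notation correct := (correction rho sigma a b g k).
Local Notation kap := (moment_order k).
Local Notation dist := (dist2 a b).

Hypothesis K_le : forall t, 0 < t <= a -> K t <= expR (q / t).
Hypothesis large : forall t (z : pf_state R m N), 1 <= t ->
  (pimh_step y rho sigma t z (fun z' => (g * expz k z' + maxstat z')%:E) <=
   (g * expz k z + b)%:E)%E.
Hypothesis small : forall t (z : pf_state R m N), 0 < t <= a ->
  (pimh_step y rho sigma t z
     (fun z' => ((K t + 4 * t) * \1_(@low_event R m N t) z')%:E) <=
   (K t * \1_(@low_event R m N t) z + 2 * t)%:E)%E.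

Definition lyapunov (i : nat) (w : Omega) : R :=
  dist (theta i w) + weight i * correct (theta i w) (X i w).

Let th_ge0 i w : 0 <= theta i w := ltW (theta_gt0 i w).

Let mth i : measurable_fun setT (theta i). Proof. exact: measurable_funP. Qed.
Let mX i : measurable_fun setT (X i). Proof. exact: measurable_funP. Qed.

Lemma measurable_dist_theta i : measurable_fun setT (fun w => dist (theta i w)).
Proof. exact: measurableT_comp (measurable_dist2 a b) (mth i). Qed.

Lemma measurable_lyapunov i : measurable_fun setT (lyapunov i).
Proof.
apply: measurable_funD; first exact: measurable_dist_theta.
by apply: measurable_funM => //; exact: measurable_correction.
Qed.

Let correct_ge0 i j w : 0 <= correct (theta i w) (X j w).
Proof. exact: correction_ge0. Qed.

Lemma integral_lyapunov i (A : set Omega) : measurable A ->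
  (\int[P]_(w in A) (lyapunov i w)%:E = \int[P]_(w in A) (dist (theta i w))%:E +
   (weight i)%:E * \int[P]_(w in A) (correct (theta i w) (X i w))%:E)%E.
Proof.
move=> mA; rewrite integralD_real// ?integralZ_real//.
- exact: measurable_correction.
- exact: weight_ge0.
- exact: measurable_dist_theta.
- by apply: measurable_funM => //; exact: measurable_correction.
- by move=> w; exact: dist2_ge0.
- by move=> w; rewrite mulr_ge0 ?weight_ge0.
Qed.

(** The loss, which does not depend on the new state, is put under the one-step
    law, so that the integral of a one-step mean never has to be split. *)
Lemma integral_correction_drift i A : history theta X Gam i A ->
  (\int[P]_(w in A) (correct (theta i w) (X i.+1 w))%:E +
   \int[P]_(w in A) (gain a b (theta i w) (X i.+1 w))%:E +
   \int[P]_(w in A) (loss a b (theta i w))%:E <=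
   \int[P]_(w in A) (correct (theta i w) (X i w))%:E +
   \int[P]_(w in A) (pull a b (theta i w))%:E)%E.
Proof.
move=> hA; have mA := history_measurable hA.
have mloss : measurable_fun setT (fun w => loss a b (theta i w)) by exact: measurable_loss.
have mgain : measurable_fun setT (fun w => gain a b (theta i w) (X i.+1 w)) by exact: measurable_gain.
have mcor j : measurable_fun setT (fun w => correct (theta i w) (X j w)) by exact: measurable_correction.
have mpull : measurable_fun setT (fun w => pull a b (theta i w)) by exact: measurable_pull.
have gain0 w : 0 <= gain a b (theta i w) (X i.+1 w) by exact: gain_ge0.
have loss0 w : 0 <= loss a b (theta i w) by exact: loss_ge0.
have pull0 w : 0 <= pull a b (theta i w) by exact: pull_ge0.
have mcg : measurable_fun setT
    (fun w => correct (theta i w) (X i.+1 w) + gain a b (theta i w) (X i.+1 w)).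
  exact: measurable_funD.
have csg0 w : 0 <= correct (theta i w) (X i.+1 w) + gain a b (theta i w) (X i.+1 w).
  by rewrite addr_ge0.
have c0 j w : 0 <= correct (theta i w) (X j w) by exact: correct_ge0.
have e1 := integralD_real P mA mcg mloss csg0 loss0.
rewrite (integralD_real P mA (mcor i.+1) mgain (c0 i.+1) gain0) in e1.
have e2 := integralD_real P mA (mcor i) mpull (c0 i) pull0.
rewrite -e1 -e2 {e1 e2}.
pose f (t : R) (z : pf_state R m N) : R := correct t z + gain a b t z + loss a b t.
rewrite (integral_kernel_theta (f := f))//; last 2 first.
- apply: measurable_funD; last by apply: measurable_loss.
  by apply: measurable_funD; [apply: measurable_correction|apply: measurable_gain].
- by move=> t z t0; rewrite /f addr_ge0 ?loss_ge0// addr_ge0 ?correction_ge0 ?gain_ge0.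
rewrite integral_restrict [leRHS]integral_restrict.
apply: ge0_le_integral_any => w; case: ifP => // _.
  apply (monotone_pimh_step y rho sigma (theta i w) (X i w)).1 => z.
  by rewrite lee_fin /f addr_ge0 ?loss_ge0// addr_ge0 ?correction_ge0 ?gain_ge0.
apply: le_trans (correction_drift sigma0 rho1 g0 b1 large small (X i w) (theta_gt0 i w)).
have hE := expectation_pimh_step y sigma0 rho1 (theta i w) (X i w).
rewrite -[X in (_ + X)%E](expect_cst hE (loss0 w)) -expect_add//.
- apply/measurable_EFinP/measurable_funD; last by apply: measurable_gain.
  by apply: measurable_correction.
- by move=> z; rewrite lee_fin addr_ge0 ?correction_ge0 ?gain_ge0.
- by move=> z; rewrite lee_fin.
Qed.

(** The term [pull] appears on both sides, through [lyapunov_step] and through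
    [integral_correction_drift]; it is bounded on the projection set, hence of
    finite integral, and cancels. *)
Lemma integrated_drift i A (M : R) : history theta X Gam i A ->
  upr i.+1 <= 1 -> lo i <= a -> b <= hi i.+1 ->
  (\int[P]_w (expz kap (X i.+1 w))%:E <= M%:E)%E ->
  (\int[P]_(w in A) (lyapunov i.+1 w)%:E +
    (weight i * (lo i / a))%:E * \int[P]_(w in A) (dist (theta i w))%:E <=
   \int[P]_(w in A) (lyapunov i w)%:E +
    (upr i.+1 * ((gsz i.+1 ^+ 2 + weight i) * remainder m a g q (lo i.+1) (hi i.+1)) * M)%:E)%E.
Proof.
move=> hA p1 la bh hM; have mA := history_measurable hA.
set r := remainder _ _ _ _ _ _; set s := gsz i.+1; set p := upr i.+1.
have s0 : 0 <= s by exact: gain_size_ge0.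
have p0 : 0 <= p by exact: update_prob_ge0.
have wE : weight i = s * p by [].
have w0 := weight_ge0 etag etap cg0 cp0 i.
have hh0 : 0 <= hi i.+1 by apply: le_trans bh; apply: le_trans b1.
have r0 : 0 <= r.
  by rewrite /r /remainder !addr_ge0 ?sqr_ge0// !mulr_ge0 ?expR_ge0// ltW.
pose J w : bool := U i.+1 w <= p.
pose F w : R := s * gain a b (theta i w) (X i.+1 w) + (s ^+ 2 + weight i) * r * expz kap (X i.+1 w).
have step w : lyapunov i.+1 w + (if J w then 1 else 0) * (s * pull a b (theta i w)) <=
    dist (theta i w) + weight i * correct (theta i w) (X i.+1 w) +
    (if J w then 1 else 0) * F w.
  have /andP[lt th] := theta_bounds i w.
  have hb : lo i.+1 <= theta i w <= hi i.+1.
    by rewrite (le_trans _ lt) ?lo_noninc//= (le_trans th)// hi_nondec.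
  have := @lyapunov_step R m N y rho sigma a b g k q g0 k0 q0 a0 ab K_le (J w)
    (lo i.+1) (hi i.+1) (theta i w) (theta i.+1 w) s (weight i) (weight i.+1) (X i.+1 w)
    (lo0 _) hb s0 (le_trans (lo_noninc (leqnSn i)) la) bh _ _.
  rewrite (weight_ge0 etag etap cg0 cp0) (weight_noninc cg0 cp0 etag0 etap0) => /(_ erefl).
  have -> : (if J w then s else 0) = Gam i.+1 w by rewrite step_sizeE.
  move=> /(_ (theta_clamp i w)); rewrite step_sizeE -/p -/(J w) /F /lyapunov.
  by case: (J w); rewrite ?mul1r ?mul0r.
have mJ : measurable_fun setT (fun w => if J w then 1 else 0 : R).
  by apply: measurable_fun_ifT => //; apply: measurable_fun_ler.
have mpull : measurable_fun setT (fun w => pull a b (theta i w)) by exact: measurable_pull.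
have mgain : measurable_fun setT (fun w => gain a b (theta i w) (X i.+1 w)) by exact: measurable_gain.
have mexp : measurable_fun setT (fun w => expz kap (X i.+1 w)) by exact: measurable_expz.
have mF : measurable_fun setT F by apply: measurable_funD; exact: measurable_funM.
have mcor j : measurable_fun setT (fun w => correct (theta i w) (X j w)) by exact: measurable_correction.
have gain0 w : 0 <= gain a b (theta i w) (X i.+1 w) by exact: gain_ge0.
have pull0 w : 0 <= pull a b (theta i w) by exact: pull_ge0.
have sw0 : 0 <= s ^+ 2 + weight i by rewrite addr_ge0 ?sqr_ge0.
have F0 w : 0 <= F w.
  apply: addr_ge0; first exact: mulr_ge0.
  by apply: mulr_ge0; [exact: mulr_ge0|exact: expR_ge0].
have J0 w : 0 <= (if J w then 1 else 0) :> R by case: (J w).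
have lyap0 j w : 0 <= lyapunov j w by rewrite addr_ge0 ?dist2_ge0// mulr_ge0 ?weight_ge0.
have mly := measurable_lyapunov.
have h1 : (\int[P]_(w in A) (lyapunov i.+1 w)%:E +
    p%:E * (s%:E * \int[P]_(w in A) (pull a b (theta i w))%:E) <=
    \int[P]_(w in A) (dist (theta i w))%:E +
    (weight i)%:E * \int[P]_(w in A) (correct (theta i w) (X i.+1 w))%:E +
    p%:E * \int[P]_(w in A) (F w)%:E)%E.
  have mJs : measurable_fun setT (fun w => (if J w then 1 else 0) * (s * pull a b (theta i w))).
    by apply: measurable_funM => //; exact: measurable_funM.
  have mJF : measurable_fun setT (fun w => (if J w then 1 else 0) * F w).
    by apply: measurable_funM.
  have p01 : 0 <= upr i.+1 <= 1 by rewrite p0.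
  have Es := integral_update_theta
    (f := fun t _ => s * pull a b t) p01 hA.
  rewrite -integralZ_real// -Es; last 2 first.
  - by apply: measurable_funM => //; exact: measurable_pull.
  - by move=> t _ t0; rewrite mulr_ge0 ?pull_ge0.
  have EF := integral_update_theta
    (f := fun t z => s * gain a b t z + (s ^+ 2 + weight i) * r * expz kap z) p01 hA.
  rewrite -EF; last 2 first.
  - by apply: measurable_funD; apply: measurable_funM => //;
      [exact: measurable_gain|exact: measurable_expz].
  - move=> t z t0; apply: addr_ge0; first by rewrite mulr_ge0 ?gain_ge0.
    by apply: mulr_ge0; [exact: mulr_ge0|exact: expR_ge0].
  have mD := measurable_dist_theta i.
  have mwc : measurable_fun setT (fun w => weight i * correct (theta i w) (X i.+1 w)).
    exact: measurable_funM.
  have D0 w : 0 <= dist (theta i w) by exact: dist2_ge0.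
  have wc0 w : 0 <= weight i * correct (theta i w) (X i.+1 w) by exact: mulr_ge0.
  have Js0 w : 0 <= (if J w then 1 else 0) * (s * pull a b (theta i w)).
    by rewrite mulr_ge0// mulr_ge0.
  have JF0 w : 0 <= (if J w then 1 else 0) * F w by rewrite mulr_ge0.
  rewrite -integralZ_real// -!integralD_real//.
  - apply: le_integral_real => //; first exact: measurable_funD.
    + by apply: measurable_funD => //; exact: measurable_funD.
    + by move=> w; apply: addr_ge0; [exact: lyap0|exact: Js0].
  - exact: measurable_funD.
  - by move=> w; apply: addr_ge0.
have h2 := integral_correction_drift hA.
have h3 : ((weight i * (lo i / a))%:E * \int[P]_(w in A) (dist (theta i w))%:E <=
    (weight i)%:E * \int[P]_(w in A) (loss a b (theta i w))%:E)%E.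
  have la0 : 0 <= lo i / a by rewrite divr_ge0// ltW.
  have D0 w : 0 <= dist (theta i w) by exact: dist2_ge0.
  rewrite EFinM -muleA -(integralZ_real P mA (measurable_dist_theta i) D0 la0).
  apply: lee_wpmul2l; first by rewrite lee_fin.
  apply: le_integral_real => //.
  - by apply: measurable_funM => //; exact: measurable_dist_theta.
  - exact: measurable_loss.
  - by move=> w; rewrite mulr_ge0// dist2_ge0.
  - move=> w; apply: dist2_le_loss => //; first by rewrite lo0.
    by case/andP: (theta_bounds i w).
have Qfin : (\int[P]_(w in A) (pull a b (theta i w))%:E)%E \is a fin_num.
  pose B := 2 * hi i * hi i + 6 * a * hi i.
  rewrite ge0_fin_numE; last by apply: integral_ge0 => w _; rewrite lee_fin.
  apply: (@le_lt_trans _ _ (\int[P]_(w in A) B%:E)%E).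
    apply: (le_integral_real P (h := fun=> B)) => // w.
    have /andP[_ th] := theta_bounds i w.
    have t0 := theta_gt0 i w; have hi0 : 0 <= hi i by apply: le_trans th; exact: ltW.
    have b0 : 0 <= b by apply: le_trans ab; exact: ltW.
    have xh : excess b (theta i w) <= hi i.
      by rewrite /excess; case: (leP (theta i w - b) 0) => ?; lra.
    have da : deficit a (theta i w) <= a.
      exact: deficit_le (ltW a0) (ltW t0).
    apply: lerD; apply: ler_pM; rewrite ?mulr_ge0 ?excess_ge0 ?deficit_ge0 ?(ltW t0)//.
    - by rewrite ler_wpM2l.
    - by rewrite ler_wpM2l.
  rewrite integral_cst// ltey_eq; apply/orP; left.
  by rewrite fin_numM// fin_num_measure.
have wQfin : ((weight i)%:E * \int[P]_(w in A) (pull a b (theta i w))%:E)%E \is a fin_num.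
  by rewrite fin_numM.
have hE : (\int[P]_(w in A) (expz kap (X i.+1 w))%:E <= M%:E)%E.
  apply: le_trans hM; apply: ge0_subset_integral => //.
  - by apply/measurable_EFinP.
  - by move=> w _; rewrite lee_fin expR_ge0.
have F_eq : (\int[P]_(w in A) (F w)%:E =
    s%:E * \int[P]_(w in A) (gain a b (theta i w) (X i.+1 w))%:E +
    ((s ^+ 2 + weight i) * r)%:E * \int[P]_(w in A) (expz kap (X i.+1 w))%:E)%E.
  have e0 w : 0 <= expz kap (X i.+1 w) by exact: expR_ge0.
  have K0 : 0 <= (s ^+ 2 + weight i) * r by exact: mulr_ge0.
  rewrite -(integralZ_real P mA mexp e0 K0) -(integralZ_real P mA mgain gain0 s0).
  apply: integralD_real => //; try exact: measurable_funM.
  - by move=> w; exact: mulr_ge0.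
  - by move=> w; exact: mulr_ge0.
have int0 (f : Omega -> R) : (forall w, 0 <= f w) -> (0 <= \int[P]_(w in A) (f w)%:E)%E.
  by move=> f0; apply: integral_ge0 => w _; rewrite lee_fin.
have h1' : (\int[P]_(w in A) (lyapunov i.+1 w)%:E +
    (weight i)%:E * \int[P]_(w in A) (pull a b (theta i w))%:E <=
    \int[P]_(w in A) (dist (theta i w))%:E +
    (weight i)%:E * \int[P]_(w in A) (correct (theta i w) (X i.+1 w))%:E +
    ((weight i)%:E * \int[P]_(w in A) (gain a b (theta i w) (X i.+1 w))%:E +
     (p * ((s ^+ 2 + weight i) * r) * M)%:E))%E.
  rewrite muleA -EFinM (mulrC p) -wE in h1; apply: le_trans h1 _; apply: leeD => //.
  have K0 : 0 <= (s ^+ 2 + weight i) * r by exact: mulr_ge0.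
  have IG0 := int0 _ gain0.
  have IE0 : (0 <= \int[P]_(w in A) (expz kap (X i.+1 w))%:E)%E.
    by apply: int0 => w; exact: expR_ge0.
  rewrite F_eq ge0_muleDr; [|exact: mule_ge0|exact: mule_ge0].
  rewrite muleA -EFinM (mulrC p s) -wE; apply: leeD => //.
  rewrite muleA -EFinM [leRHS]EFinM; apply: lee_wpmul2l => //.
  by rewrite lee_fin; apply: mulr_ge0 => //; exact: mulr_ge0.
have h2' : ((weight i)%:E * \int[P]_(w in A) (correct (theta i w) (X i.+1 w))%:E +
    (weight i)%:E * \int[P]_(w in A) (gain a b (theta i w) (X i.+1 w))%:E +
    (weight i)%:E * \int[P]_(w in A) (loss a b (theta i w))%:E <=
    (weight i)%:E * \int[P]_(w in A) (correct (theta i w) (X i w))%:E +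
    (weight i)%:E * \int[P]_(w in A) (pull a b (theta i w))%:E)%E.
  apply: ereal_scale h2 => //; apply: int0 => w.
  - exact: correct_ge0.
  - exact: gain0.
  - exact: loss_ge0.
  - exact: correct_ge0.
  - exact: pull0.
rewrite [X in (_ <= X + _)%E]integral_lyapunov//.
exact: ereal_cancel wQfin h1' h2' h3.
Qed.

Let b0 : 0 <= b := le_trans ler01 b1.

Lemma dist2_theta_cvg0 (delta : R) : 0 < delta ->
  P (\bigcup_j \bigcap_(i in [set i | (j <= i)%N])
       [set w | dist2 a b (theta i w) < delta]) = 1%E.
Proof.
have [e e0 rates] := step_rates m lo_noninc lo_cvg hi_cvg lo_rate hi_rate cg0 cp0
  heta1 heta2 heta3 etag0 etap0 a0 b0 g0 q0.
have kap0 : 0 <= moment_order k by rewrite addr_ge0.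
have [CM CM0 hCM] := state_moment_rate kap0 e0.
have [B [j0 [B0 hrates]]] := rates CM CM0.
pose V := lyapunov.
pose W i w := dist2 a b (theta i w).
have w0 i : 0 <= weight i := weight_ge0 etag etap cg0 cp0 i.
have th0 i w : 0 < theta i w := theta_gt0 i w.
have cor0 i w : 0 <= correction rho sigma a b g k (theta i w) (X i w).
  by apply: correction_ge0 => //; exact: ltW.
have mexp i : measurable_fun setT (fun w => expz (moment_order k) (X i w)).
  exact: measurable_expz.
have mW i : measurable_fun setT (W i).
  exact: measurableT_comp (measurable_dist2 a b) (mth i).
have W0 i w : 0 <= W i w by exact: dist2_ge0.
have hW i : (j0 <= i)%N -> (\int[P]_w (W i w)%:E <= (2 * hi i.+1 ^+ 2)%:E)%E.
  move=> ji; have [_ [_ _ bh]] := hrates i ji.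
  rewrite -(integral_probability_cst P).
  apply: (le_integral_real P (h := fun=> 2 * hi i.+1 ^+ 2)) => // w.
  have /andP[_ th] := theta_bounds i w.
  apply: dist2_le_hi; [exact: ltW|exact: b0| |exact: le_trans bh].
  by rewrite (ltW (th0 i w)) (le_trans th)// hi_nondec.
have V_W i : (j0 <= i)%N ->
    (\int[P]_w (V i w)%:E <= \int[P]_w (W i w)%:E + (B * i.+1%:R `^ (- e))%:E)%E.
  move=> ji; have [[_ hB _] [_ la bh]] := hrates i ji.
  rewrite (integral_lyapunov i measurableT).
  apply: leeD => //; set S := 2 * hi i.+1 * g + _ in hB.
  have S0 : 0 <= S.
    rewrite addr_ge0// !mulr_ge0 ?expR_ge0 ?(ltW a0)//.
    by apply: le_trans bh; exact: b0.
  have step w : correction rho sigma a b g k (theta i w) (X i w) <=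
      S * expz (moment_order k) (X i w).
    have /andP[lt th] := theta_bounds i w.
    apply: (correction_le g0 k0 q0 a0 ab K_le) => //.
    by rewrite (le_trans _ lt) ?lo_noninc//= (le_trans th)// hi_nondec.
  apply: (@le_trans _ _ ((weight i)%:E * (S%:E * (CM * i.+1%:R `^ e)%:E))%E).
    apply: lee_wpmul2l; first by rewrite lee_fin.
    apply: le_trans (lee_wpmul2l _ (hCM i i (leqnSn i))); last by rewrite lee_fin.
    rewrite -integralZ_real//; last by move=> w; exact: expR_ge0.
    apply: le_integral_real => //; first exact: measurable_correction.
    exact: measurable_funM.
  by rewrite -!EFinM lee_fin.
apply: (@almost_supermartingale_cvg0 R d Omega P (history theta X Gam) _ _ _ _ V W j0
  (fun i => cg * cp / a / i.+1%:R) (fun i => B * i.+1%:R `^ (- (1 + e)))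
  (fun i => B * i.+1%:R `^ (- e))).
- by move=> i A; exact: history_measurable.
- by move=> i; exact: historyT.
- by move=> i A A'; exact: historyI.
- by move=> i A; exact: history_step.
- by move=> i; exact: measurable_lyapunov.
- exact: mW.
- by move=> i w _; exact: W0.
- by move=> i w _; rewrite lerDl mulr_ge0.
- by move=> i c; apply: (@history_theta i i [set t | dist t < c]) => //; exact: measurable_dist2_lt.
- by move=> i; rewrite divr_ge0// divr_ge0 ?mulr_ge0// ltW.
- move=> i A ji hA; have [[hb _ hd] [p1 la bh]] := hrates i ji.
  have drift := integrated_drift hA p1 la bh
    (hCM i i.+1 (leqnn _)).
  apply: le_trans (le_trans drift _).
    apply: leeD => //; apply: lee_wpmul2r; last by rewrite lee_fin.
    by apply: integral_ge0 => w _; rewrite lee_fin.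
  by apply: leeD => //; rewrite lee_fin.
- apply: le_lt_trans (V_W j0 (leqnn _)) _.
  by apply: le_lt_trans (leeD2r _ (hW j0 (leqnn _))) _; rewrite -EFinD ltry.
- exact: V_W.
- by move=> j M; apply: harmonic_dvg; rewrite divr_gt0// mulr_gt0.
- exact: riemann_tail.
- exact: powR_neg_small.
Qed.

End process.

Theorem proposition5p8 (R : realType) (m N : nat) (hm : (0 < m)%N)
    (rho sigma : R) (hrho : -1 < rho < 1) (hsigma : 0 < sigma ^+ 2)
    (y : m.+1.-tuple nat) (hy : (0 < ybar y)%N)
    (lo hi : R^nat)
    (lo_noninc : nonincreasing_seq lo) (lo_cvg : lo @ \oo --> (0 : R))
    (hi_nondec : nondecreasing_seq hi) (hi_cvg : hi @ \oo --> +oo)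
    (lo_rate : limn_einf (fun i => (lo i * ln (i%:R : R))%:E) = +oo%E)
    (hi_rate : forall eps : R, 0 < eps ->
       limn_esup (fun i => (hi i / i%:R `^ eps)%:E) = 0%E)
    (cg cp etag etap : R) (hcg : 0 < cg) (hcp : 0 < cp)
    (hetag : 0 < etag < 1) (hetap : 0 < etap < 1)
    (heta1 : etag + etap < 1) (heta2 : 1 < 2 * etag + etap)
    (heta3 : 1 < etag + 2 * etap) :
  exists c1 c2 : R, 0 < c1 < c2 /\
    forall (theta0 : R) (x0 : pf_state R m N), proj_set lo hi 0 theta0 ->
    forall (d : measure_display) (Omega : measurableType d)
      (P : probability Omega R) (U theta : nat -> {mfun Omega >-> R})
      (X : nat -> {mfun Omega >-> pf_state R m N}),
    pimh_em_process P y rho sigma lo hi cg cp etag etap theta0 x0 U theta X ->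
    P (\bigcup_(k in [set k | (1 <= k)%N]) \bigcap_(i in [set i | (k <= i)%N])
         [set w | c1 <= theta i w <= c2]) = 1%E.
Proof.
have sigma0 : sigma != 0.
  by apply: contraTneq hsigma => ->; rewrite expr0n ltxx.
have [g [k [b [g0 k0 b1 large]]]] := drift_large N sigma0 hrho hy.
have [a1 [q [a10 q0 K_le1 small1]]] := drift_small N sigma0 hrho hy.
pose a := Num.min a1 1.
have a0 : 0 < a by rewrite lt_min a10 ltr01.
have aa1 : a <= a1 by rewrite ge_min lexx.
have ab : a <= b by apply: le_trans b1; rewrite ge_min lexx orbT.
have K_le t : 0 < t <= a -> corrector m N rho sigma t <= expR (q / t).
  by move=> /andP[t0 ta]; apply: K_le1; rewrite t0 (le_trans ta).
have a20 : 0 < a / 2 by rewrite divr_gt0.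
exists (a / 2), (b + a / 2); split.
  by rewrite a20 ltrDr (lt_le_trans _ b1).
move=> theta0 x0 [theta00 theta0E] d Omega P U theta X hP.
have small t (z : pf_state R m N) : 0 < t <= a -> _ :=
  fun h => small1 t z (let: conj t0 ta := andP h in introT andP (conj t0 (le_trans ta aa1))).
have hetag0 : 0 < etag by case/andP: hetag.
have hetap0 : 0 < etap by case/andP: hetap.
have := dist2_theta_cvg0 hP sigma0 hrho lo_noninc lo_cvg hi_nondec hi_cvg lo_rate hi_rate
  theta0E hcg hcp hetag0 hetap0 heta1 heta2 heta3 g0 k0 q0 a0 ab b1 K_le large small
  (exprn_gt0 2 a20).
set E := \bigcup_j _; set E' := \bigcup_(j in _) _ => PE.
have mE : measurable E.
  apply: bigcup_measurable => j _; apply: bigcap_measurable; first by exists j => /=.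
  move=> i _; rewrite -[X in measurable X]setTI.
  rewrite (_ : [set w | _] = theta i @^-1` [set t | dist2 a b t < (a / 2) ^+ 2])//.
  by apply: measurable_funP => //; exact: measurable_dist2_lt.
have mE' : measurable E'.
  apply: bigcup_measurable => j _; apply: bigcap_measurable; first by exists j => /=.
  move=> i _; rewrite -[X in measurable X]setTI.
  rewrite (_ : [set w | _] = theta i @^-1` `[a / 2, b + a / 2]%classic); last first.
    by apply/seteqP; split => w /=; rewrite in_itv.
  exact: measurable_funP.
apply/eqP; rewrite eq_le probability_le1//= -PE; apply: le_measure; rewrite ?inE//.
move=> w [j _ hj]; exists j.+1 => //= i /= ji.
have /= := hj i (ltnW ji); move/(dist2_lt (ltW a20)).
have -> : a - a / 2 = a / 2 by rewrite [X in X - _](splitr a) addrK.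
by [].
Qed.
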